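(* For every closed set $\Lambda \subset \mathbb{S}^n$ one has $$\dim_H(\Lambda) \leq \overline{\dim}_B(\Lambda) = h_c(\Lambda).$$ When $\Lambda = \Lambda(G)$ is the limit set of a non-elementary Kleinian group $G$ acting on $\mathbb{B}^{n+1}$, one has $$\delta(G) \leq \dim_H(\Lambda(G)) \leq \overline{\dim}_B(\Lambda(G)) = h_c(\Lambda(G)).$$
   Context: Let $n\ge 1$. $(\mathbb{B}^{n+1},d)$ is the unit ball model of $(n+1)$-dimensional hyperbolic space, with boundary at infinity the unit sphere $\mathbb{S}^n$; $\mathrm{vol}$ is hyperbolic volume and $B_R(z)$ the hyperbolic ball of centre $z$ and radius $R$. A Kleinian group is a discrete subgroup of the group of orientation preserving isometries of $\mathbb{B}^{n+1}$; its limit set $\Lambda(G)\subset\mathbb{S}^n$ is the set of accumulation points of any $G$-orbit; $G$ is non-elementary if $\Lambda(G)$ has more than two points. The critical exponent is $\delta(G)=\inf\{s>0 : \sum_{g\in G} e^{-s\,d(g(x),z)}<\infty\}$ (independent of $x,z\in\mathbb{B}^{n+1}$). For a closed set $\Lambda\subset\mathbb{S}^n$, the convex hull $H(\Lambda)\subset\mathbb{B}^{n+1}$ is the hyperbolic convex hull of the union of all geodesics both of whose end points lie in $\Lambda$, and $H_\varepsilon(\Lambda)$ is its $\varepsilon$-neighbourhood, $\varepsilon>0$. The convex core entropy of $\Lambda$ is $$h_c(\Lambda)=\limsup_{R\to\infty}\frac{\log \mathrm{vol}(B_R(z)\cap H_\varepsilon(\Lambda))}{R},$$ which is independent of $z\in\mathbb{B}^{n+1}$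 and of $\varepsilon>0$. It satisfies $0\le h_c(\Lambda)\le n$; for $\Lambda$ with at most one point (empty hull) $h_c(\Lambda)$ is taken to be $0$, and all dimensions of the empty set are taken to be $0$. $\dim_H$ is Hausdorff dimension and $\overline{\dim}_B$ is upper box-counting dimension, $\overline{\dim}_B(\Lambda)=\limsup_{\varepsilon\to0}\frac{\log N_\varepsilon(\Lambda)}{-\log\varepsilon}$, with $N_\varepsilon(\Lambda)$ the smallest number of sets of diameter at most $\varepsilon$ covering $\Lambda$, with respect to the spherical (equivalently Euclidean) metric on $\mathbb{S}^n$. *)

(* Defs.v *)
From HB Require Import structures.
From mathcomp Require Import all_boot all_order all_algebra.
From mathcomp Require Import all_classical all_reals all_analysis.

Set Implicit Arguments.
Unset Strict Implicit.
Unset Printing Implicit Defensive.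

Import Order.TTheory GRing.Theory Num.Theory.
Import numFieldNormedType.Exports.

Local Open Scope classical_set_scope.
Local Open Scope ring_scope.
Local Open Scope ereal_scope.

Section lebesgue_tuple.
Context {R : realType}.

(* Lebesgue measure on the Borel sets of R^n, as an iterated product; the library
   puts the product sigma-algebra on [n.-tuple].  Values on other sets are junk. *)
Fixpoint lebesgue_tuple {n : nat} : set (n.-tuple (measurableTypeR R)) -> \bar R :=
  match n return set (n.-tuple (measurableTypeR R)) -> \bar R with
  | 0 => \d_[tuple]
  | m.+1 => pushforward (lebesgue_measure \x @lebesgue_tuple m)
              (fun p : measurableTypeR R * m.-tuple (measurableTypeR R) =>
                 [tuple of p.1 :: p.2])
  end.

End lebesgue_tuple.

Section euclidean.
Context {R : realType} {n : nat}.
Implicit Types (x : 'rV[R]_n) (A U : set 'rV[R]_n).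

(* The library norm on ['rV_n] is the sup norm; it induces the same topology. *)
Definition enorm x : R := Num.sqrt (\sum_(i < n) x ord0 i ^+ 2)%R.

Definition unit_ball : set 'rV[R]_n := [set x | (enorm x < 1)%R].
Definition unit_sphere : set 'rV[R]_n := [set x | enorm x = 1%R].

(* The point 0 is thrown in so that the empty set has diameter 0. *)
Definition ediam U : \bar R :=
  ereal_sup (0 |` [set (enorm (x - y))%:E | x in U & y in U]).

Definition hausdorff_content (s delta : R) A : \bar R :=
  ereal_inf [set \sum_(0 <= i <oo) ediam (U i) `^ s |
    U in [set U : nat -> set 'rV[R]_n |
      A `<=` \bigcup_i U i /\ forall i, ediam (U i) <= delta%:E]].

Definition hausdorff_measure (s : R) A : \bar R :=
  ereal_sup [set hausdorff_content s delta A | delta in [set delta | (0 < delta)%R]].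

(* Restricting to s > 0 does not change the infimum and avoids the convention
   needed for 0 ^ 0 in the s = 0 measure. *)
Definition hausdorff_dim A : \bar R :=
  ereal_inf [set s%:E | s in [set s : R | (0 < s)%R /\ hausdorff_measure s A = 0]].

Definition covering_number (e : R) A : \bar R :=
  ereal_inf [set k%:R%:E | k in [set k : nat |
    exists U : 'I_k -> set 'rV[R]_n,
      A `<=` \bigcup_i U i /\ forall i, ediam (U i) <= e%:E]].

(* By convention the empty set has dimension 0; log 0 would give -oo. *)
Definition upper_box_dim A : \bar R :=
  if A == set0 then 0
  else limf_esup (fun e : R => lne (covering_number e A) / (- ln e)%:E) 0^'+.

End euclidean.

Section hyperbolic.
Context {R : realType} {n : nat}.

(* The (n+1)-dimensional ball model; as a [set_type] it carries the topology
   induced by the Euclidean one, which is that of the hyperbolic metric. *)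
Definition hyp : Type := set_type (@unit_ball R n.+1).

Definition bval (x : hyp) : 'rV[R]_n.+1 := \val x.

Definition arcosh (t : R) : R := ln (t + Num.sqrt (t ^+ 2 - 1))%R.

(* The metric of curvature -1:
   cosh d(x, y) = 1 + 2 |x - y|^2 / ((1 - |x|^2) (1 - |y|^2)). *)
Definition hdist (x y : hyp) : R :=
  arcosh (1 + 2 * enorm (bval x - bval y) ^+ 2 /
    ((1 - enorm (bval x) ^+ 2) * (1 - enorm (bval y) ^+ 2)))%R.

Definition tuple_row (t : n.+1.-tuple (measurableTypeR R)) : 'rV[R]_n.+1 :=
  \row_i tnth t i.

(* The volume form of curvature -1 in the ball model is (2 / (1 - |x|^2))^(n+1) dx. *)
Definition hvol (A : set hyp) : \bar R :=
  \int[@lebesgue_tuple R n.+1]_(t in tuple_row @^-1` (bval @` A))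
    ((2 / (1 - enorm (tuple_row t) ^+ 2)) ^+ n.+1)%R%:E.

Definition hopen_ball (z : hyp) (r : R) : set hyp := [set x | (hdist z x < r)%R].

Definition hneighbourhood (e : R) (A : set hyp) : set hyp :=
  [set x | exists2 y, A y & (hdist x y < e)%R].

Definition geodesic (J : set R) (c : R -> hyp) : Prop :=
  forall s t, J s -> J t -> hdist (c s) (c t) = `|s - t|%R.

Definition hconvex (C : set hyp) : Prop :=
  forall (a b : R) (c : R -> hyp), (a <= b)%R -> geodesic `[a, b] c ->
    C (c a) -> C (c b) -> forall t, t \in `[a, b] -> C (c t).

Definition geodesics_between (L : set 'rV[R]_n.+1) : set hyp :=
  [set p | exists c : R -> hyp, [/\ geodesic setT c,
    (exists2 xi, L xi & bval (c t) @[t --> +oo%R] --> xi),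
    (exists2 eta, L eta & bval (c t) @[t --> -oo%R] --> eta) &
    exists t, p = c t]].

Definition hull (L : set 'rV[R]_n.+1) : set hyp :=
  smallest hconvex (geodesics_between L).

(* The value depends neither on z nor on e > 0; both are kept as parameters.  The
   hull of a set with at most one point is empty, and its entropy is 0 by convention. *)
Definition convex_core_entropy (z : hyp) (e : R) (L : set 'rV[R]_n.+1) : \bar R :=
  if `[< (L #<= `I_1)%card >] then 0
  else limf_esup
    (fun r : R => lne (hvol (hopen_ball z r `&` hneighbourhood e (hull L))) / r%:E)
    (pinfty_nbhs R).

(* [valL_ 0 _] extends a function on the ball by 0; derivatives at points of the
   open ball do not depend on the extension. *)
Definition orientation_preserving (g : hyp -> hyp) : Prop :=
  forall x : hyp, let f : 'rV[R]_n.+1 -> 'rV[R]_n.+1 := valL_ 0%R (bval \o g) in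
    differentiable f (bval x) /\ (0 < \det ('J f (bval x)))%R.

Definition oriented_isometry (g : hyp -> hyp) : Prop :=
  [/\ bijective g, (forall x y, hdist (g x) (g y) = hdist x y) &
      orientation_preserving g].

Definition transformation_group (G : set (hyp -> hyp)) : Prop :=
  [/\ G id, (forall g h, G g -> G h -> G (g \o h)) &
      (forall g, G g -> exists2 h, G h & cancel g h /\ cancel h g)].

(* The isometry group carries the compact-open topology. *)
Definition kleinian (G : set (hyp -> hyp)) : Prop :=
  [/\ transformation_group G, G `<=` oriented_isometry &
      G `<=` @isolated {compact-open, hyp -> hyp} G].

(* [x], and [z] in [critical_exponent], are arbitrary base points. *)
Definition orbit_of (G : set (hyp -> hyp)) (x : hyp) : set hyp :=
  [set g x | g in G].

Definition limit_set (G : set (hyp -> hyp)) (x : hyp) : set 'rV[R]_n.+1 :=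
  unit_sphere `&` limit_point (bval @` orbit_of G x).

Definition non_elementary (G : set (hyp -> hyp)) (x : hyp) : Prop :=
  ~ (limit_set G x #<= `I_2)%card.

Definition critical_exponent (G : set (hyp -> hyp)) (x z : hyp) : \bar R :=
  ereal_inf [set s%:E | s in [set s : R | (0 < s)%R /\
    \esum_(g in G) (expR (- s * hdist (g x) z))%R%:E < +oo]].

End hyperbolic.
Arguments hyp : clear implicits.

(* Main.v *)
From HB Require Import structures.
Require Import Defs.
From mathcomp Require Import all_boot all_order all_algebra.
From mathcomp Require Import all_classical all_reals all_analysis.
From mathcomp Require Import measurable_realfun.
From mathcomp Require Import ring lra.

(* A point p of the hull of Lambda lies within 1 - |p|^2 of Lambda: otherwise a
   hyperbolic half-space, cut out by a linear form of Minkowski space, separates p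
   from Lambda.  So the part of the hull neighbourhood at depth about exp(-k) is
   covered by boundedly many cubes of that size per set of a covering of Lambda at
   scale exp(-k), and each such cube has bounded hyperbolic volume.  Conversely, if
   xi_1, ..., xi_m in Lambda are s-separated, the geodesics issuing from the xi_i
   towards points of Lambda at distance bounded below contain points at depth about
   s near the xi_i, and small balls around these are disjoint.  Hence the volume
   growth of the hull and the covering numbers have the same exponential rate.

   For the critical exponent (Bishop-Jones): if the number of g in G with
   d(0, g 0) in [k, k + 1) is not O(exp(t k)), compactness gives boundary points
   xi, eta such that this remains true for the g with g 0 near xi and g^-1 0 near
   eta.  Since G has no global fixed point on the sphere, composing with one f in G
   separates f xi from eta.  Finitely many of the maps f g, at least exp(t L) of
   them, each moving 0 by at most L, then play ping-pong, and their words converge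
   to a Cantor subset of the limit set on which points whose codings first differ
   at place j are at distance at least c exp(-j L).  Counting cylinders, such a set
   has positive t-dimensional Hausdorff measure. *)

Set Implicit Arguments.
Unset Strict Implicit.
Unset Printing Implicit Defensive.

Import Order.TTheory GRing.Theory Num.Theory.
Import numFieldNormedType.Exports.

Local Open Scope classical_set_scope.
Local Open Scope ring_scope.

(** * The hyperbolic metric of the ball *)

(** No isometry is ever extended to the sphere: fixed points at infinity and the ping-pong are
    phrased with points of the ball, and the Euclidean distortion of an isometry is read off from
    the invariance of |x - y|^2 / ((1 - |x|^2) (1 - |y|^2)). Nor is the hull neighbourhood shown to
    be measurable; its volume is only compared pointwise with finite sums of indicators of cubes.

    The absence of a global fixed point xi rests on the Poisson kernel at xi, which an element
    fixing xi multiplies by a constant. If all these constants are 1, the orbit stays on a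
    horosphere and accumulates only at xi. If some g has another constant, discreteness forces every
    h in G to commute with a power of g and hence to fix a second point eta; the product of the two
    kernels is then constant on the orbit, which accumulates only at xi and eta. Both cases
    contradict non-elementarity.

    The words of the ping-pong accumulate on the sphere because they give pairwise distinct orbit
    points; for this the map f must also keep images off the base point. *)

Section euclidean_norm.
Context {R : realType} {m : nat}.
Implicit Types x y z : 'rV[R]_m.

Definition edot x y : R := \sum_(i < m) x ord0 i * y ord0 i.

Lemma edotC x y : edot x y = edot y x.
Proof. by apply: eq_bigr => i _; rewrite mulrC. Qed.

Lemma edotDl x y z : edot (x + y) z = edot x z + edot y z.
Proof.
by rewrite /edot -big_split; apply: eq_bigr => i _; rewrite !mxE mulrDl.
Qed.

Lemma edotZl a x y : edot (a *: x) y = a * edot x y.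
Proof. by rewrite mulr_sumr; apply: eq_bigr => i _; rewrite !mxE mulrA. Qed.

Lemma edotDr x y z : edot z (x + y) = edot z x + edot z y.
Proof. by rewrite edotC edotDl !(edotC z). Qed.

Lemma edotZr a x y : edot y (a *: x) = a * edot y x.
Proof. by rewrite edotC edotZl (edotC y). Qed.

Lemma edotNl x y : edot (- x) y = - edot x y.
Proof. by rewrite -scaleN1r edotZl mulN1r. Qed.

Lemma edotNr x y : edot y (- x) = - edot y x.
Proof. by rewrite edotC edotNl (edotC y). Qed.

Definition edotE := (edotDl, edotDr, edotNl, edotNr, edotZl, edotZr).

Lemma edot_ge0 x : 0 <= edot x x.
Proof. by apply: sumr_ge0 => i _; rewrite -expr2 sqr_ge0. Qed.

Lemma enorm_sqr x : enorm x ^+ 2 = edot x x.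
Proof.
rewrite /enorm sqr_sqrtr; first by apply: eq_bigr => i _; rewrite expr2.
by apply: sumr_ge0 => i _; rewrite sqr_ge0.
Qed.

Lemma enorm_ge0 x : 0 <= enorm x.
Proof. exact: sqrtr_ge0. Qed.

Lemma edot0l x : edot 0 x = 0.
Proof. by apply: big1 => i _; rewrite mxE mul0r. Qed.

Lemma edot_eq0 x : edot x x = 0 -> x = 0.
Proof.
move=> /eqP; rewrite psumr_eq0 => [/allP h|i _]; last by rewrite -expr2 sqr_ge0.
apply/rowP => i; rewrite mxE; apply/eqP.
by have := h i (mem_index_enum i); rewrite mulf_eq0 orbb.
Qed.

Lemma enorm0 : enorm (0 : 'rV[R]_m) = 0.
Proof. by apply/eqP; rewrite -sqrf_eq0 enorm_sqr edot0l. Qed.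

Lemma enorm_eq0 x : enorm x = 0 -> x = 0.
Proof. by move=> x0; apply: edot_eq0; rewrite -enorm_sqr x0 expr0n. Qed.

Lemma enormN x : enorm (- x) = enorm x.
Proof.
by apply/eqP; rewrite -(@eqrXn2 _ 2) ?enorm_ge0// !enorm_sqr !edotE opprK.
Qed.

Lemma enormB x y : enorm (x - y) = enorm (y - x).
Proof. by rewrite -enormN opprB. Qed.

Lemma enormZ a x : enorm (a *: x) = `|a| * enorm x.
Proof.
apply/eqP; rewrite -(@eqrXn2 _ 2) ?mulr_ge0 ?enorm_ge0//.
by rewrite exprMn !enorm_sqr !edotE real_normK ?num_real// expr2 mulrA.
Qed.

End euclidean_norm.

(** The discriminant of a nonnegative binary quadratic form. At (c, -b) the form is c (a c - b^2);
    when c = 0 and b is nonzero it takes the value -1. Serves both the Euclidean scalar product and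
    the Minkowski form on the orthogonal of a time-like vector. *)
Lemma psd_cauchy_schwarz {R : realFieldType} (a b c : R) :
  (forall s t, 0 <= s ^+ 2 * a + 2 * s * t * b + t ^+ 2 * c) ->
  b ^+ 2 <= a * c.
Proof.
move=> h; have c0 : 0 <= c by have := h 0 1; nra.
have [c0'|c0'] := eqVneq c 0; last first.
  have cp : 0 < c by rewrite lt_neqAle eq_sym c0' c0.
  have := h c (- b); have -> : c ^+ 2 * a + 2 * c * (- b) * b + (- b) ^+ 2 * c =
     c * (a * c - b ^+ 2) by ring.
  by rewrite pmulr_rge0// subr_ge0.
rewrite c0' mulr0; have [->|b0] := eqVneq b 0; first by rewrite expr0n.
have := h 1 (- (a + 1) / (2 * b)); rewrite c0'.
have -> : 1 ^+ 2 * a + 2 * 1 * (- (a + 1) / (2 * b)) * b +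
   (- (a + 1) / (2 * b)) ^+ 2 * 0 = -1 by field.
by rewrite ler0N1.
Qed.

Section euclidean_triangle.
Context {R : realType} {m : nat}.
Implicit Types x y z : 'rV[R]_m.

Lemma edot_cauchy x y : edot x y ^+ 2 <= edot x x * edot y y.
Proof.
apply: psd_cauchy_schwarz => s t.
have := edot_ge0 (s *: x + t *: y); rewrite !edotE (edotC y x); nra.
Qed.

Lemma edot_le x y : edot x y <= enorm x * enorm y.
Proof.
have h := mulr_ge0 (enorm_ge0 x) (enorm_ge0 y).
apply: le_trans (ler_norm _) _.
rewrite -(@ler_pXn2r _ 2) ?nnegrE//.
by rewrite real_normK ?num_real// exprMn !enorm_sqr edot_cauchy.
Qed.

Lemma enormD x y : enorm (x + y) <= enorm x + enorm y.
Proof.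
have hx := enorm_ge0 x; have hy := enorm_ge0 y.
rewrite -(@ler_pXn2r _ 2) ?nnegrE ?enorm_ge0 ?addr_ge0//.
rewrite enorm_sqr !edotE (edotC y x) sqrrD !enorm_sqr.
have := edot_le x y; lra.
Qed.

Lemma enorm_triangle x y z : enorm (x - z) <= enorm (x - y) + enorm (y - z).
Proof. by have := enormD (x - y) (y - z); rewrite addrA subrK. Qed.

Lemma enorm_dist x y : `|enorm x - enorm y| <= enorm (x - y).
Proof.
have h1 := enorm_triangle x y 0; have h2 := enorm_triangle y x 0.
rewrite !subr0 in h1 h2; rewrite (enormB y x) in h2.
by rewrite ler_norml; apply/andP; split; lra.
Qed.

Lemma coord_le_enorm x i : `|x ord0 i| <= enorm x.
Proof.
rewrite -(@ler_pXn2r _ 2) ?nnegrE ?enorm_ge0//.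
rewrite real_normK ?num_real// enorm_sqr /edot (bigD1 i)//= -expr2 lerDl.
by apply: sumr_ge0 => j _; rewrite -expr2 sqr_ge0.
Qed.

Lemma norm_le_enorm x : `|x| <= enorm x.
Proof.
rewrite [`|x|]mx_normrE; apply/bigmax_leP; split=> [|[i j] _ /=].
  exact: enorm_ge0.
by rewrite ord1 coord_le_enorm.
Qed.

Lemma coord_le_norm x i : `|x ord0 i| <= `|x|.
Proof.
by rewrite [leRHS]mx_normrE (le_bigmax _ (fun ij => `|x ij.1 ij.2|) (ord0, i)).
Qed.

Lemma enorm_le_coord x (r : R) : 0 <= r ->
  (forall i, `|x ord0 i| <= r) -> enorm x <= m%:R * r.
Proof.
move=> r0 h; rewrite -(@ler_pXn2r _ 2) ?nnegrE ?enorm_ge0 ?mulr_ge0//.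
rewrite enorm_sqr; apply: (@le_trans _ _ (\sum_(i < m) r ^+ 2)).
  apply: ler_sum => i _; rewrite -expr2 -[_ ^+ 2]real_normK ?num_real//.
  by rewrite ler_pXn2r ?nnegrE.
rewrite sumr_const card_ord -[leLHS]mulr_natl exprMn ler_wpM2r ?sqr_ge0//.
by rewrite -natrX ler_nat; case: m => [|k]//; rewrite leq_pmulr.
Qed.

Lemma enorm_le_norm x : enorm x <= m%:R * `|x|.
Proof. by apply: enorm_le_coord => // i; exact: coord_le_norm. Qed.

Lemma nbhs_enormP x (U : set 'rV[R]_m) :
  nbhs x U <-> exists2 e, 0 < e & forall y, enorm (y - x) < e -> U y.
Proof.
split=> [/nbhs_ballP[e /= e0 eU]|[e e0 eU]].
  exists e => // y yx; apply: eU; rewrite mx_norm_ball /= /ball_/=.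
  by rewrite (le_lt_trans (norm_le_enorm _))// enormB.
apply/nbhs_ballP; exists (e / (m%:R + 1)) => /=; first by rewrite divr_gt0.
move=> y; rewrite mx_norm_ball /= /ball_/= => xy; apply: eU.
rewrite enormB (le_lt_trans (enorm_le_norm _))//.
move: xy; rewrite ltr_pdivlMr//; apply: le_lt_trans.
by rewrite mulrC ler_wpM2l// lerDl.
Qed.

Lemma near_enorm x e : 0 < e -> \forall y \near x, enorm (y - x) < e.
Proof. by move=> e0; apply/nbhs_enormP; exists e. Qed.

Lemma enorm_continuous : continuous (@enorm R m).
Proof.
move=> x U /nbhs_ballP[e /= e0 eU]; apply/nbhs_enormP; exists e => // y yx.
by apply: eU; rewrite /ball/= (le_lt_trans (enorm_dist _ _))// enormB.
Qed.

End euclidean_triangle.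

Section hyperbolic_functions.
Context {R : realType}.
Implicit Types s t : R.

Definition hcosh t : R := (expR t + expR (- t)) / 2.
Definition hsinh t : R := (expR t - expR (- t)) / 2.

Lemma hcoshE t : hcosh t = (expR t + expR (- t)) / 2.
Proof. by []. Qed.

Lemma hsinhE t : hsinh t = (expR t - expR (- t)) / 2.
Proof. by []. Qed.

Lemma hcoshN t : hcosh (- t) = hcosh t.
Proof. by rewrite /hcosh opprK addrC. Qed.

Lemma hcosh0 : hcosh 0 = 1.
Proof. by rewrite /hcosh oppr0 expR0; field. Qed.

Lemma hcosh_norm t : hcosh `|t| = hcosh t.
Proof. by have [//|//] := ger0P t; rewrite hcoshN. Qed.

Lemma hcoshD s t : hcosh (s + t) = hcosh s * hcosh t + hsinh s * hsinh t.
Proof. by rewrite /hcosh /hsinh opprD !expRD; field. Qed.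

Lemma hsinh_sqr t : hsinh t ^+ 2 = hcosh t ^+ 2 - 1.
Proof.
rewrite /hcosh /hsinh expRN; have := expR_gt0 t => h; field.
by rewrite gt_eqF.
Qed.

Lemma hcosh_lt s t : 0 <= s -> s < t -> hcosh s < hcosh t.
Proof.
move=> s0 st; rewrite /hcosh ltr_pM2r ?invr_gt0// !expRN.
have h1 : 1 <= expR s by rewrite -expR0 ler_expR.
have h2 : expR s < expR t by rewrite ltr_expR.
rewrite -subr_gt0.
have -> : expR t + (expR t)^-1 - (expR s + (expR s)^-1) =
  (expR t - expR s) * (1 - (expR s * expR t)^-1).
  by field; rewrite !gt_eqF ?expR_gt0.
apply: mulr_gt0; rewrite subr_gt0// invf_lt1; nra.
Qed.

Lemma hcosh_le s t : 0 <= s -> s <= t -> hcosh s <= hcosh t.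
Proof.
by move=> s0; rewrite le_eqVlt => /predU1P[->//|/hcosh_lt-/(_ s0)/ltW].
Qed.

Lemma hcosh_le_inv s t : 0 <= t -> hcosh s <= hcosh t -> s <= t.
Proof. by move=> t0; apply: contraTT; rewrite -!ltNge => /hcosh_lt; apply. Qed.

Lemma hcosh_inj s t : 0 <= s -> 0 <= t -> hcosh s = hcosh t -> s = t.
Proof.
move=> s0 t0 e; apply/eqP; rewrite eq_le.
by apply/andP; split; apply: hcosh_le_inv; rewrite // e.
Qed.

Lemma hsinh_ge0 t : 0 <= t -> 0 <= hsinh t.
Proof.
by move=> t0; rewrite /hsinh mulr_ge0 ?invr_ge0// subr_ge0 ler_expR; lra.
Qed.

Lemma hsinh_gt0 t : 0 < t -> 0 < hsinh t.
Proof.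
by move=> t0; rewrite /hsinh mulr_gt0 ?invr_gt0// subr_gt0 ltr_expR; lra.
Qed.

Lemma hcosh_ge1 t : 1 <= hcosh t.
Proof. by rewrite -hcosh_norm -hcosh0 hcosh_le. Qed.

Lemma hcosh_arcosh t : 1 <= t -> hcosh (arcosh t) = t.
Proof.
move=> t1; have t2 : 0 <= t ^+ 2 - 1 by nra.
have h := sqr_sqrtr t2; have s0 := sqrtr_ge0 (t ^+ 2 - 1).
rewrite /hcosh /arcosh expRN lnK ?posrE; last by lra.
set s := Num.sqrt _ in h s0 *.
have -> : (t + s)^-1 = t - s.
  by apply: (@mulfI _ (t + s)); [rewrite gt_eqF//; lra|rewrite divff ?gt_eqF//; lra || nra].
by field.
Qed.

Lemma arcosh_ge0 t : 1 <= t -> 0 <= arcosh t.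
Proof. by move=> t1; apply: ln_ge0; have := sqrtr_ge0 (t ^+ 2 - 1); lra. Qed.

End hyperbolic_functions.

(** * Minkowski space and the hyperboloid *)

Section minkowski.
Context {R : realType} {m : nat}.
Implicit Types A B C w : 'rV[R]_m.

(** The orthogonal of the time-like vector (t, B) is space-like: w0 t = <w, B> and Cauchy-Schwarz
    give w0^2 t^2 <= |w|^2 (t^2 - 1). The equality case identifies points of geodesics in
    [mink_segment]. *)
Lemma mink_orthogonal (w0 t : R) w B :
  0 < t -> edot B B = t ^+ 2 - 1 -> w0 * t = edot w B ->
  w0 ^+ 2 <= edot w w /\ (w0 ^+ 2 = edot w w -> w0 = 0 /\ w = 0).
Proof.
move=> t0 BB h; have := edot_cauchy w B; rewrite -h BB exprMn => h1.
have t1 : 0 < t ^+ 2 by rewrite exprn_gt0.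
have w0ge := sqr_ge0 w0; have wge := edot_ge0 w.
split; first by rewrite -(ler_pM2r t1); apply: le_trans h1 _; nra.
move=> e; have w00 : w0 ^+ 2 = 0 by nra.
split; first by apply/eqP; rewrite -sqrf_eq0 w00.
by apply: edot_eq0; rewrite -e.
Qed.

(** Gram determinant of the projections of A and C to the orthogonal of B, where the form is
    definite; a, b, c stand for the hyperbolic cosines of the three distances. *)
Lemma mink_gram (ta tb tc a b c : R) A B C : 0 < tb ->
  edot A A = ta ^+ 2 - 1 -> edot B B = tb ^+ 2 - 1 -> edot C C = tc ^+ 2 - 1 ->
  edot A B = ta * tb - a -> edot B C = tb * tc - b -> edot A C = ta * tc - c ->
  (a * b - c) ^+ 2 <= (a ^+ 2 - 1) * (b ^+ 2 - 1).
Proof.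
move=> tb0 AA BB CC AB BC AC; apply: psd_cauchy_schwarz => s t.
pose w := s *: (A - a *: B) + t *: (C - b *: B).
pose w0 := s * (ta - a * tb) + t * (tc - b * tb).
have e : edot w w - w0 ^+ 2 =
   s ^+ 2 * (a ^+ 2 - 1) + 2 * s * t * (a * b - c) + t ^+ 2 * (b ^+ 2 - 1).
  rewrite /w /w0 !edotE AA BB CC (edotC C A) (edotC C B) (edotC B A) AB BC AC.
  by ring.
rewrite -e subr_ge0; apply: (proj1 (mink_orthogonal tb0 BB _)).
by rewrite /w /w0 !edotE BB (edotC C B) AB BC; ring.
Qed.

End minkowski.

Section ball_metric.
Context {R : realType} {n : nat}.
Implicit Types (x y z : hyp R n) (r : R).

(** This gives the conformal factor 2 / [om] and measures depth: [om x] is exp(-d(0, x)) up to a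
    factor 4 ([om_ge], [om_le]). *)
Definition om x : R := 1 - enorm (bval x) ^+ 2.

(** This is sinh^2(d / 2), rational in the coordinates; isometries are used through its
    invariance. *)
Definition hq x y : R := enorm (bval x - bval y) ^+ 2 / (om x * om y).

Lemma bval_lt1 x : enorm (bval x) < 1.
Proof. by have := set_valP x. Qed.

Lemma om_gt0 x : 0 < om x.
Proof.
by have := bval_lt1 x; have := enorm_ge0 (bval x); rewrite /om; nra.
Qed.

Lemma om_neq0 x : om x != 0.
Proof. by rewrite gt_eqF ?om_gt0. Qed.

Lemma om_le1 x : om x <= 1.
Proof. by have := sqr_ge0 (enorm (bval x)); rewrite /om; lra. Qed.

Definition hpoint (v : 'rV[R]_n.+1) (v1 : enorm v < 1) : hyp R n :=
  exist _ v (mem_set v1).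

Lemma hpointK v v1 : bval (@hpoint v v1) = v.
Proof. by []. Qed.

Definition horigin : hyp R n :=
  hpoint (eq_ind_r (fun r => r < 1) ltr01 enorm0).

Lemma horiginE : bval horigin = 0.
Proof. by []. Qed.

Lemma om_horigin : om horigin = 1.
Proof. by rewrite /om horiginE enorm0 expr0n subr0. Qed.

Lemma hq_ge0 x y : 0 <= hq x y.
Proof. by rewrite divr_ge0 ?sqr_ge0// mulr_ge0// ltW// om_gt0. Qed.

Lemma hqC x y : hq x y = hq y x.
Proof. by rewrite /hq enormB (mulrC (om x)). Qed.

Lemma hdistE x y : hdist x y = arcosh (1 + 2 * hq x y).
Proof. by rewrite /hdist /hq mulrA. Qed.

#[global] Opaque hdist arcosh hcosh hsinh.

Lemma hcosh_hdist x y : hcosh (hdist x y) = 1 + 2 * hq x y.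
Proof. by rewrite hdistE hcosh_arcosh//; have := hq_ge0 x y; lra. Qed.

Lemma hdist_ge0 x y : 0 <= hdist x y.
Proof. by rewrite hdistE arcosh_ge0//; have := hq_ge0 x y; lra. Qed.

Lemma hdistC x y : hdist x y = hdist y x.
Proof. by rewrite !hdistE hqC. Qed.

Lemma hdistxx x : hdist x x = 0.
Proof.
apply: hcosh_inj; rewrite ?hdist_ge0// hcosh_hdist hcosh0 /hq subrr enorm0.
by rewrite expr0n mul0r mulr0 addr0.
Qed.

Lemma hdist_eq_hq x y x' y' : hdist x y = hdist x' y' -> hq x y = hq x' y'.
Proof.
by move=> /(congr1 hcosh); rewrite !hcosh_hdist => /addrI/mulfI; apply.
Qed.

(* The point (mT x, mV x) of the hyperboloid corresponds to x; mV is locked so that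
   bilinearity of edot does not see through it. *)
Definition mT x : R := (1 + enorm (bval x) ^+ 2) / om x.
Definition mV x : 'rV[R]_n.+1 := locked ((2 / om x) *: bval x).

Lemma mTE x : mT x = (1 + enorm (bval x) ^+ 2) / om x.
Proof. by []. Qed.

Lemma mVE x : mV x = (2 / om x) *: bval x.
Proof. by rewrite /mV -lock. Qed.

Lemma mink_hdist x y :
  edot (mV x) (mV y) = mT x * mT y - hcosh (hdist x y).
Proof.
rewrite hcosh_hdist /hq /mT !mVE !enorm_sqr !edotE (edotC (bval y) (bval x)).
have := om_neq0 x; have := om_neq0 y; rewrite /om !enorm_sqr => hx hy.
by field; rewrite hx.
Qed.

Lemma mink_self x : edot (mV x) (mV x) = mT x ^+ 2 - 1.
Proof. by rewrite mink_hdist hdistxx hcosh0 expr2. Qed.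

Lemma mT_gt0 x : 0 < mT x.
Proof.
by rewrite divr_gt0 ?om_gt0// ltr_wpDr ?sqr_ge0.
Qed.

#[global] Opaque mT mV.

(** With a, b, c the hyperbolic cosines, [mink_gram] bounds |a b - c| by the product of the
    hyperbolic sines, so c is at most the hyperbolic cosine of the sum. *)
Lemma hdist_triangle x y z : hdist x z <= hdist x y + hdist y z.
Proof.
apply: hcosh_le_inv; first by rewrite addr_ge0 ?hdist_ge0.
have s0 : 0 <= hsinh (hdist x y) * hsinh (hdist y z).
  by rewrite mulr_ge0// hsinh_ge0 ?hdist_ge0.
have := mink_gram (mT_gt0 y) (mink_self x) (mink_self y) (mink_self z)
  (mink_hdist x y) (mink_hdist y z) (mink_hdist x z).
have := hsinh_sqr (hdist x y); have := hsinh_sqr (hdist y z).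
have := hcoshD (hdist x y) (hdist y z).
move: (hcosh (_ + _)) (hcosh (hdist x y)) (hcosh (hdist y z)) => e a b.
move: (hcosh _) (hsinh (hdist x y)) (hsinh (hdist y z)) s0 => c u v s0 -> ev eu.
rewrite -eu -ev -exprMn; move: (u * v) s0 => s; nra.
Qed.

Lemma om_hdist x : (om x)^-1 = (1 + hcosh (hdist horigin x)) / 2.
Proof.
have -> : hcosh (hdist horigin x) = 1 + 2 * (enorm (bval x) ^+ 2 / om x).
  by rewrite hcosh_hdist /hq om_horigin mul1r horiginE sub0r enormN.
have := om_neq0 x; rewrite /om; move: (enorm (bval x)) => a h.
by field.
Qed.

Lemma expR_om x : expR (hdist horigin x) / 4 <= (om x)^-1 <= expR (hdist horigin x).
Proof.
rewrite om_hdist hcoshE; set d := hdist _ _.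
have d1 : 1 <= expR d by rewrite -expR0 ler_expR hdist_ge0.
have d2 : expR (- d) <= 1 by rewrite -expR0 ler_expR lerNl oppr0 hdist_ge0.
by have := expR_gt0 (- d) => d3; apply/andP; split; lra.
Qed.

Lemma omE x : om x = 1 - enorm (bval x) ^+ 2.
Proof. by []. Qed.

#[global] Opaque om.

Lemma om_ge x : expR (- hdist horigin x) <= om x.
Proof.
have /andP[_ h] := expR_om x.
by rewrite expRN -(invrK (om x)) lef_pV2 ?posrE ?expR_gt0 ?invr_gt0 ?om_gt0.
Qed.

Lemma om_le x : om x <= 4 * expR (- hdist horigin x).
Proof.
have /andP[h _] := expR_om x.
rewrite expRN -(invrK (om x)) -(invrK 4) -invfM lef_pV2 ?posrE.
- by rewrite mulrC.
- by rewrite invr_gt0 om_gt0.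
- by rewrite mulr_gt0 ?expR_gt0// invr_gt0.
Qed.

Lemma om_ratio x y l : hdist horigin y <= hdist horigin x + l -> 0 <= l ->
  om x <= expR l * om y.
Proof.
move=> h l0; have ox := om_gt0 x; have oy := om_gt0 y.
have hc : hcosh (hdist horigin y) <= hcosh (hdist horigin x + l).
  by rewrite hcosh_le ?hdist_ge0.
have el : 1 <= expR l by rewrite -expR0 ler_expR.
have el' : expR (- l) <= expR l by rewrite ler_expR; lra.
have hl : (om y)^-1 <= expR l * (om x)^-1.
  rewrite !om_hdist; move: hc; rewrite !hcoshE opprD !expRD.
  have := expR_gt0 (hdist horigin x); have := expR_gt0 (- hdist horigin x).
  set u := expR (hdist _ _); set v := expR (- hdist _ _) => v0 u0 hc.
  have : v * expR (- l) <= v * expR l by rewrite ler_wpM2l// ltW.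
  by lra.
have := ler_wpM2r (ltW ox) hl; rewrite mulfVK ?om_neq0// => h2.
by have := ler_wpM2r (ltW oy) h2; rewrite mulrAC mulVf ?om_neq0// mul1r.
Qed.

End ball_metric.

(** * Euclidean distortion of isometries *)

Section isometries.
Context {R : realType} {n : nat}.
Implicit Types (x y z p : hyp R n) (g : hyp R n -> hyp R n) (r c l : R).

Local Notation o0 := (@horigin R n).

Lemma om_inv_hq x : (om x)^-1 = 1 + hq o0 x.
Proof. by rewrite om_hdist hcosh_hdist; field. Qed.

Lemma enorm_hq x y : enorm (bval x - bval y) ^+ 2 = hq x y * om x * om y.
Proof. by rewrite /hq -mulrA divfK ?mulf_neq0 ?om_neq0. Qed.

Definition isometric g := forall x y, hdist (g x) (g y) = hdist x y.

Lemma isometric_hq g x y : isometric g -> hq (g x) (g y) = hq x y.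
Proof. by move=> gi; apply: hdist_eq_hq. Qed.

Lemma isometric_enorm g x y : isometric g ->
  enorm (bval (g x) - bval (g y)) ^+ 2 * om x * om y =
  enorm (bval x - bval y) ^+ 2 * om (g x) * om (g y).
Proof. by move=> gi; rewrite !enorm_hq isometric_hq//; ring. Qed.

Lemma isometric_om g x : isometric g -> om x <= expR (hdist o0 (g o0)) * om (g x).
Proof.
move=> gi; apply: om_ratio; last exact: hdist_ge0.
by rewrite addrC -(gi o0 x) hdist_triangle.
Qed.

(** The distortion formula [isometric_enorm] combined with [isometric_om] at both points. As a lower
    bound for the image distance, it keeps images of separated points separated. *)
Lemma isometric_lipschitz g x y : isometric g ->
  enorm (bval x - bval y) <=
  expR (hdist o0 (g o0)) * enorm (bval (g x) - bval (g y)).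
Proof.
move=> gi; have := isometric_om x gi; have := isometric_om y gi.
have := isometric_enorm x y gi.
have := enorm_ge0 (bval x - bval y).
have := enorm_ge0 (bval (g x) - bval (g y)).
have := expR_gt0 (hdist o0 (g o0)).
have := om_gt0 x; have := om_gt0 y; have := om_gt0 (g x); have := om_gt0 (g y).
move: (enorm _) (enorm _) (expR _) (om x) (om y) (om (g x)) (om (g y)).
move=> b a E u v u' v' v'0 u'0 v0 u0 E0 a0 b0 e hv hu.
rewrite -(@ler_pXn2r _ 2) ?nnegrE ?mulr_ge0//; last exact: ltW.
have uv : 0 < u' * v' by rewrite mulr_gt0.
rewrite -(ler_pM2r uv) [leLHS]mulrA -e.
have -> : (E * a) ^+ 2 * (u' * v') = a ^+ 2 * ((E * u') * (E * v')) by ring.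
rewrite -mulrA ler_wpM2l ?sqr_ge0// ler_pM// ltW//.
Qed.

(** Here p is g^-1 0. The distortion formula for x and 0, with om (g 0) = om p and 1 / om (g x) = 1
    + hq x p, shows that points far from p land near g 0. *)
Lemma isometric_contract g x p : isometric g -> g p = o0 ->
  enorm (bval (g x) - bval (g o0)) * enorm (bval x - bval p) <= om p.
Proof.
move=> gi gp.
have e0 : om (g o0) = om p.
  apply: invr_inj; rewrite !om_inv_hq -{1}gp isometric_hq//.
  by rewrite hqC.
have e1 : (om (g x))^-1 = 1 + enorm (bval x - bval p) ^+ 2 / (om x * om p).
  by rewrite om_inv_hq -gp isometric_hq// hqC.
have e2 := isometric_enorm x o0 gi; rewrite om_horigin mulr1 e0 in e2.
have x1 : enorm (bval x - bval o0) ^+ 2 <= 1.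
  rewrite subr0; have := bval_lt1 x; have := enorm_ge0 (bval x); nra.
move: e1 e2 x1 (om_gt0 x) (om_gt0 p) (om_gt0 (g x)).
have := enorm_ge0 (bval x - bval p).
have := enorm_ge0 (bval (g x) - bval (g o0)).
move: (enorm (bval x - bval p)) (enorm (bval (g x) - bval (g o0))).
move: (enorm _ ^+ 2) (om x) (om p) (om (g x)) => a u v w b c c0 b0 e1 e2 a1 u0 v0 w0.
have uv : u * v = w * (u * v + b ^+ 2).
  have uv0 : u * v != 0 by rewrite mulf_neq0// gt_eqF.
  have h : w^-1 * (u * v) = u * v + b ^+ 2 by rewrite e1 mulrDl mul1r divfK.
  by rewrite -h mulrA mulfV ?mul1r// gt_eqF.
rewrite -(@ler_pXn2r _ 2) ?nnegrE ?mulr_ge0//; last exact: ltW.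
rewrite -(ler_pM2r u0) exprMn mulrAC e2.
have wb : w * b ^+ 2 <= u * v.
  by rewrite [leRHS]uv mulrDr lerDr !mulr_ge0// ltW.
have -> : a * w * v * b ^+ 2 = a * v * (w * b ^+ 2) by ring.
apply: (@le_trans _ _ (a * v * (u * v))); first by rewrite ler_wpM2l//; nra.
have -> : a * v * (u * v) = a * (v ^+ 2 * u) by ring.
have : 0 <= v ^+ 2 * u by rewrite mulr_ge0 ?sqr_ge0// ltW.
nra.
Qed.

Lemma enorm_le_hdist x y r : hdist x y <= r ->
  enorm (bval x - bval y) <= expR r * om x /\ om y <= expR r * om x.
Proof.
move=> xy.
have r0 : 0 <= r by apply: le_trans xy; exact: hdist_ge0.
have h1 : om y <= expR r * om x.
  apply: om_ratio => //; apply: le_trans (hdist_triangle _ y _) _.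
  by rewrite lerD2l hdistC.
split=> //.
have E1 : 1 <= expR r by rewrite -expR0 ler_expR.
have h2 : hq x y <= expR r.
  have : hcosh (hdist x y) <= hcosh r by apply: hcosh_le => //; exact: hdist_ge0.
  rewrite hcosh_hdist [hcosh r]hcoshE.
  have : expR (- r) <= 1 by rewrite -expR0 ler_expR; lra.
  lra.
have := om_gt0 x; have := om_gt0 y => y0 x0.
have h0 : 0 <= expR r * om x by rewrite mulr_ge0 ?expR_ge0 ?ltW.
rewrite -(@ler_pXn2r _ 2) ?nnegrE ?enorm_ge0//.
rewrite enorm_hq; have -> : (expR r * om x) ^+ 2 = (expR r * om x) * (expR r * om x).
  by rewrite expr2.
apply: ler_pM => //; last by rewrite ler_wpM2r// ltW.
- by rewrite mulr_ge0 ?hq_ge0// ltW.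
- exact: ltW.
Qed.

Lemma enorm_lt1_near x (v : 'rV[R]_n.+1) :
  enorm (bval x - v) <= om x / 4 -> enorm v < 1.
Proof.
move=> h; have h1 := enorm_dist (bval x) v; have h2 := bval_lt1 x.
have := enorm_ge0 (bval x); rewrite omE in h => h3.
have : enorm v <= enorm (bval x) + (1 - enorm (bval x) ^+ 2) / 4.
  by move: h1; rewrite ler_norml => /andP[]; lra.
by nra.
Qed.

Lemma om_near x y c : c <= 1 / 4 ->
  enorm (bval x - bval y) <= c * om x -> om x / 2 <= om y <= 3 / 2 * om x.
Proof.
move=> c4 h; have h1 := enorm_dist (bval x) (bval y).
have hx := bval_lt1 x; have hy := bval_lt1 y.
have hx0 := enorm_ge0 (bval x); have hy0 := enorm_ge0 (bval y).
have ox := om_gt0 x.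
have : `|enorm (bval x) - enorm (bval y)| <= om x / 4.
  by apply: le_trans h1 (le_trans h _); nra.
rewrite ler_norml => /andP[h2 h3].
have := omE x; have := omE y => ey ex; apply/andP; split; nra.
Qed.

Lemma hdist_lt_of_enorm r : 0 < r -> exists2 c, 0 < c <= 1 / 4 &
  forall x y, enorm (bval x - bval y) <= c * om x -> hdist x y < r.
Proof.
move=> r0; have h : 1 < hcosh r by rewrite -hcosh0 hcosh_lt.
(* Since c <= 1/4, om y >= om x / 2 and so hq <= 2 c^2; then cosh d <= 1 + 4 c^2 <= 1 + c < cosh
   r. *)
pose c := Num.min (1 / 4) ((hcosh r - 1) / 2).
have c0 : 0 < c by rewrite lt_min; apply/andP; split; lra.
have c4 : c <= 1 / 4 by rewrite ge_min lexx.
have cr : c <= (hcosh r - 1) / 2 by rewrite ge_min lexx orbT.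
exists c => [|x y xy]; first by rewrite c0.
have /andP[oy _] := om_near c4 xy; have ox := om_gt0 x; have oy0 := om_gt0 y.
rewrite ltNge; apply/negP => /(hcosh_le (ltW r0)).
rewrite hcosh_hdist leNgt => /negP; apply.
suff : hq x y <= 2 * c ^+ 2 by nra.
rewrite /hq ler_pdivrMr ?mulr_gt0//.
have : enorm (bval x - bval y) ^+ 2 <= (c * om x) ^+ 2.
  by rewrite ler_pXn2r ?nnegrE ?enorm_ge0// mulr_ge0// ltW.
move/le_trans; apply; rewrite exprMn.
have : 0 <= c ^+ 2 by rewrite sqr_ge0.
have : om x ^+ 2 <= 2 * (om x * om y) by nra.
by move=> *; nra.
Qed.

Lemma hdist_le_hq x y (K : R) : hq x y <= K -> hdist x y <= arcosh (1 + 2 * K).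
Proof.
move=> h; have h0 := hq_ge0 x y.
have K1 : 1 <= 1 + 2 * K by lra.
apply: hcosh_le_inv; first exact: arcosh_ge0.
by rewrite (hcosh_arcosh K1) hcosh_hdist; lra.
Qed.

End isometries.

(** * Volume *)

Section pointwise_monotonicity.
Local Open Scope ereal_scope.
Context d (T : measurableType d) {R : realType} (mu : {measure set T -> \bar R}).

(* No measurability: the integral of a nonnegative function is a supremum over
   the simple functions below it. *)
Lemma ge0_le_integral_pointwise (f g : T -> \bar R) :
  (forall x, 0 <= f x) -> (forall x, f x <= g x) ->
  \int[mu]_x f x <= \int[mu]_x g x.
Proof.
move=> f0 fg; rewrite !ge0_integralTE// => [|x]; last exact: le_trans (fg x).
apply: ereal_sup_le => _ [h /= hf <-].
by exists h => // x; exact: le_trans (fg x).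
Qed.

End pointwise_monotonicity.

Section lebesgue_tuple_measure.
Local Open Scope ereal_scope.
Context {R : realType}.
Local Notation T := (measurableTypeR R).

Definition cube {m : nat} (a : 'I_m -> R) (r : R) : set (m.-tuple T) :=
  [set t | forall i, (`|tnth t i - a i| <= r)%R].

Lemma measurable_cube m (a : 'I_m -> R) (r : R) : measurable (cube a r).
Proof.
have -> : cube a r =
    \bigcap_(i in [set: 'I_m]) ((@tnth m T ^~ i) @^-1` [set` `[a i - r, a i + r]%R]).
  apply/seteqP; split=> t /= h i.
    by move=> _; rewrite /= in_itv/= -ler_distl; exact: h.
  by have := h i I; rewrite /= in_itv/= -ler_distl.
apply: fin_bigcap_measurable => [|i _]; first exact: finite_finset.
rewrite -[X in measurable X]setTI; exact: measurable_tnth.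
Qed.

Section step.
Context {m : nat} (mu : {sigma_finite_measure set (m.-tuple T) -> \bar R}).

Definition tuple_cons (p : T * m.-tuple T) : m.+1.-tuple T :=
  [tuple of p.1 :: p.2].

Lemma measurable_tuple_cons : measurable_fun setT tuple_cons.
Proof. exact: measurable_cons. Qed.

(** The inductive step of [lebesgue_tuple], a bare set function, receives the structure of a
    sigma-finite measure, which the product at the next stage requires. *)
Definition lebesgue_step : set (m.+1.-tuple T) -> \bar R :=
  pushforward (lebesgue_measure \x mu) tuple_cons.

Let step0 : lebesgue_step set0 = 0.
Proof. by rewrite /lebesgue_step /pushforward preimage_set0 measure0. Qed.

Let step_ge0 A : 0 <= lebesgue_step A.
Proof. exact: integral_ge0. Qed.

Let preimage_cons A : measurable A -> measurable (tuple_cons @^-1` A).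
Proof.
by move=> mA; rewrite -[X in measurable X]setTI; exact: measurable_tuple_cons.
Qed.

Let step_sigma_additive : semi_sigma_additive lebesgue_step.
Proof.
move=> F mF tF mUF; rewrite /lebesgue_step /pushforward preimage_bigcup.
apply: (@measure_semi_sigma_additive _ _ _ (lebesgue_measure \x mu)).
- by move=> k; exact: preimage_cons.
- apply/trivIsetP => /= i j _ _ ij; rewrite -preimage_setI.
  by move/trivIsetP : tF => /(_ _ _ _ _ ij) ->//; rewrite preimage_set0.
- by rewrite -preimage_bigcup; exact: preimage_cons.
Qed.

HB.instance Definition _ := isMeasure.Build _ _ _ lebesgue_step
  step0 step_ge0 step_sigma_additive.

Let step_sigma_finite : sigma_finite setT lebesgue_step.
Proof.
have /sigma_finiteP[F [UF ndF mF]] := sigma_finiteT (@lebesgue_measure R).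
have /sigma_finiteP[G [UG ndG mG]] := sigma_finiteT mu.
pose p (t : m.+1.-tuple T) := (thead t, [tuple of behead t]).
have mp : measurable_fun setT p.
  by apply: measurable_fun_pair; [exact: measurable_tnth|exact: measurable_behead].
have pK : cancel tuple_cons p.
  by move=> -[x t]; rewrite /p theadE; congr pair; exact: val_inj.
exists (fun k => p @^-1` (F k `*` G k)).
  rewrite -preimage_bigcup -(preimage_setT p); congr preimage.
  apply/esym/seteqP; split=> // -[x t] _.
  have [i _ Fx] : (\bigcup_i F i) x by rewrite -UF.
  have [j _ Gt] : (\bigcup_i G i) t by rewrite -UG.
  exists (maxn i j) => //; split.
  - by move: x Fx; exact/subsetPset/ndF/leq_maxl.
  - by move: t Gt; exact/subsetPset/ndG/leq_maxr.
move=> k; have [mFk Fk] := mF k; have [mGk Gk] := mG k; split.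
  by rewrite -[X in measurable X]setTI; apply: mp => //; exact: measurableX.
rewrite /lebesgue_step /pushforward -comp_preimage.
rewrite (_ : p \o tuple_cons = id); last by rewrite funeqE => x /=; rewrite pK.
by rewrite preimage_id product_measure1E// lte_mul_pinfty// ge0_fin_numE.
Qed.

HB.instance Definition _ := Measure_isSigmaFinite.Build _ _ _ lebesgue_step
  step_sigma_finite.

End step.

Lemma lebesgue_tuple_measureP m :
  exists2 mu : {sigma_finite_measure set (m.-tuple T) -> \bar R},
    @lebesgue_tuple R m = mu &
    forall a r, (0 <= r)%R -> mu (cube a r) = ((2 * r) ^+ m)%:E.
Proof.
elim: m => [|m [mu muE mu_cube]].
  have fin : fin_num_fun (\d_([tuple] : 0.-tuple T) : set _ -> \bar R).
    by move=> A _; rewrite diracE.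
  exists (\d_([tuple] : 0.-tuple T))%R => // a r r0.
  by rewrite /= diracE mem_set//; case.
exists (lebesgue_step mu); first by rewrite /= muE.
move=> a r r0; rewrite [LHS]/= /lebesgue_step /pushforward.
have -> : tuple_cons @^-1` cube a r =
    [set` `[a ord0 - r, a ord0 + r]%R] `*` cube (fun i => a (lift ord0 i)) r.
  apply/seteqP; split=> -[x t] /=.
    move=> h; split=> [|i]; first by rewrite /= in_itv/= -ler_distl; exact: (h ord0).
    by have := h (lift ord0 i); rewrite tnthS.
  move=> [+ h] i; rewrite /= in_itv/= -ler_distl => hx.
  by case: (unliftP ord0 i) => [j|] ->; rewrite ?tnthS//; exact: h.
set I := [set` _]; set C := cube _ _.
transitivity (lebesgue_measure I * mu C).
  apply: (@product_measure1E _ _ T (m.-tuple T) R lebesgue_measure mu).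
    exact: measurable_itv.
  exact: measurable_cube.
have -> : lebesgue_measure I = (2 * r)%:E.
  rewrite /I lebesgue_measure_itv/= lte_fin -EFinB.
  case: ltP => h; first by congr EFin; ring.
  by congr EFin; lra.
by rewrite mu_cube// exprS EFinM.
Qed.

End lebesgue_tuple_measure.

Section volume_bounds.
Context {R : realType} {n : nat}.
Implicit Types (A : set (hyp R n)) (x : hyp R n).
Local Notation T := (measurableTypeR R).

Definition vdens x : R := (2 / om x) ^+ n.+1.

Lemma vdens_ge0 x : 0 <= vdens x.
Proof. by rewrite exprn_ge0// divr_ge0// ltW// om_gt0. Qed.

Local Open Scope ereal_scope.

Definition hdensity A (t : n.+1.-tuple T) : \bar R :=
  ((fun t => ((2 / (1 - enorm (tuple_row t) ^+ 2)) ^+ n.+1)%R%:E) \_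
    (tuple_row @^-1` (bval @` A))) t.

Lemma hdensity_in A x t : A x -> bval x = tuple_row t ->
  hdensity A t = (vdens x)%:E.
Proof.
by move=> Ax xt; rewrite /hdensity patchE mem_set/= -?xt//; exists x.
Qed.

Lemma hdensity_ge0 A t : 0 <= hdensity A t.
Proof.
have [[x Ax xt]|h] := pselect (exists2 x, A x & bval x = tuple_row t).
  by rewrite (hdensity_in Ax xt) lee_fin vdens_ge0.
by rewrite /hdensity patchE memNset.
Qed.

Lemma integral_cubes (I : finType) (c : I -> 'I_n.+1 -> R) (r w : I -> R)
    (mu : {sigma_finite_measure set (n.+1.-tuple T) -> \bar R}) :
  (forall a r, (0 <= r)%R -> mu (cube a r) = ((2 * r) ^+ n.+1)%:E) ->
  (forall i, 0 <= r i)%R -> (forall i, 0 <= w i)%R ->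
  \int[mu]_t (\sum_(i : I) (w i * \1_(cube (c i) (r i)) t)%:E) =
  (\sum_(i : I) w i * (2 * r i) ^+ n.+1)%:E.
Proof.
move=> muc r0 w0; rewrite ge0_integral_sum//=.
- rewrite -sumEFin; apply: eq_bigr => i _.
  rewrite (integralZl_indic measurableT (fun=> cube (c i) (r i)))//.
  + rewrite integral_indic; [|exact: measurableT|exact: measurable_cube].
    by rewrite setIT [RHS]EFinM; congr (_ * _); exact: muc.
  + by move=> w1; have := w0 i; rewrite leNgt w1.
  + exact: measurable_cube.
- move=> i; apply/measurable_EFinP; apply: measurable_funM => //.
  by apply: measurable_indic; exact: measurable_cube.
- by move=> i t _; rewrite lee_fin mulr_ge0.
Qed.

(** The density is dominated pointwise by weighted indicators of cubes, since a ball of radius r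
    lies in the cube of half-side r. *)
Lemma hvol_le (I : finType) (c : I -> 'rV[R]_n.+1) (r w : I -> R) A :
  (forall i, 0 <= r i)%R -> (forall i, 0 <= w i)%R ->
  (forall x, A x -> exists2 i, (enorm (bval x - c i) <= r i)%R &
     (vdens x <= w i)%R) ->
  hvol A <= (\sum_(i : I) w i * (2 * r i) ^+ n.+1)%:E.
Proof.
move=> r0 w0 h; have [mu muE muc] := @lebesgue_tuple_measureP R n.+1.
rewrite -(integral_cubes (fun i => c i ord0) muc r0 w0).
rewrite /hvol muE integral_mkcond; apply: ge0_le_integral_pointwise => t.
  exact: hdensity_ge0.
rewrite -/(hdensity A t) sumEFin.
have [[x Ax xt]|nx] := pselect (exists2 x, A x & bval x = tuple_row t).
  rewrite (hdensity_in Ax xt) lee_fin; have [i xi wi] := h x Ax.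
  rewrite (bigD1 i)//= indicE mem_set/=; last first.
    move=> j; apply: le_trans xi; apply: le_trans (coord_le_enorm _ j).
    by rewrite xt !mxE.
  rewrite mulr1; apply: le_trans wi _; rewrite lerDl; apply: sumr_ge0 => j _.
  by rewrite mulr_ge0.
rewrite /hdensity patchE memNset// lee_fin; apply: sumr_ge0 => j _.
by rewrite mulr_ge0.
Qed.

(** A cube of half-side r lies in the ball of radius (n + 1) r, so the separation makes the cubes
    disjoint and at most one term of the sum is nonzero at each point. *)
Lemma hvol_ge (I : finType) (c : I -> 'rV[R]_n.+1) (r w : I -> R) A :
  (forall i, 0 <= r i)%R -> (forall i, 0 <= w i)%R ->
  (forall i (v : 'rV[R]_n.+1), (enorm (v - c i) <= n.+1%:R * r i)%R ->
     exists x, [/\ bval x = v, A x & (w i <= vdens x)%R]) ->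
  (forall i j, i != j -> (n.+1%:R * (r i + r j) < enorm (c i - c j))%R) ->
  (\sum_(i : I) w i * (2 * r i) ^+ n.+1)%:E <= hvol A.
Proof.
move=> r0 w0 h sep; have [mu muE muc] := @lebesgue_tuple_measureP R n.+1.
rewrite -(integral_cubes (fun i => c i ord0) muc r0 w0).
rewrite /hvol muE [leRHS]integral_mkcond.
apply: ge0_le_integral_pointwise => t.
  by apply: sume_ge0 => i _; rewrite lee_fin mulr_ge0.
rewrite -/(hdensity A t) sumEFin.
have cubeE i : cube (c i ord0) (r i) t ->
    (enorm (tuple_row t - c i) <= n.+1%:R * r i)%R.
  by move=> ti; apply: enorm_le_coord => // j; rewrite !mxE; exact: ti.
have [[i ti]|nt] := pselect (exists i, cube (c i ord0) (r i) t); last first.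
  rewrite big1 ?hdensity_ge0// => i _.
  by rewrite indicE memNset ?mulr0// => ti; apply: nt; exists i.
have [x [xt Ax wx]] := h i _ (cubeE _ ti).
rewrite (hdensity_in Ax xt) lee_fin (bigD1 i)//= big1 ?addr0 => [|j ji].
  by rewrite indicE mem_set// mulr1.
rewrite indicE memNset ?mulr0// => tj; have := sep _ _ ji.
rewrite ltNge => /negP; apply.
apply: le_trans (enorm_triangle _ (tuple_row t) _) _.
by rewrite mulrDr lerD// ?(enormB (c j)) cubeE.
Qed.

End volume_bounds.

(** * Convex hulls and geodesics *)

Section hull_geometry.
Context {R : realType}.

Lemma hsinhD (s t : R) : hsinh (s + t) = hsinh s * hcosh t + hcosh s * hsinh t.
Proof. by rewrite hcoshE [hcosh s]hcoshE !hsinhE opprD !expRD; field. Qed.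

(** Equality in the triangle inequality, with cs, ss the hyperbolic cosine and sine of d(A, C) and
    cr, sr those of d(C, B). The difference of the two sides is orthogonal to C and null, hence zero
    by [mink_orthogonal]. *)
Lemma mink_segment {m : nat} (A B C : 'rV[R]_m) (ta tb tc cs ss cr sr : R) :
  edot A A = ta ^+ 2 - 1 -> edot B B = tb ^+ 2 - 1 -> edot C C = tc ^+ 2 - 1 ->
  edot A C = ta * tc - cs -> edot C B = tc * tb - cr ->
  edot A B = ta * tb - (cs * cr + ss * sr) ->
  ss ^+ 2 = cs ^+ 2 - 1 -> sr ^+ 2 = cr ^+ 2 - 1 -> 0 < tc ->
  (ss * cr + cs * sr) * tc = sr * ta + ss * tb /\
  (ss * cr + cs * sr) *: C = sr *: A + ss *: B.
Proof.
move=> AA BB CC AC CB AB hs hr tc0.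
pose w := (ss * cr + cs * sr) *: C - (sr *: A + ss *: B).
pose w0 := (ss * cr + cs * sr) * tc - (sr * ta + ss * tb).
have [_ h] : w0 ^+ 2 <= edot w w /\ (w0 ^+ 2 = edot w w -> w0 = 0 /\ w = 0).
  apply: (mink_orthogonal tc0 CC).
  by rewrite /w /w0 !edotE CC AC (edotC B C) CB; ring.
have [] : w0 = 0 /\ w = 0.
  apply: h; apply/eqP; rewrite -subr_eq0; apply/eqP.
  have -> : w0 ^+ 2 - edot w w = ss ^+ 2 * (1 - cr ^+ 2 + sr ^+ 2) +
      sr ^+ 2 * (1 - cs ^+ 2 + ss ^+ 2).
    rewrite /w /w0 !edotE AA BB CC (edotC C A) (edotC B C) (edotC B A) AC CB AB.
    by ring.
  by rewrite hs hr; ring.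
by rewrite /w /w0 => /eqP; rewrite subr_eq0 => /eqP -> /eqP; rewrite subr_eq0 => /eqP ->.
Qed.

Context {n : nat}.
Implicit Types (x y z p : hyp R n) (w xi eta : 'rV[R]_n.+1) (L : set 'rV[R]_n.+1).

(* The trace on the hyperboloid of a linear functional of Minkowski space. *)
Definition mink_form (w : 'rV[R]_n.+1) (b : R) (x : hyp R n) : R :=
  edot (mV x) w - b * mT x.

Lemma mink_form_om w b x :
  mink_form w b x * om x = 2 * edot (bval x) w - b * (1 + enorm (bval x) ^+ 2).
Proof.
rewrite /mink_form mVE mTE edotZl; have := om_neq0 x.
by move: (om x) (edot _ _) (enorm _) => o e f o0; field.
Qed.

(** By [mink_segment] an intermediate point is, on the hyperboloid, a positive combination of the
    end points, so a linear form negative at both stays negative. *)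
Lemma mink_form_lt0_segment w b (J : set R) (c : R -> hyp R n) s t u :
  geodesic J c -> J s -> J t -> J u -> s < t -> t < u ->
  mink_form w b (c s) < 0 -> mink_form w b (c u) < 0 ->
  mink_form w b (c t) < 0.
Proof.
move=> gc Js Jt Ju st tu hs hu.
have dst : hdist (c s) (c t) = t - s by rewrite gc// ler0_norm; lra.
have dtu : hdist (c t) (c u) = u - t by rewrite gc// ler0_norm; lra.
have dsu : hdist (c s) (c u) = (t - s) + (u - t) by rewrite gc// ler0_norm; lra.
have AC := mink_hdist (c s) (c t); rewrite dst in AC.
have CB := mink_hdist (c t) (c u); rewrite dtu in CB.
have AB := mink_hdist (c s) (c u); rewrite dsu hcoshD in AB.
have [eT eV] := mink_segment (mink_self _) (mink_self _) (mink_self _) AC CB AB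
  (hsinh_sqr _) (hsinh_sqr _) (mT_gt0 _).
have s1 : 0 < hsinh (t - s) by apply: hsinh_gt0; lra.
have s2 : 0 < hsinh (u - t) by apply: hsinh_gt0; lra.
have s3 : 0 < hsinh (t - s) * hcosh (u - t) + hcosh (t - s) * hsinh (u - t).
  by rewrite -hsinhD hsinh_gt0; lra.
have e1 := congr1 (edot^~ w) eV; rewrite /= edotDl !edotZl in e1.
rewrite -(pmulr_rlt0 _ s3).
suff -> : (hsinh (t - s) * hcosh (u - t) + hcosh (t - s) * hsinh (u - t)) *
    mink_form w b (c t) =
    hsinh (u - t) * mink_form w b (c s) + hsinh (t - s) * mink_form w b (c u).
  have h1 : hsinh (u - t) * mink_form w b (c s) < 0 by rewrite pmulr_rlt0.
  have h2 : hsinh (t - s) * mink_form w b (c u) < 0 by rewrite pmulr_rlt0.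
  lra.
by rewrite /mink_form mulrBr e1 [X in _ - X]mulrCA eT; ring.
Qed.

Lemma hconvex_mink_form w b : hconvex [set x | mink_form w b x < 0].
Proof.
move=> s u c su gc /= hs hu t; rewrite in_itv/= => /andP[st tu].
move: st; rewrite le_eqVlt => /predU1P[<-//|st].
move: tu; rewrite le_eqVlt => /predU1P[->//|tu].
apply: (mink_form_lt0_segment gc _ _ _ st tu) => //=;
  by rewrite in_itv/=; apply/andP; split; lra.
Qed.

Lemma continuous_edot w : continuous (fun v : 'rV[R]_n.+1 => edot v w).
Proof.
move=> x U /nbhs_ballP[e /= e0 eU]; have w0 := enorm_ge0 w.
apply/nbhs_enormP; exists (e / (enorm w + 1)); first by rewrite divr_gt0//; lra.
move=> y; rewrite ltr_pdivlMr; last by lra.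
move=> yx; apply: eU; rewrite /ball/=.
have -> : edot x w - edot y w = edot (x - y) w by rewrite !edotE.
have h1 := edot_le (x - y) w; have h2 := edot_le (y - x) w.
have e1 : edot (y - x) w = - edot (x - y) w by rewrite !edotE; ring.
rewrite e1 in h2; rewrite (enormB x y) in h1.
have := enorm_ge0 (y - x) => d0.
by rewrite ltr_norml; apply/andP; split; nra.
Qed.

(** The product of [mink_form] and [om] extends continuously to the closed ball, with value 2 (<xi,
    w> - b) at a point xi of the sphere. *)
Lemma mink_form_lt0_near w b xi (F : set_system R) (c : R -> hyp R n) :
  ProperFilter F -> enorm xi = 1 -> edot xi w < b -> bval (c t) @[t --> F] --> xi ->
  \forall t \near F, mink_form w b (c t) < 0.
Proof.
move=> FF xi1 xib cxi.
have h1 : edot (bval (c t)) w @[t --> F] --> edot xi w.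
  exact (cvg_comp _ _ cxi (@continuous_edot w xi)).
have h2 : enorm (bval (c t)) @[t --> F] --> enorm xi.
  exact (cvg_comp _ _ cxi (@enorm_continuous _ _ xi)).
have h3 : (2 * edot (bval (c t)) w -
    b * (1 + enorm (bval (c t)) * enorm (bval (c t)))) @[t --> F] -->
    2 * edot xi w - b * (1 + enorm xi * enorm xi).
  apply: cvgB; first exact: cvgMr.
  by apply: cvgMr; apply: cvgD; [exact: cvg_cst|exact: cvgM].
have h4 : 2 * edot xi w - b * (1 + enorm xi * enorm xi) < 0.
  by rewrite xi1; lra.
have := @cvgr_lt _ _ F FF _ _ h3 _ h4; apply: filterS => t h.
by rewrite -(pmulr_llt0 _ (om_gt0 (c t))) mink_form_om expr2.
Qed.

Lemma hull_near_limit L p : L `<=` unit_sphere -> hull L p ->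
  exists2 xi, L xi & enorm (bval p - xi) <= om p.
Proof.
(* With this b the form vanishes at p: for p other than 0, its half-space is bounded by the
   hyperplane through p orthogonal to the radius. Either some xi in L lies beyond it, and is then
   close to p, or the half-space contains the hull but not p. *)
move=> LS Lp; pose w := mV p; pose b := edot w w / mT p.
have T0 := mT_gt0 p.
have [[xi Lxi hxi]|nh] := pselect (exists2 xi, L xi & b <= edot xi w).
  exists xi => //; have xi1 : enorm xi = 1 by exact: LS.
  have op := om_gt0 p; have oe := omE p.
  have := hxi; rewrite /b /w mink_self ler_pdivrMr// mVE edotZr mTE.
  set e := edot xi _; set a := enorm (bval p) in oe * => h.
  (* Here e = <xi, p>. The bound e >= 2 a^2 / (1 + a^2) gives |p - xi|^2 = 1 + a^2 - 2 e <= (1 -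
     a^2)^2 / (1 + a^2) <= (om p)^2. *)
  have h2 : 2 * a ^+ 2 <= e * (1 + a ^+ 2).
    have : (((1 + a ^+ 2) / om p) ^+ 2 - 1) * om p ^+ 2 <=
        (2 / om p * e * ((1 + a ^+ 2) / om p)) * om p ^+ 2.
      by rewrite ler_wpM2r// sqr_ge0.
    have -> : (((1 + a ^+ 2) / om p) ^+ 2 - 1) * om p ^+ 2 =
       (1 + a ^+ 2) ^+ 2 - om p ^+ 2 by field; rewrite gt_eqF.
    have -> : 2 / om p * e * ((1 + a ^+ 2) / om p) * om p ^+ 2 =
       2 * e * (1 + a ^+ 2) by field; rewrite gt_eqF.
    by rewrite oe; nra.
  have a0 := sqr_ge0 a.
  rewrite -(@ler_pXn2r _ 2) ?nnegrE ?enorm_ge0 ?(ltW op)//.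
  rewrite enorm_sqr !edotE -!enorm_sqr xi1 (edotC (bval p)) -/e -/a.
  have : (a ^+ 2 + 1 - 2 * e) * (1 + a ^+ 2) <= om p ^+ 2 by rewrite oe; nra.
  have := sqr_ge0 (om p) => o2 h3.
  by have [X0|X0] := leP 0 (a ^+ 2 + 1 - 2 * e); nra.
have {}nh xi : L xi -> edot xi w < b.
  by move=> Lxi; rewrite ltNge; apply/negP => h; apply: nh; exists xi.
have : mink_form w b p < 0.
  apply: (Lp [set x | mink_form w b x < 0]); split; first exact: hconvex_mink_form.
  move=> _ [c [gc [xi Lxi cxi] [eta Leta ceta] [t ->]]] /=.
  have /= h1 := mink_form_lt0_near _ (LS _ Lxi) (nh _ Lxi) cxi.
  have /= h2 := mink_form_lt0_near _ (LS _ Leta) (nh _ Leta) ceta.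
  have [M [_ hM]] := h1; have [N [_ hN]] := h2.
  pose u := `|M| + `|t| + 1; pose s := - (`|N| + `|t| + 1).
  have := ler_norm M; have := ler_norm (- N); have := ler_norm t.
  have := ler_norm (- t); rewrite !normrN => t1 t2 N1 M1.
  have M0 := normr_ge0 M; have N0 := normr_ge0 N; have t0 := normr_ge0 t.
  apply: (mink_form_lt0_segment gc (s := s) (u := u)) => //.
  - by rewrite /s; lra.
  - by rewrite /u; lra.
  - by apply: hN; rewrite /s; lra.
  - by apply: hM; rewrite /u; lra.
by rewrite /mink_form -/w /b mulfVK ?gt_eqF// subrr ltxx.
Qed.

Lemma hneighbourhood_hull_near L e x : L `<=` unit_sphere ->
  hneighbourhood e (hull L) x ->
  exists2 xi, L xi & enorm (bval x - xi) <= 2 * expR e * om x.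
Proof.
move=> LS [p /(hull_near_limit LS)[xi Lxi pxi] xp].
have [h1 h2] := enorm_le_hdist (ltW xp).
exists xi => //; apply: le_trans (enorm_triangle _ (bval p) _) _; lra.
Qed.

End hull_geometry.

(** * Geodesics between points of the sphere *)

Section ideal_geodesics.
Context {R : realType} {n : nat}.
Implicit Types (x y z p : hyp R n) (xi eta : 'rV[R]_n.+1) (L : set 'rV[R]_n.+1).

(** Inverse of the hyperboloid chart, the central projection V / (1 + T). *)
Lemma hyperboloid_point (T : R) (V : 'rV[R]_n.+1) :
  edot V V = T ^+ 2 - 1 -> 1 <= T ->
  exists x : hyp R n,
    [/\ bval x = (1 + T)^-1 *: V, om x = 2 / (1 + T), mT x = T & mV x = V].
Proof.
move=> VV T1; pose v := (1 + T)^-1 *: V.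
have v2 : enorm v ^+ 2 = (T - 1) / (1 + T).
  by rewrite enorm_sqr !edotE VV; field; lra.
have v1 : enorm v < 1.
  have : enorm v ^+ 2 < 1 by rewrite v2 ltr_pdivrMr; lra.
  by have := enorm_ge0 v; nra.
have ox : om (hpoint v1) = 2 / (1 + T).
  by rewrite omE hpointK v2; field; lra.
exists (hpoint v1); split => //.
  by rewrite mTE ox hpointK v2; field; lra.
rewrite mVE ox hpointK /v scalerA.
suff -> : 2 / (2 / (1 + T)) * (1 + T)^-1 = 1 by rewrite scale1r.
by field; lra.
Qed.

Lemma half_ideal_bound xi eta (t : R) x : let a := enorm (xi - eta) in
  let T := (expR t + expR (- t)) / a in
  enorm xi = 1 -> enorm eta = 1 -> 0 < a -> 0 <= t ->
  bval x = (1 + T)^-1 *: (a^-1 *: (expR t *: xi + expR (- t) *: eta)) ->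
  enorm (bval x - xi) <= 2 * a * expR (- t).
Proof.
move=> a T xi1 eta1 a0 t0 xE.
have E0 := expR_gt0 t; have F0 := expR_gt0 (- t).
have D0 : 0 < a + expR t + expR (- t) by lra.
have -> : bval x - xi =
    (a + expR t + expR (- t))^-1 *: (expR (- t) *: (eta - xi) - a *: xi).
  rewrite xE /T; apply/rowP => i; rewrite !mxE; field.
  by rewrite !gt_eqF//=; lra.
rewrite enormZ gtr0_norm ?invr_gt0// mulrC ler_pdivrMr//.
have h : enorm (expR (- t) *: (eta - xi) - a *: xi) <= expR (- t) * a + a.
  apply: le_trans (enormD _ _) _.
  by rewrite enormN !enormZ xi1 mulr1 !gtr0_norm// (enormB eta).
apply: le_trans h _.
have EF : expR t * expR (- t) = 1 by rewrite -expRD subrr expR0.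
have F1 : expR (- t) <= 1 by rewrite -expR0 ler_expR; lra.
have : 0 <= a * expR (- t) * (a + expR (- t)) by rewrite !mulr_ge0 ?addr_ge0 ?ltW.
have : a * (expR t * expR (- t)) = a by rewrite EF mulr1.
nra.
Qed.

(** On the hyperboloid the geodesic is (e^t (1, xi) + e^-t (1, eta)) / a, a combination of two
    light-like vectors whose Minkowski product is a^2 / 2. *)
Lemma ideal_geodesic xi eta : let a := enorm (xi - eta) in
  enorm xi = 1 -> enorm eta = 1 -> 0 < a ->
  exists c : R -> hyp R n,
    [/\ geodesic setT c, bval (c t) @[t --> +oo] --> xi,
        bval (c t) @[t --> -oo] --> eta &
        forall t, 0 <= t -> a / 2 * expR (- t) <= om (c t) /\
                  enorm (bval (c t) - xi) <= 2 * a * expR (- t)].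
Proof.
move=> a xi1 eta1 a0.
have a2 : a <= 2 by have := enormD xi (- eta); rewrite enormN xi1 eta1.
have xe : edot xi eta = 1 - a ^+ 2 / 2.
  rewrite /a enorm_sqr !edotE -!enorm_sqr xi1 eta1 (edotC eta).
  by field.
pose T t : R := (expR t + expR (- t)) / a.
pose V t := a^-1 *: (expR t *: xi + expR (- t) *: eta).
have VV s t : edot (V s) (V t) = T s * T t - hcosh (s - t).
  rewrite /V /T !edotE -!enorm_sqr xi1 eta1 (edotC eta) xe hcoshE opprB !expRD.
  by field; rewrite gt_eqF.
have T1 t : 1 <= T t.
  rewrite /T ler_pdivlMr// mul1r; have := hcosh_ge1 t; rewrite hcoshE; lra.
have /choice[c cP] t : exists x : hyp R n,
    [/\ bval x = (1 + T t)^-1 *: V t, om x = 2 / (1 + T t), mT x = T t & mV x = V t].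
  by apply: hyperboloid_point => //; rewrite VV subrr hcosh0 expr2.
have b1 t : 0 <= t -> enorm (bval (c t) - xi) <= 2 * a * expR (- t).
  by move=> t0; have [e _ _ _] := cP t; apply: (half_ideal_bound xi1 eta1 a0 t0 e).
have b2 t : 0 <= t -> enorm (bval (c (- t)) - eta) <= 2 * a * expR (- t).
  move=> t0; have [e _ _ _] := cP (- t).
  have := @half_ideal_bound eta xi t (c (- t)); rewrite /= (enormB eta xi) -/a.
  apply=> //; rewrite e /T /V opprK (addrC (expR (- t))).
  by rewrite (addrC (expR (- t) *: _)).
have lim (f : R -> hyp R n) zeta :
    (forall t, 0 <= t -> enorm (bval (f t) - zeta) <= 2 * a * expR (- t)) ->
    forall U, nbhs zeta U -> exists2 M, 0 <= M & forall t, M < t -> U (bval (f t)).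
  move=> fz U /nbhs_enormP[e e0 eU].
  exists (`|ln (2 * a / e)|) => // t lt; apply: eU.
  have t0 : 0 <= t by apply: ltW; apply: le_lt_trans lt; exact: normr_ge0.
  apply: le_lt_trans (fz _ t0) _.
  have : 2 * a / e < expR t.
    rewrite -[ltLHS]lnK ?posrE ?divr_gt0 ?mulr_gt0// ltr_expR.
    by apply: le_lt_trans lt; exact: ler_norm.
  by rewrite ltr_pdivrMr// expRN ltr_pdivrMr ?expR_gt0// (mulrC e).
exists c; split.
- move=> s t _ _; apply: hcosh_inj; rewrite ?hdist_ge0// hcosh_norm.
  have [_ _ Ts Vs] := cP s; have [_ _ Tt Vt] := cP t.
  have := mink_hdist (c s) (c t); rewrite Ts Tt Vs Vt VV => /addrI/oppr_inj.
  by [].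
- move=> U /(lim c _ b1)[M M0 hM]; exists M; split; first exact: num_real.
  exact: hM.
- move=> U /(lim (fun t => c (- t)) _ b2)[M M0 hM].
  exists (- M); split; first exact: num_real.
  by move=> t tM; rewrite /= -(opprK t); apply: hM; lra.
- move=> t t0; split; last exact: b1.
  have [_ -> _ _] := cP t; have F0 := expR_gt0 (- t).
  have F1 : expR (- t) <= 1 by rewrite -expR0 ler_expR; lra.
  have E1 : 1 <= expR t by rewrite -expR0 ler_expR.
  have EF : expR t * expR (- t) = 1 by rewrite -expRD subrr expR0.
  have -> : 2 / (1 + T t) = 2 * a / (a + expR t + expR (- t)).
    by rewrite /T; field; rewrite !gt_eqF//=; lra.
  rewrite ler_pdivlMr; last by lra.
  have : expR (- t) * (a + expR t + expR (- t)) <= 4.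
    have : expR (- t) * (a + expR (- t)) <= 3 by nra.
    nra.
  by nra.
Qed.

Lemma hull_point L (D : R) xi (r : R) : L `<=` unit_sphere -> L xi ->
  (exists2 eta, L eta & D <= enorm (xi - eta)) -> 0 < r -> r <= 16 * D ->
  exists p : hyp R n, [/\ hull L p, enorm (bval p - xi) <= r / 8 & r / 32 <= om p].
Proof.
move=> LS Lxi [eta Leta De] r0 rD; set a := enorm _ in De.
have a0 : 0 < a by lra.
have [c [gc c1 c2 cb]] := ideal_geodesic (LS _ Lxi) (LS _ Leta) a0.
(* At time ln (16 a / r) one has e^-t = r / (16 a), which turns the bounds 2 a e^-t and a / 2 e^-t
   into r / 8 and r / 32; r <= 16 D makes this time nonnegative. *)
have q1 : 1 <= 16 * a / r by rewrite ler_pdivlMr; lra.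
have t0 : 0 <= ln (16 * a / r) by rewrite ln_ge0.
have [h1 h2] := cb _ t0.
have e : expR (- ln (16 * a / r)) = r / (16 * a).
  by rewrite expRN lnK ?posrE; [rewrite invf_div|lra].
exists (c (ln (16 * a / r))); split.
- move=> C [_ hC]; apply: hC; exists c; split=> //; [by exists xi|by exists eta|].
  by eexists.
- apply: le_trans h2 _; rewrite e -/a.
  have -> : 2 * a * (r / (16 * a)) = r / 8 by field; rewrite gt_eqF.
  by [].
- apply: le_trans h1; rewrite e -/a.
  have -> : a / 2 * (r / (16 * a)) = r / 32 by field; rewrite gt_eqF.
  by [].
Qed.

End ideal_geodesics.

(** * Box dimension and entropy *)

Section coverings.
Context {R : realType} {m : nat}.
Implicit Types (A U : set 'rV[R]_m) (x y : 'rV[R]_m) (e r : R).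

Lemma ediam_ge U x y r : (ediam U <= r%:E)%E -> U x -> U y -> enorm (x - y) <= r.
Proof.
move=> Ur Ux Uy; rewrite -lee_fin; apply: le_trans Ur.
by apply: ereal_sup_ubound; right; exists x => //; exists y.
Qed.

Lemma ediam_le U r : 0 <= r -> (forall x y, U x -> U y -> enorm (x - y) <= r) ->
  (ediam U <= r%:E)%E.
Proof.
move=> r0 h; apply: ge_ereal_sup => _ [->|[x Ux [y Uy <-]]]; rewrite lee_fin//.
exact: h.
Qed.

Lemma ediam_ge0 U : (0 <= ediam U)%E.
Proof. by apply: ereal_sup_ubound; left. Qed.

Lemma ediam0 : ediam (set0 : set 'rV[R]_m) = 0%E.
Proof.
by apply/eqP; rewrite eq_le ediam_ge0 andbT; apply: ediam_le.
Qed.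

Definition covers (k : nat) e A := exists U : 'I_k -> set 'rV[R]_m,
  A `<=` \bigcup_i U i /\ forall i, (ediam (U i) <= e%:E)%E.

Lemma covering_number_le k e A : covers k e A -> (covering_number e A <= k%:R%:E)%E.
Proof. by move=> h; apply: ereal_inf_lbound; exists k. Qed.

Lemma covering_numberP k0 e A : covers k0 e A ->
  exists2 k : nat, covering_number e A = k%:R%:E & covers k e A.
Proof.
move=> h0; have ex : exists k, `[< covers k e A >] by exists k0; apply/asboolP.
case: (ex_minnP ex) => k /asboolP hk kmin; exists k => //.
apply/eqP; rewrite eq_le covering_number_le//=.
apply: le_ereal_inf_tmp => _ [j /= hj <-].
by rewrite lee_fin ler_nat; apply: kmin; apply/asboolP.
Qed.

Lemma covers_ge1 k e A : A !=set0 -> covers k e A -> (1 <= k)%N.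
Proof. by move=> [x Ax] [U [AU _]]; have [i _ _] := AU x Ax; case: k i U AU => [[]|]. Qed.

Lemma unit_ball_net e : 0 < e -> exists (I : finType) (c : I -> 'rV[R]_m),
  forall x, enorm x <= 1 -> exists i, enorm (x - c i) <= e.
Proof.
move=> e0; pose h := e / (m%:R + 1).
have m0 : (0 : R) < m%:R + 1 by rewrite ltr_wpDl.
have h0 : 0 < h by rewrite divr_gt0.
pose K := (Num.trunc (2 / h)).+1.
exists {ffun 'I_m -> 'I_K}, (fun f : {ffun 'I_m -> 'I_K} => \row_j (-1 + h * (f j)%:R)).
move=> x x1.
have xj j : 0 <= (x ord0 j + 1) / h <= 2 / h.
  have := coord_le_enorm x j; rewrite ler_norml => /andP[h1 h2].
  apply/andP; split; first by rewrite divr_ge0//; lra.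
  by rewrite ler_pM2r ?invr_gt0//; lra.
exists [ffun j => inord (Num.trunc ((x ord0 j + 1) / h))].
apply: (@le_trans _ _ (m%:R * h)).
  apply: enorm_le_coord; first exact: ltW.
  move=> j; rewrite !mxE ffunE; have /andP[x0 x2] := xj j.
  have /andP[t1 t2] := truncn_itv x0.
  rewrite inordK; last first.
    rewrite /K ltnS -ltnS -(ltr_nat R).
    have h2 : 0 <= 2 / h by rewrite divr_ge0// ltW.
    have /andP[_ t3] := truncn_itv h2.
    by apply: le_lt_trans t1 (le_lt_trans x2 t3).
  move: t1 t2; set t := Num.trunc _; rewrite ler_pdivlMr// ltr_pdivrMr// => t1 t2.
  rewrite -natr1 in t2.
  by rewrite ler_norml; apply/andP; split; lra.
by rewrite /h mulrCA ger_pMr// ler_pdivrMr// mul1r lerDl.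
Qed.

Lemma covers_bounded e A : 0 < e -> (forall x, A x -> enorm x <= 1) ->
  exists k, covers k e A.
Proof.
move=> e0 A1; have [|I [c cP]] := @unit_ball_net (e / 2); first by rewrite divr_gt0.
exists #|I|, (fun i => [set x | enorm (x - c (enum_val i)) <= e / 2]); split.
  move=> x /A1/cP[i xi]; exists (enum_rank i) => //=.
  by rewrite enum_rankK.
move=> i; apply: ediam_le => [|x y /= xi yi]; first exact: ltW.
apply: le_trans (enorm_triangle _ (c (enum_val i)) _) _.
by rewrite (enormB (c _)); lra.
Qed.

Definition separated (k : nat) e A (x : 'I_k -> 'rV[R]_m) :=
  (forall i, A (x i)) /\ (forall i j, i != j -> e < enorm (x i - x j)).

Lemma separated_le_covers k l e A (x : 'I_k -> 'rV[R]_m) :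
  separated e A x -> covers l e A -> (k <= l)%N.
Proof.
move=> [Ax sep] [U [AU Ue]].
have /choice[f fP] i : exists j, U j (x i).
  by have [j _ ?] := AU _ (Ax i); exists j.
rewrite -(card_ord k) -(card_ord l); apply: (leq_card f) => i j fij.
apply/eqP; apply/negPn/negP => /sep; rewrite ltNge => /negP; apply.
by apply: (ediam_ge (Ue (f i))); rewrite // fij.
Qed.

(** A covering at scale e bounds the size of separated families; at maximal size, a point farther
    than e from all members could still be appended. *)
Lemma maximal_separated e A : 0 < e -> (forall x, A x -> enorm x <= 1) ->
  exists k (x : 'I_k -> 'rV[R]_m), separated e A x /\ covers k (2 * e) A.
Proof.
move=> e0 A1; have [l Al] := covers_bounded e0 A1.
pose P k := `[< exists x : 'I_k -> 'rV[R]_m, separated e A x >].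
have P0 : exists k, P k by exists 0%N; apply/asboolP; exists (fun=> 0); split; case.
have Pl k : P k -> (k <= l)%N by move=> /asboolP[x /separated_le_covers]; apply.
case: (ex_maxnP P0 Pl) => k /asboolP[x xsep] kmax; exists k, x; split=> //.
exists (fun i => [set v | enorm (v - x i) <= e]); split=> [v Av|i]; last first.
  apply: ediam_le => [|u v /= ui vi]; first by rewrite mulr_ge0// ltW.
  by apply: le_trans (enorm_triangle _ (x i) _) _; rewrite (enormB (x i)); lra.
apply: contrapT => nv; have [Ax sep] := xsep.
have : P k.+1; last by move=> /kmax; rewrite ltnn.
have far i : e < enorm (v - x i).
  by rewrite ltNge; apply/negP => h; apply: nv; exists i.
apply/asboolP; exists (fun i => if unlift ord_max i is Some j then x j else v).
split=> [i|i j]; first by case: unliftP => [j|] _.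
case: unliftP => [i'|] ->; case: unliftP => [j'|] -> ij.
- by apply: sep; apply: contra_neq ij => ->.
- by rewrite enormB.
- exact: far.
- by rewrite eqxx in ij.
Qed.

End coverings.

(** * Volume of the hull neighbourhood *)

Section core_volume.
Context {R : realType} {n : nat}.
Implicit Types (x y z p : hyp R n) (L : set 'rV[R]_n.+1) (e r : R).
Local Notation o0 := (@horigin R n).

(** Points are sorted into shells by j = floor(-ln om) <= K. One covering at the finest scale
    exp(-K) serves every shell: each of its sets gets a cube of half-side C1 exp(-j), and the
    density bound (2 e exp(j))^(n+1) makes its contribution independent of j. The factor K + 1
    counts shells and disappears in the exponential rate. *)
Lemma hvol_core_le L z e : L `<=` unit_sphere ->
  exists2 C : R, 0 < C & forall r (K k : nat), r + hdist o0 z <= K%:R ->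
    covers k (expR (- K%:R)) L ->
    (hvol (hopen_ball z r `&` hneighbourhood e (hull L)) <=
      (C * (K.+1)%:R * k%:R)%:E)%E.
Proof.
move=> LS; pose C1 := 2 * expR e + 1.
have C10 : 0 < C1 by rewrite /C1; have := expR_gt0 e; lra.
exists ((4 * expR 1 * C1) ^+ n.+1).
  by rewrite exprn_gt0// !mulr_gt0// expR_gt0.
move=> r K k rK [U [LU Ue]].
have /choice[c cP] i : exists v : 'rV[R]_n.+1,
    forall xi, L xi -> U i xi -> enorm (xi - v) <= expR (- K%:R).
  have [[v [Lv Uv]]|nv] := pselect (exists v, L v /\ U i v).
    by exists v => xi _ Uxi; apply: (ediam_ge (Ue i)).
  by exists 0 => xi Lxi Uxi; exfalso; apply: nv; exists xi.
pose I := ('I_K.+1 * 'I_k)%type.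
pose cc (i : I) := c i.2.
pose rr (i : I) : R := C1 * expR (- (i.1 : nat)%:R).
pose ww (i : I) : R := (2 * expR 1 * expR (i.1 : nat)%:R) ^+ n.+1.
have rr0 i : 0 <= rr i by rewrite mulr_ge0 ?expR_ge0// ltW.
have ww0 i : 0 <= ww i by rewrite exprn_ge0// !mulr_ge0 ?expR_ge0.
apply: (@le_trans _ _ (\sum_(i : I) ww i * (2 * rr i) ^+ n.+1)%:E); last first.
  rewrite lee_fin (eq_bigr (fun=> (4 * expR 1 * C1) ^+ n.+1)); last first.
    move=> i _; rewrite /ww /rr -exprMn; congr (_ ^+ _).
    have := expRxMexpNx_1 ((i.1 : nat)%:R : R).
    set E := expR _%:R; set F := expR (- _%:R) => EF.
    by transitivity (4 * expR 1 * C1 * (E * F)); [ring|rewrite EF mulr1].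
  by rewrite sumr_const card_prod !card_ord -[leLHS]mulr_natr natrM mulrA.
apply: (@hvol_le _ _ _ cc rr ww) => // x [zx /(hneighbourhood_hull_near LS)[xi Lxi xxi]].
have ox := om_gt0 x; have ox1 := om_le1 x.
have l0 : 0 <= - ln (om x) by rewrite oppr_ge0 ln_le0.
have lK : - ln (om x) <= K%:R.
  apply: le_trans rK; have : - hdist o0 x <= ln (om x).
    by rewrite -[leLHS]expRK ler_ln ?posrE ?expR_gt0// om_ge.
  have := hdist_triangle o0 z x; move: zx; rewrite /hopen_ball/=; lra.
have /andP[j1 j2] := truncn_itv l0; set j := Num.trunc _ in j1 j2.
have jK : (j < K.+1)%N by rewrite ltnS -(ler_nat R) (le_trans j1).
have [i _ Ui] := LU _ Lxi.
have oj : om x <= expR (- j%:R) by rewrite -[leLHS]lnK ?posrE// ler_expR; lra.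
have oj1 : expR (- j%:R) <= expR 1 * om x.
  rewrite -[om x]lnK ?posrE// -expRD ler_expR; rewrite -natr1 in j2; lra.
exists (Ordinal jK, i).
  rewrite /cc /rr /=; apply: le_trans (enorm_triangle _ xi _) _.
  have h1 := cP _ _ Lxi Ui.
  have h2 : expR (- K%:R) <= expR (- j%:R) :> R.
    by rewrite ler_expR lerN2 ler_nat -ltnS.
  rewrite /C1 [leRHS]mulrDl mul1r; apply: lerD; last exact: le_trans h1 h2.
  by apply: le_trans xxi _; rewrite ler_wpM2l// mulr_ge0// expR_ge0.
rewrite /vdens /ww /= lerXn2r ?nnegrE ?mulr_ge0 ?expR_ge0 ?invr_ge0 ?(ltW ox)//.
rewrite ler_pdivrMr//; have := expRxMexpNx_1 (j%:R : R); move: oj1.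
have := expR_gt0 (j%:R : R); move: (expR j%:R) (expR (- j%:R)) => E F E0 FE EF.
have : E * F <= E * (expR 1 * om x) by rewrite ler_pM2l.
by rewrite EF; lra.
Qed.

(** Near each x i there is a hull point p i at depth comparable to s and within s / 8 of x i; the p
    i are then more than 3 s / 4 apart, while the cubes around them lie in balls of radius kap s /
    32. One of a, b is at distance at least D from any given point of L and serves as the other end
    of the geodesic. *)
Lemma hvol_core_ge L z e a b : L `<=` unit_sphere -> L a -> L b -> a <> b ->
  0 < e -> exists C c d : R, [/\ 0 < c, 0 < d & forall (s r : R) (k : nat) (x : 'I_k -> 'rV[R]_n.+1),
    0 < s -> s <= d -> C - ln s <= r -> separated s L x ->
    ((c * k%:R)%:E <= hvol (hopen_ball z r `&` hneighbourhood e (hull L)))%E].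
Proof.
move=> LS La Lb ab e0.
pose D := enorm (a - b) / 2.
have D0 : 0 < D.
  rewrite divr_gt0// lt_neqAle enorm_ge0 andbT eq_sym; apply/eqP => /enorm_eq0/eqP.
  by rewrite subr_eq0 => /eqP.
have far xi : L xi -> exists2 eta, L eta & D <= enorm (xi - eta).
  move=> Lxi; have := enorm_triangle a xi b; rewrite (enormB a xi) => h.
  have [h1|h1] := leP D (enorm (xi - a)); first by exists a.
  by exists b => //; move: h h1; rewrite /D; lra.
have e1 : 0 < Num.min e 1 by rewrite lt_min e0/=.
have [kap /andP[kap0 kap4] kapP] := @hdist_lt_of_enorm R n _ e1.
(* The depth s / 32 puts p i within ln 128 - ln s of the centre, as om <= 4 exp(-d); one unit is for
   the distance from p i to the points of its cube, the other is slack. *)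
pose C := hdist z o0 + 1 + ln 128 + 1.
pose c := (8 * (kap / 32) / n.+1%:R) ^+ n.+1.
exists C, c, (16 * D); split.
- by rewrite exprn_gt0// !mulr_gt0// invr_gt0.
- by rewrite mulr_gt0.
move=> s r k x s0 sd Csr [Lx sep].
have /choice[p pP] i : exists p, [/\ hull L p, enorm (bval p - x i) <= s / 8 & s / 32 <= om p].
  exact: hull_point LS (Lx i) (far _ (Lx i)) s0 sd.
have op i : om (p i) <= s / 4.
  have [_ h1 _] := pP i; have := enorm_dist (bval (p i)) (x i).
  rewrite (LS _ (Lx i)) ler_norml => /andP[h2 _].
  rewrite omE; have := enorm_ge0 (bval (p i)); have := bval_lt1 (p i); nra.
pose rho := kap / 32 * s / n.+1%:R.
have rho0 : 0 < rho by rewrite !mulr_gt0// invr_gt0.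
have nrho : n.+1%:R * rho = kap / 32 * s.
  by rewrite /rho mulrC divfK// pnatr_eq0.
(* In the cube om <= 3/2 om (p i) <= 3 s / 8, so 2 / om exceeds 4 / s. *)
pose w : R := (4 / s) ^+ n.+1.
have -> : c * k%:R = \sum_(i < k) w * (2 * rho) ^+ n.+1.
  rewrite sumr_const card_ord -[RHS]mulr_natr; congr (_ * _).
  rewrite -exprMn /c /rho; congr (_ ^+ _).
  have : (n.+1%:R : R) != 0 by rewrite pnatr_eq0.
  by move: (n.+1%:R : R) => N N0; field; rewrite N0/= gt_eqF.
apply: (@hvol_ge _ _ _ (fun i => bval (p i)) (fun=> rho) (fun=> w)).
- by move=> _; exact: ltW.
- by move=> _; rewrite exprn_ge0// divr_ge0// ltW.
- move=> i v; rewrite nrho enormB => vp; have [Hp h1 h2] := pP i.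
  have h3 : enorm (bval (p i) - v) <= kap * om (p i).
    by apply: le_trans vp _; rewrite -mulrA ler_pM2l//; lra.
  have v1 : enorm v < 1.
    apply: (@enorm_lt1_near _ _ (p i)); apply: le_trans h3 _.
    by rewrite mulrC ler_pM2l ?om_gt0//; lra.
  exists (hpoint v1); split=> //.
    have := kapP (p i) (hpoint v1) h3; rewrite lt_min => /andP[d1 d2].
    split; last by exists (p i) => //; rewrite hdistC.
    rewrite /hopen_ball/=; apply: lt_le_trans Csr.
    have t1 := hdist_triangle z o0 (hpoint v1).
    have t2 := hdist_triangle o0 (p i) (hpoint v1).
    have t3 : hdist o0 (p i) <= ln 128 - ln s.
      have := le_trans h2 (om_le (p i)).
      rewrite -ln_div ?posrE// => h4.
      rewrite -[leLHS]expRK ler_ln ?posrE ?expR_gt0 ?divr_gt0// ler_pdivlMr//.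
      move: h4; rewrite expRN; set E := expR _ => h4.
      have E0 : 0 < E by exact: expR_gt0.
      by move: h4; rewrite ler_pdivlMr//; lra.
    rewrite /C; lra.
  rewrite /w /vdens lerXn2r ?nnegrE ?divr_ge0 ?(ltW (om_gt0 _)) ?(ltW s0)//.
  have /andP[_ ov] := om_near (y := hpoint v1) kap4 h3.
  have ov0 := om_gt0 (hpoint v1); have := op i => opi.
  by rewrite ler_pdivrMr// mulrAC ler_pdivlMr//; nra.
- move=> i j ij; rewrite mulrDr !nrho.
  have [_ hi _] := pP i; have [_ hj _] := pP j; have := sep i j ij.
  have := enorm_triangle (x i) (bval (p i)) (x j).
  have := enorm_triangle (bval (p i)) (bval (p j)) (x j).
  rewrite (enormB (x i) (bval _)); nra.
Qed.

Lemma hvol_ge0 (A : set (hyp R n)) : (0 <= hvol A)%E.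
Proof.
have [mu muE _] := @lebesgue_tuple_measureP R n.+1.
rewrite /hvol muE integral_mkcond; apply: integral_ge0 => t _.
exact: (hdensity_ge0 A t).
Qed.

End core_volume.

Section limsup_tools.
Context {R : realType}.
Local Open Scope ereal_scope.

Lemma le_ereal_eps (x y : \bar R) :
  (forall s d : R, y < s%:E -> (0 < d)%R -> x <= (s + d)%:E) -> x <= y.
Proof.
case: y => [y| |] h; last 2 first.
- exact: leey.
- case: x h => [x| |] h //.
    have := h (x - 2)%R 1%R (ltNyr _) ltr01; rewrite lee_fin => ?; exfalso; lra.
  by have := h 0%R 1%R (ltNyr _) ltr01; rewrite leNgt ltry.
apply/lee_addgt0Pr => e e0; rewrite -EFinD.
have := h (y + e / 2)%R (e / 2)%R; rewrite -addrA -splitr; apply.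
  by rewrite lte_fin ltrDl divr_gt0.
by rewrite divr_gt0.
Qed.

Lemma limf_esup_le (f : R -> \bar R) (F : set_system R) (s : \bar R) :
  (\forall x \near F, f x <= s) -> limf_esup f F <= s.
Proof.
move=> h; apply: (@le_trans _ _ (ereal_sup (f @` [set x | f x <= s]))).
  by apply: ereal_inf_lbound; exists [set x | f x <= s].
by apply: ge_ereal_sup => _ [x /= xs <-].
Qed.

Lemma limf_esup_lt (f : R -> \bar R) (F : set_system R) (s : \bar R) :
  Filter F -> limf_esup f F < s -> \forall x \near F, f x < s.
Proof.
move=> FF /ereal_inf_lt[_ [V FV <-] Vs]; apply: filterS FV => x Vx.
by apply: le_lt_trans Vs; apply: ereal_sup_ubound; exists x.
Qed.

Lemma near_right0P (P : R -> Prop) : (\forall e \near (0 : R)^'+, P e) <->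
  exists2 d : R, (0 < d)%R & forall e, (0 < e)%R -> (e < d)%R -> P e.
Proof.
split=> [/nbhs_ballP[d /= d0 h]|[d d0 h]].
  exists d => // e e0 ed; apply: h => //.
  by rewrite /ball/= sub0r normrN gtr0_norm.
apply/nbhs_ballP; exists d => //= e; rewrite /ball/= sub0r normrN => ed e0.
by apply: h => //; rewrite -(gtr0_norm e0).
Qed.

Lemma lee_divr_le (r : R) (x y : \bar R) : (0 < r)%R ->
  (x / r%:E <= y) = (x <= y * r%:E).
Proof. by move=> r0; rewrite inver gt_eqF// lee_pdivrMr. Qed.

Lemma lte_divr_lt (r : R) (x y : \bar R) : (0 < r)%R ->
  (x / r%:E < y) = (x < y * r%:E).
Proof. by move=> r0; rewrite inver gt_eqF// lte_pdivrMr. Qed.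

Lemma le_lne (x y : \bar R) : 0 <= x -> x <= y -> lne x <= lne y.
Proof.
move=> x0 xy; rewrite lee_lne// in_itv/= leey andbT//.
exact: le_trans xy.
Qed.

(** The inequality ln u <= u - 1 at u = a y. With a small slope a it makes the factor K + 1 of
    [hvol_core_le] negligible. *)
Lemma ln_le_linear (a y : R) : (0 < a)%R -> (0 < y)%R -> (ln y <= a * y - ln a)%R.
Proof.
move=> a0 y0; rewrite lerBrDr addrC -lnM ?posrE//.
have ay : (0 < a * y)%R by rewrite mulr_gt0.
have := @le_ln1Dx R (a * y - 1)%R; rewrite (addrC 1%R) subrK => h.
by have := h ltac:(lra); lra.
Qed.

Lemma ln_natr_ge0 (k : nat) : (1 <= k)%N -> (0 <= ln (k%:R : R))%R.
Proof. by move=> k1; rewrite ln_ge0// ler1n. Qed.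

End limsup_tools.

(** * Covering numbers against volume growth *)

Section box_dimension.
Context {R : realType} {n : nat}.
Implicit Types (L : set 'rV[R]_n.+1) (z : hyp R n) (e s d r : R).
Local Notation o0 := (@horigin R n).

Definition core_volume L z e r : \bar R :=
  hvol (hopen_ball z r `&` hneighbourhood e (hull L)).

Lemma sphere_covers L e : L `<=` unit_sphere -> 0 < e ->
  exists2 k : nat, covering_number e L = k%:R%:E & covers k e L.
Proof.
move=> LS e0; have [|k /covering_numberP//] := covers_bounded (A := L) e0.
by move=> x /LS ->.
Qed.

Lemma box_dim_le_core L z e a b : L `<=` unit_sphere -> L a -> L b -> a <> b ->
  0 < e -> (limf_esup (fun e => lne (covering_number e L) / (- ln e)%:E) 0^'+
  <= limf_esup (fun r => lne (core_volume L z e r) / r%:E) +oo%R)%E.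
Proof.
move=> LS La Lb ab e0; apply: le_ereal_eps => s d hs d0.
have [M [_ hM]] := limf_esup_lt _ hs.
have [C [c [d1 [c0 d10 hv]]]] := hvol_core_ge z LS La Lb ab e0.
(* The volume bound at r = C - ln (eps / 2) reads ln k < s (- ln eps) + Q. Of the four bounds on eps
   below, the third makes r exceed M and the last lets d absorb Q. *)
pose Q := s * (C + ln 2) - ln c.
apply/limf_esup_le/near_right0P.
exists (Num.min (Num.min 1 d1) (Num.min (expR (C - `|M| - 1)) (expR (- (`|Q| / d))))).
  by rewrite !lt_min ltr01 d10 !expR_gt0.
move=> eps eps0; rewrite !lt_min => /andP[/andP[h1 h2] /andP[h3 h4]].
have l0 : 0 < - ln eps by rewrite oppr_gt0 ln_lt0// eps0.
have l3 : ln eps < C - `|M| - 1 by rewrite -ltr_expR lnK.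
have l4 : `|Q| / d < - ln eps by rewrite ltrNr -ltr_expR lnK.
have e20 : 0 < eps / 2 by rewrite divr_gt0.
have [k [x [xsep xcov]]] := @maximal_separated R n.+1 _ L e20 (fun x Lx => ltac:(by rewrite (LS _ Lx))).
have {}xcov : covers k eps L by move: xcov; rewrite mulrC divfK.
have [k' Nk' cov'] := covering_numberP xcov.
have k'1 : (1 <= k')%N by apply: covers_ge1 cov'; exists a.
have k'k : (k' <= k)%N.
  by rewrite -(ler_nat R) -lee_fin -Nk' covering_number_le.
have k1 := leq_trans k'1 k'k.
pose r := C - ln (eps / 2).
have ln2 : 0 < ln 2 :> R by rewrite ln_gt0// ltr1n.
have lne2 : ln (eps / 2) = ln eps - ln 2 by rewrite ln_div ?posrE.
have M0 := normr_ge0 M; have MM := ler_norm M.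
have rM : M < r by rewrite /r lne2; lra.
have r0 : 0 < r by rewrite /r lne2; lra.
have := hM r rM; rewrite lte_divr_lt// => volr.
have vk := hv _ r _ _ e20 ltac:(lra) (lexx _) xsep.
have ck0 : 0 < c * k%:R by rewrite mulr_gt0// ltr0n.
have : (lne (c * k%:R)%:E < (s * r)%:E)%E.
  by apply: le_lt_trans volr; apply: le_lne => //; rewrite lee_fin ltW.
rewrite lne_EFin// lte_fin lnM ?posrE ?ltr0n// => hk.
rewrite lee_divr_le// Nk' lne_EFin ?ltr0n// -EFinM lee_fin.
have lk : ln (k'%:R : R) <= ln k%:R by rewrite ler_ln ?posrE ?ltr0n// ler_nat.
have Qd : Q <= d * - ln eps.
  by have := ler_norm Q; move: l4; rewrite ltr_pdivrMr//; lra.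
move: hk Qd; rewrite /r /Q lne2; nra.
Qed.

Lemma core_le_box_dim L z e : L `<=` unit_sphere -> L !=set0 ->
  (limf_esup (fun r => lne (core_volume L z e r) / r%:E) +oo%R <=
  limf_esup (fun e => lne (covering_number e L) / (- ln e)%:E) 0^'+)%E.
Proof.
move=> LS L0; apply: le_ereal_eps => s d hs d0.
have [e0 e00 he] := (near_right0P _).1 (limf_esup_lt _ hs).
have [C C0 hv] := hvol_core_le z e LS.
pose D := hdist o0 z; have D0 : 0 <= D := hdist_ge0 _ _.
(* Constants left over when ln C + ln (K + 1) + ln k is bounded using K <= r + D + 1; half of d pays
   for ln (K + 1), the other half for Q. *)
pose Q := ln C + d / 2 * (D + 2) - ln (d / 2) + s * (D + 1).
apply: limf_esup_le; exists (`|ln e0| + `|Q| * 2 / d); split; first exact: num_real.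
move=> r hr.
have Q0 := normr_ge0 Q; have le0 := normr_ge0 (ln e0).
have Qd0 : 0 <= `|Q| * 2 / d by rewrite divr_ge0 ?mulr_ge0// ltW.
have r0 : 0 < r by lra.
have rD : 0 <= r + D by lra.
pose K := (Num.trunc (r + D)).+1.
have [K1 K2] : r + D <= K%:R /\ K%:R <= r + D + 1.
  have /andP[t1 t2] := truncn_itv rD; split; first exact: ltW.
  by rewrite /K -natr1; lra.
have KK : 0 < - ln (expR (- K%:R)) :> R by rewrite expRK opprK ltr0n.
have Ke : expR (- K%:R) < e0.
  rewrite -[e0]lnK ?posrE// ltr_expR; have := ler_norm (- ln e0).
  by rewrite normrN; lra.
have [k Nk cov] := sphere_covers LS (expR_gt0 (- K%:R)).
have k1 := covers_ge1 L0 cov.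
have := he _ (expR_gt0 _) Ke.
rewrite lte_divr_lt// Nk lne_EFin ?ltr0n// -EFinM lte_fin expRK opprK => hk.
have := ln_natr_ge0 (R := R) k1 => lk0.
have s0 : 0 < s.
  have K0 : 0 < K%:R :> R by rewrite ltr0n.
  by rewrite -(pmulr_lgt0 _ K0); lra.
have hvk := hv r K k K1 cov.
rewrite lee_divr_le//; apply: le_trans (le_lne (hvol_ge0 _) hvk) _.
have k0 : 0 < k%:R :> R by rewrite ltr0n.
have K10 : 0 < K.+1%:R :> R by rewrite ltr0n.
rewrite lne_EFin ?mulr_gt0// -EFinM lee_fin !lnM ?posrE ?mulr_gt0//.
have d20 : 0 < d / 2 by lra.
have h1 : ln (K.+1%:R : R) <= d / 2 * K.+1%:R - ln (d / 2) := ln_le_linear d20 K10.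
have h2 : d / 2 * K.+1%:R <= d / 2 * (r + D + 2).
  by rewrite ler_pM2l// -natr1; lra.
have h3 : s * K%:R <= s * (r + D + 1) by rewrite ler_pM2l.
have h4 : Q <= d / 2 * r.
  have := ler_norm Q; have : `|Q| * 2 / d < r by lra.
  by rewrite ltr_pdivrMr//; lra.
move: h4; rewrite /Q; lra.
Qed.

End box_dimension.

(** * Hausdorff dimension against box dimension *)

Section hausdorff_box.
Context {R : realType} {n : nat}.
Implicit Types (A : set 'rV[R]_n) (e s d r t : R).

Lemma hausdorff_content_le A k e t d : covers k e A -> 0 < t -> 0 < e -> e <= d ->
  (hausdorff_content t d A <= (k%:R * expR (t * ln e))%:E)%E.
Proof.
move=> [U [AU Ue]] t0 e0 ed.
pose V i := if insub i is Some j then U j else set0.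
have Vt i : (ediam (V i) `^ t <= (expR (t * ln e))%:E)%E.
  rewrite /V; case: insubP => [j _ _|_]; last first.
    by rewrite ediam0 poweR0r ?gt_eqF// lee_fin expR_ge0.
  have -> : (expR (t * ln e))%:E = (e%:E `^ t)%E.
    by rewrite poweR_EFin /powR gt_eqF.
  apply: gt0_ler_poweR => //; first exact: ltW.
  - by rewrite in_itv/= ediam_ge0 leey.
  - by rewrite in_itv/= leey lee_fin ltW.
apply: (@le_trans _ _ (\sum_(0 <= i <oo) ediam (V i) `^ t)%E).
  apply: ereal_inf_lbound; exists V => //; split=> [x /AU[j _ Ux]|i].
    by exists (val j) => //; rewrite /V valK.
  rewrite /V; case: insubP => [j _ _|_]; last by rewrite ediam0 lee_fin; lra.
  by apply: le_trans (Ue j) _; rewrite lee_fin.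
rewrite (nneseries_split 0 k); last by move=> i _; exact: poweR_ge0.
rewrite add0n [X in (_ + X)%E]eseries0 ?adde0; last first.
  move=> i ki _; rewrite /V insubN; first by rewrite ediam0 poweR0r// gt_eqF.
  by rewrite -leqNgt.
apply: (@le_trans _ _ (\sum_(0 <= i < k) (expR (t * ln e))%:E)%E).
  by apply: lee_sum.
by rewrite sumEFin sumr_const_nat subn0 lee_fin mulr_natl.
Qed.

Lemma hausdorff_measure0 A t : 0 < t ->
  (forall d h, 0 < d -> 0 < h -> exists k e,
    [/\ 0 < e, e <= d, covers k e A & k%:R * expR (t * ln e) <= h]) ->
  hausdorff_measure t A = 0%E.
Proof.
move=> t0 h; apply/eqP; rewrite eq_le; apply/andP; split.
  apply: ge_ereal_sup => _ [d /= d0 <-]; apply/lee_addgt0Pr => h0 h00.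
  have [k [e [e0 ed cov ke]]] := h d h0 d0 h00.
  rewrite add0e; apply: le_trans (hausdorff_content_le cov t0 e0 ed) _.
  by rewrite lee_fin.
apply: (@le_trans _ _ (hausdorff_content t 1 A)).
  apply: le_ereal_inf_tmp => _ [U _ <-]; apply: nneseries_ge0 => i _ _.
  exact: poweR_ge0.
by apply: ereal_sup_ubound; exists 1 => //=.
Qed.

Lemma hausdorff_dim_le A t : 0 < t -> hausdorff_measure t A = 0%E ->
  (hausdorff_dim A <= t%:E)%E.
Proof. by move=> t0 h; apply: ereal_inf_lbound; exists t. Qed.

Lemma hausdorff_le_box A : (forall x, A x -> enorm x <= 1) ->
  (hausdorff_dim A <= upper_box_dim A)%E.
Proof.
move=> A1; rewrite /upper_box_dim; case: eqP => [->|/eqP/set0P A0].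
  apply/lee_addgt0Pr => t t0; rewrite add0e; apply: hausdorff_dim_le => //.
  apply: hausdorff_measure0 => // d h d0 h0; exists 0%N, d; split => //.
    by exists (fun=> set0); split=> [x []|[]].
  by rewrite mul0r ltW.
apply: le_ereal_eps => s d hs d0.
have [e0 e00 he] := (near_right0P _).1 (limf_esup_lt _ hs).
have key e : 0 < e -> e < e0 -> e < 1 ->
    exists2 k : nat, covers k e A & 0 <= ln (k%:R : R) < s * - ln e /\ (1 <= k)%N.
  move=> ep ee0 e1; have [k0 /covering_numberP[k Nk cov]] := covers_bounded ep A1.
  have k1 := covers_ge1 A0 cov; exists k => //; split=> //.
  rewrite ln_natr_ge0//=; have := he _ ep ee0.
  rewrite lte_divr_lt; last by rewrite oppr_gt0 ln_lt0// ep.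
  by rewrite Nk lne_EFin ?ltr0n// -EFinM lte_fin.
have s0 : 0 < s.
  pose e := Num.min (e0 / 2) (1 / 2).
  have ep : 0 < e by rewrite lt_min !divr_gt0.
  have e1 : e < 1 by rewrite gt_min; apply/orP; right; lra.
  have ee0 : e < e0 by rewrite gt_min; apply/orP; left; lra.
  have [k _ [/andP[h1 h2] _]] := key e ep ee0 e1.
  have : 0 < s * - ln e by lra.
  by rewrite pmulr_lgt0// oppr_gt0 ln_lt0// ep.
apply: hausdorff_dim_le; first by rewrite addr_gt0.
apply: hausdorff_measure0; first by rewrite addr_gt0.
move=> d1 h d10 h0.
(* The last bound gives d ln e <= - |ln h|; as k < e^(-s), it follows that k e^(s + d) <= e^d <=
   h. *)
pose e := Num.min (Num.min d1 (e0 / 2)) (Num.min (1 / 2) (expR (- (`|ln h| / d)))).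
have ep : 0 < e by rewrite !lt_min d10 expR_gt0 !divr_gt0.
have ed1 : e <= d1 by rewrite !ge_min lexx.
have ee0 : e < e0.
  by apply: (@le_lt_trans _ _ (e0 / 2)); [rewrite !ge_min lexx orbT|lra].
have e1 : e < 1.
  by apply: (@le_lt_trans _ _ (1 / 2)); [rewrite !ge_min lexx !orbT|lra].
have eh : e <= expR (- (`|ln h| / d)) by rewrite !ge_min lexx !orbT.
have [k cov [/andP[h1 h2] k1]] := key e ep ee0 e1.
exists k, e; split => //.
rewrite -[k%:R]lnK ?posrE ?ltr0n// -expRD -[leRHS]lnK ?posrE// ler_expR.
have : ln e <= - (`|ln h| / d) by rewrite -[leRHS]expRK ler_ln ?posrE ?expR_gt0.
rewrite lerNr ler_pdivrMr// => h3.
have := ler_norm (- ln h); rewrite normrN; nra.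
Qed.

End hausdorff_box.

Section entropy_of_closed_sets.
Context {R : realType} {n : nat}.
Implicit Types (L : set 'rV[R]_n.+1) (z : hyp R n).

Lemma card_le_sub_image {T : Type} (A : set T) (f : nat -> T) (k : nat) :
  A `<=` f @` `I_k -> (A #<= `I_k)%card.
Proof. by move=> /subset_card_le /card_le_trans; apply; exact: card_image_le. Qed.

Lemma card_le1_eq {T : Type} (A : set T) (a b : T) :
  (A #<= `I_1)%card -> A a -> A b -> a = b.
Proof.
move=> /pcard_leP[f] Aa Ab.
have fa : (f a < 1)%N by exact: (@funS _ _ _ _ f a Aa).
have fb : (f b < 1)%N by exact: (@funS _ _ _ _ f b Ab).
have fab : f a = f b by move: fa fb; rewrite !ltnS !leqn0 => /eqP -> /eqP ->.
exact: (@inj _ _ _ f a b (mem_set Aa) (mem_set Ab) fab).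
Qed.

Lemma box_dim_eq_core_entropy L z (e : R) : L `<=` unit_sphere -> 0 < e ->
  upper_box_dim L = convex_core_entropy z e L.
Proof.
move=> LS e0; rewrite /upper_box_dim /convex_core_entropy.
have [->|/eqP/set0P L0] := eqP.
  by rewrite asboolT//; apply: (@card_le_sub_image _ _ (fun=> 0)).
have [[a [b [La Lb ab]]]|nab] := pselect (exists a b, [/\ L a, L b & a <> b]).
  rewrite asboolF; last by move=> h; apply: ab; exact: card_le1_eq h La Lb.
  apply/eqP; rewrite eq_le; apply/andP; split.
    exact: box_dim_le_core LS La Lb ab e0.
  exact: core_le_box_dim.
have [a La] := L0.
have La1 x : L x -> x = a.
  by move=> Lx; apply: contrapT => xa; apply: nab; exists x, a.
rewrite asboolT; last first.
  by apply: (@card_le_sub_image _ _ (fun=> a)) => x /La1 ->; exists 0%N.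
(* For a single point the entropy is 0 by convention, whereas the box dimension has to be
   computed. *)
have cov1 d : 0 < d -> covering_number d L = 1%E.
  move=> d0; have [k Nk cov] := sphere_covers LS d0.
  have k1 := covers_ge1 L0 cov; rewrite Nk; congr EFin.
  suff : (k <= 1)%N by case: k k1 {Nk cov} => [|[|]].
  rewrite -(ler_nat R) -lee_fin -Nk; apply: covering_number_le.
  exists (fun=> [set a]); split=> [x /La1 ->|_]; first by exists ord0.
  by apply: ediam_le => [|x y -> ->]; rewrite ?subrr ?enorm0 ltW.
have lim0 (s : \bar R) : (s = 0)%E -> (limf_esup (fun e => lne (covering_number e L) / (- ln e)%:E) 0^'+ <= s)%E.
  move=> ->; apply/limf_esup_le/near_right0P; exists 1 => // d d0 d1.
  by rewrite cov1// lne1 mul0e.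
apply/eqP; rewrite eq_le lim0//=.
rewrite leNgt; apply/negP => hlt.
have [d d0 h] := (near_right0P _).1 (limf_esup_lt _ hlt).
have := h (d / 2); rewrite cov1 ?divr_gt0// lne1 mul0e ltxx.
by move/(_ isT)/(_ ltac:(lra)).
Qed.

End entropy_of_closed_sets.

(** * Discrete groups *)

Section discreteness.
Context {R : realType} {n : nat}.
Implicit Types (x y z p : hyp R n) (g h : hyp R n -> hyp R n) (r e : R).
Implicit Types (G : set (hyp R n -> hyp R n)).
Local Notation o0 := (@horigin R n).

Lemma enorm_lt_of_hdist e : 0 < e -> exists2 r, 0 < r &
  forall x y, hdist x y < r -> enorm (bval x - bval y) < e.
Proof.
move=> e0; have e2 : 0 < e ^+ 2 by rewrite exprn_gt0.
have e1 : 1 <= 1 + 2 * e ^+ 2 by lra.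
exists (arcosh (1 + 2 * e ^+ 2)).
  rewrite lt_neqAle arcosh_ge0// andbT eq_sym; apply/eqP => h.
  by have := hcosh_arcosh e1; rewrite h hcosh0; lra.
move=> x y /(hcosh_lt (hdist_ge0 _ _)); rewrite (hcosh_arcosh e1) hcosh_hdist => h.
rewrite -(@ltr_pXn2r _ 2) ?nnegrE ?enorm_ge0 ?(ltW e0)// enorm_hq.
have := hq_ge0 x y; have := om_gt0 x; have := om_gt0 y.
have := om_le1 x; have := om_le1 y; move: (om x) (om y) => u v.
move: (hq x y) h => q h v1 u1 v0 u0 q0.
have : q * u <= q by nra.
have : q * u * v <= q * u by have := mulr_ge0 q0 (ltW u0); nra.
lra.
Qed.

Lemma nbhs_hdist x (U : set (hyp R n)) : nbhs x U ->
  exists2 r, 0 < r & forall y, hdist y x < r -> U y.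
Proof.
move=> /nbhs_ballP[e /= e0 eU]; have [r r0 rP] := enorm_lt_of_hdist e0.
exists r => // y /rP yx; apply: eU.
have : ball (bval x) e (bval y); last by [].
by rewrite mx_norm_ball /ball_/= (le_lt_trans (norm_le_enorm _))// enormB.
Qed.

Lemma hdist_nbhs x r : 0 < r -> \forall y \near x, hdist y x < r.
Proof.
move=> r0; have [c /andP[c0 _] cP] := @hdist_lt_of_enorm R n r r0.
have e0 : 0 < c * om x by rewrite mulr_gt0// om_gt0.
have /nbhs_ballP[d /= d0 dU] := near_enorm (bval x) e0.
apply/nbhs_ballP; exists d => //= y xy; rewrite hdistC; apply: cP.
rewrite enormB; apply: ltW; exact: dU.
Qed.

(** On the hyperbolic ball of radius r one has om >= exp(-r), so Euclidean closeness at scale c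
    exp(-r) implies hyperbolic closeness. Net points are replaced by nearby points of that ball,
    where there are any. *)
Lemma hdist_net r e : 0 < e -> exists (I : finType) (p : I -> hyp R n),
  forall x, hdist o0 x <= r -> exists i, hdist (p i) x < e.
Proof.
move=> e0; have [c /andP[c0 _] cP] := @hdist_lt_of_enorm R n e e0.
have [|I [a aP]] := @unit_ball_net R n.+1 (c * expR (- r) / 2).
  by rewrite divr_gt0// mulr_gt0// expR_gt0.
have /choice[p pP] i : exists p : hyp R n, forall x, hdist o0 x <= r ->
    enorm (bval x - a i) <= c * expR (- r) / 2 -> hdist p x < e.
  have [[y [yr ya]]|ny] := pselect (exists y, hdist o0 y <= r /\
      enorm (bval y - a i) <= c * expR (- r) / 2).
    exists y => x xr xa; apply: cP.
    have : expR (- r) <= om y by apply: le_trans (om_ge y); rewrite ler_expR lerN2.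
    have := enorm_triangle (bval y) (a i) (bval x); rewrite (enormB (a i)); nra.
  by exists o0 => x xr xa; exfalso; apply: ny; exists x.
exists I, p => x xr; have [i xi] := aP (bval x) (ltW (bval_lt1 x)).
by exists i; exact: pP.
Qed.

(** Let W e be the set of maps moving every point of the closed ball of radius 1 / e by less than e.
    As e tends to 0 these sets generate a filter converging to the identity in the compact-open
    topology, so some W e lies in the isolating neighbourhood. *)
Lemma kleinian_isolated_id G : kleinian G -> exists2 e, 0 < e &
  forall g, G g -> (forall x, hdist o0 x <= e^-1 -> hdist (g x) x < e) -> g = id.
Proof.
move=> [[Gid _ _] _ Giso].
have [_ [V idV VG]] := Giso _ Gid.
pose W e := [set g | forall x, hdist o0 x <= e^-1 -> hdist (g x) x < e].
pose F : set_system (hyp R n -> hyp R n) := filter_from [set e : R | 0 < e] W.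
have FF : Filter F.
  apply: filter_from_filter; first by exists 1 => /=.
  move=> a b /= a0 b0; exists (Num.min a b); first by rewrite /= lt_min a0.
  have m0 : 0 < Num.min a b by rewrite lt_min a0.
  move=> g gW; split=> x xr.
    have : hdist (g x) x < Num.min a b.
      by apply: gW; apply: le_trans xr _; rewrite lef_pV2 ?posrE// ge_min lexx.
    by rewrite lt_min => /andP[].
  have : hdist (g x) x < Num.min a b.
    by apply: gW; apply: le_trans xr _; rewrite lef_pV2 ?posrE// ge_min lexx orbT.
  by rewrite lt_min => /andP[].
have FV : F V.
  suff : (F : set_system {compact-open, hyp R n -> hyp R n}) --> (id : {compact-open, hyp R n -> hyp R n}) by apply.
  apply/compact_open_cvgP => K O cK oO KO.
  have : \forall e \near (0 : R)^'+, K `<=` [set x | hdist o0 x <= e^-1 /\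
      forall y, hdist y x < e -> O y].
    have /compact_near_coveringP cov := cK.
    apply: (cov R (0 : R)^'+ (fun e x => hdist o0 x <= e^-1 /\
      forall y, hdist y x < e -> O y)) => x Kx.
    have [r r0 rO] : exists2 r, 0 < r & forall y, hdist y x < r -> O y.
      by apply: nbhs_hdist; apply: open_nbhs_nbhs; split=> //; apply: KO; exists x.
    pose q := Num.min (r / 2) 1.
    have q0 : 0 < q by rewrite lt_min divr_gt0//= ltr01.
    pose m := Num.min (r / 2) (hdist o0 x + 1)^-1.
    have d0 : 0 < hdist o0 x + 1 by have := hdist_ge0 o0 x; lra.
    have m0 : 0 < m by rewrite lt_min divr_gt0//= invr_gt0.
    exists ([set y | hdist y x < q], [set e : R | 0 < e /\ e < m]).
      split; first exact: hdist_nbhs.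
      by apply/near_right0P; exists m.
    move=> [y e] /= [yx [e00 em]].
    move: yx em; rewrite !lt_min => /andP[yr y1] /andP[er ed]; split.
      have : (hdist o0 x + 1) <= e^-1.
        by rewrite -(invrK (_ + 1)) lef_pV2 ?posrE ?invr_gt0// ltW.
      by have := hdist_triangle o0 x y; rewrite (hdistC x); lra.
    by move=> z zy; apply: rO; have := hdist_triangle z y x; lra.
  move=> /near_right0P[d d0 h]; exists (d / 2); first by rewrite /= divr_gt0.
  have [d1 d2] : 0 < d / 2 /\ d / 2 < d by split; [rewrite divr_gt0|lra].
  move=> g gW _ [x Kx <-].
  have [xr xO] := h _ d1 d2 _ Kx; apply: xO; exact: gW.
have [e /= e0 eV] := FV; exists e => // g Gg gW.
have : (V `&` G) g by split=> //; exact: eV.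
by rewrite VG.
Qed.

Lemma kleinian_isometric G g : kleinian G -> G g -> isometric g.
Proof. by move=> [_ GI _] /GI[]. Qed.

Lemma kleinian_inv G g : kleinian G -> G g ->
  exists h, [/\ G h, cancel g h & cancel h g].
Proof. by move=> [[_ _ Ginv] _ _] /Ginv[h Gh [gh hg]]; exists h. Qed.

Lemma kleinian_comp G g h : kleinian G -> G g -> G h -> G (g \o h).
Proof. by move=> [[_ Gc _] _ _] Gg Gh; exact: Gc. Qed.

(** Arzela-Ascoli by pigeonhole: g is coded by the net points q j approximating the images of the
    net points p i. Equal codes for g and h make h^-1 g move each point of the ball of radius 1 / e
    by less than e, in four steps of e / 4, so g = h. *)
Lemma kleinian_finite G r : kleinian G ->
  finite_set [set g | G g /\ hdist o0 (g o0) <= r].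
Proof.
move=> kG; have [e e0 eP] := kleinian_isolated_id kG.
have e4 : 0 < e / 4 by rewrite divr_gt0.
have [I [p pP]] := hdist_net e^-1 e4.
pose M := \big[Num.max/0]_(i : I) hdist o0 (p i).
have [J [q qP]] := hdist_net (M + `|r|) e4.
set A := [set g | _].
have /choice[f fP] g : exists f : {ffun I -> J}, A g ->
    forall i, hdist (q (f i)) (g (p i)) < e / 4.
  have [[Gg gr]|nA] := pselect (A g); last first.
    have [|j _] := qP o0; first by rewrite hdistxx addr_ge0// bigmax_ge_id.
    by exists [ffun=> j] => /nA.
  have /choice[f fP] i : exists j, hdist (q j) (g (p i)) < e / 4.
    apply: qP; apply: le_trans (hdist_triangle _ (g o0) _) _.
    rewrite (kleinian_isometric kG Gg) addrC lerD//; last exact: le_trans (ler_norm r).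
    exact: (le_bigmax _ (fun i => hdist o0 (p i))).
  by exists (finfun f) => _ i; rewrite ffunE.
have finj : {in A &, injective f}.
  move=> g h /set_mem Ag /set_mem Ah fgh.
  have [Gg _] := Ag; have [Gh _] := Ah.
  have [k [Gk hk kh]] := kleinian_inv kG Gh.
  suff kg : k \o g = id.
    by apply/funext => x; rewrite -{2}[x](congr1 (fun u => u x) kg) /= kh.
  apply: eP => [|x xe]; first exact: kleinian_comp.
  have -> : hdist ((k \o g) x) x = hdist (g x) (h x).
    by rewrite /= -(kleinian_isometric kG Gh) kh.
  have [i pix] := pP x xe.
  have h1 := fP g Ag i; have h2 := fP h Ah i; rewrite -fgh in h2.
  have t1 := hdist_triangle (g x) (g (p i)) (h x).
  have t2 := hdist_triangle (g (p i)) (q (f g i)) (h x).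
  have t3 := hdist_triangle (q (f g i)) (h (p i)) (h x).
  rewrite (kleinian_isometric kG Gg) in t1.
  rewrite (kleinian_isometric kG Gh) in t3.
  rewrite (hdistC (g (p i)) (q _)) in t2; rewrite (hdistC x) in t1.
  lra.
by rewrite -(eq_finite_set (inj_card_eq finj)); exact: finite_finset.
Qed.

Lemma kleinian_count G r : kleinian G -> exists N : nat,
  forall l : seq (hyp R n -> hyp R n), uniq l ->
    (forall g, g \in l -> G g /\ hdist o0 (g o0) <= r) -> (size l <= N)%N.
Proof.
move=> kG; have /finite_seqP[s sE] := kleinian_finite r kG.
exists (size s) => l lu lG; apply: uniq_leq_size => // g /lG gA.
have : [set g | G g /\ hdist o0 (g o0) <= r] g by [].
by rewrite sE.
Qed.

End discreteness.

(** * A lower bound for Hausdorff measure *)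

Section cylinders.
Context {R : realType} {M : nat}.
Implicit Types (w : seq 'I_M) (v : nat -> seq 'I_M).
Local Open Scope ereal_scope.

Let mass (k : nat) : R := ((M%:R^-1) ^+ k)%R.

Let mass_ge0 k : (0 <= mass k)%R.
Proof. by rewrite exprn_ge0// invr_ge0. Qed.

(* Total mass of the cylinders of the family that lie inside the cylinder of w. *)
Let below v w : \bar R :=
  \sum_(0 <= i <oo) (if prefix w (v i) then (mass (size (v i)))%:E else 0).

Let term_ge0 v w i : 0 <= (if prefix w (v i) then (mass (size (v i)))%:E else 0).
Proof. by case: ifP => // _; rewrite lee_fin. Qed.

Let below_neq v w i : below v w < (mass (size w))%:E -> v i <> w.
Proof.
move=> h vw; move: h; rewrite ltNge => /negP; apply.
apply: (@le_trans _ _ (\sum_(0 <= j < i.+1)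
   (if prefix w (v j) then (mass (size (v j)))%:E else 0))); last first.
  by apply: nneseries_lim_ge => j _ _; exact: term_ge0.
rewrite big_nat_recr//= vw prefix_refl leeDr//.
by apply: sume_ge0 => j _; exact: term_ge0.
Qed.

(** No member equals w, so the members below w split according to their next letter, while the M
    children share the mass of w equally: some child is under-covered too. *)
Let below_child v w : (0 < M)%N -> below v w < (mass (size w))%:E ->
  exists c, below v (rcons w c) < (mass (size (rcons w c)))%:E.
Proof.
move=> M0 h; apply: contrapT => nc.
have {}nc c : (mass (size w).+1)%:E <= below v (rcons w c).
  by rewrite leNgt; apply/negP => hc; apply: nc; exists c; rewrite size_rcons.
have : \sum_(c : 'I_M) (mass (size w).+1)%:E <= \sum_(c : 'I_M) below v (rcons w c).
  by apply: lee_sum => c _; exact: nc.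
have -> : \sum_(c : 'I_M) (mass (size w).+1)%:E = (mass (size w))%:E.
  rewrite sumEFin sumr_const card_ord /mass exprS -mulrnAl -mulr_natr mulVf ?mul1r//.
  by rewrite pnatr_eq0 -lt0n.
suff -> : \sum_(c : 'I_M) below v (rcons w c) = below v w by rewrite leNgt h.
rewrite -nneseries_sum; last by move=> c j _; exact: term_ge0.
apply: eq_eseriesr => i _; have viw := below_neq (i := i) h.
case: ifPn => [/prefixP[s vs]|npre].
  case: s vs => [|c s] vs; first by rewrite cats0 in vs.
  rewrite (bigD1 c)//= big1 ?adde0 => [|c' c'c].
    by rewrite vs -cat_rcons prefix_prefix.
  by rewrite vs -cats1 prefix_catr// eqxx/= (negbTE c'c).
rewrite big1// => c _; rewrite ifN//; apply: contra npre.
by rewrite -cats1 => /catl_prefix.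
Qed.

(** If the total were below 1, under-covered children could be chosen for ever, and the resulting
    infinite word would have no prefix in the family. *)
Lemma cylinder_cover v : (0 < M)%N ->
  (forall x : nat -> 'I_M, exists i, v i = mkseq x (size (v i))) ->
  1 <= \sum_(0 <= i <oo) (mass (size (v i)))%:E.
Proof.
move=> M0 vcov; rewrite leNgt; apply/negP => hlt.
pose P w := below v w < (mass (size w))%:E.
have P0 : P [::].
  rewrite /P /= /mass expr0; apply: le_lt_trans hlt.
  by apply: lee_nneseries => i *; [exact: term_ge0|rewrite prefix0s].
have /choice[next nextP] w : exists c, P w -> P (rcons w c).
  have [/(below_child M0)[c Pc]|nP] := pselect (P w); first by exists c.
  by exists (Ordinal M0) => /nP.
pose W := fix W m := if m is k.+1 then rcons (W k) (next (W k)) else [::].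
have PW m : P (W m) by elim: m => [//|m IH] /=; exact: nextP.
have WE m : W m = mkseq (fun k => next (W k)) m.
  by elim: m => [//|m IH]; rewrite mkseqS -IH.
have [i vi] := vcov (fun k => next (W k)).
by apply: (below_neq (i := i) (PW (size (v i)))); rewrite WE.
Qed.

End cylinders.

Section cantor_sets.
Context {R : realType} {m : nat}.

Lemma first_difference {T : eqType} (x y : nat -> T) (j : nat) :
  mkseq x j <> mkseq y j -> exists k : nat, [/\ (k < j)%N, x k <> y k &
    forall i, (i < k)%N -> x i = y i].
Proof.
move=> xy.
have ex : exists k, (k < j)%N && (x k != y k).
  apply: contrapT => nex; apply: xy; apply/eq_in_map => k; rewrite mem_iota add0n.
  move=> /= kj; apply/eqP/negPn/negP => xyk; apply: nex; exists k.
  by rewrite kj.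
case: (ex_minnP ex) => k /andP[kj xyk] kmin; exists k; split=> //; first exact/eqP.
move=> i ik; apply/eqP/negPn/negP => xyi.
have := kmin i; rewrite (ltn_trans ik kj) xyi => /(_ isT).
by rewrite leqNgt ik.
Qed.

(** Take the first j with c exp(-j L) <= r: points of the Cantor set within r of each other share j
    letters, and M^-j <= exp(-t L j) <= (r / c)^t. If r = 0 there is no such j, and j = i + 2 leaves
    an error summable over i. *)
Lemma cylinder_level (M : nat) (c L t r : R) (i : nat) : 0 < c -> 0 < L -> 0 < t ->
  expR (t * L) <= M%:R -> 0 <= r -> exists2 j : nat,
    forall k, (k < j)%N -> r < c * expR (- (k%:R * L)) &
    (M%:R^-1 ^+ j) <= (c `^ t)^-1 * r `^ t + 1 / 2 / (2 ^ i.+1)%:R.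
Proof.
move=> c0 L0 t0 ML r0.
have M0 : (0 : R) < M%:R by apply: lt_le_trans ML; exact: expR_gt0.
have [r00|rneq] := eqVneq r 0.
  exists i.+2 => [k _|]; first by rewrite r00 mulr_gt0// expR_gt0.
  have M2 : (2 : R) <= M%:R.
    rewrite ler_nat -(ltr_nat R); apply: lt_le_trans ML.
    by rewrite -expR0 ltr_expR mulr_gt0.
  rewrite r00 powR0 ?gt_eqF// mulr0 add0r natrX mul1r -invfM -exprS exprVn.
  by rewrite lef_pV2 ?posrE ?exprn_gt0// lerXn2r ?nnegrE// ltW.
have rgt : 0 < r by rewrite lt_neqAle eq_sym rneq.
have ex : exists j : nat, c * expR (- (j%:R * L)) <= r.
  have q0 : 0 <= `|ln (c / r)| / L by rewrite divr_ge0// ltW.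
  exists (Num.trunc (`|ln (c / r)| / L)).+1.
  have /andP[_ /ltW] := truncn_itv q0; rewrite ler_pdivrMr//.
  set j := _.+1 => h; rewrite expRN ler_pdivrMr ?expR_gt0// mulrC -ler_pdivrMr//.
  rewrite -[leLHS]lnK ?posrE ?divr_gt0// ler_expR; apply: le_trans h.
  exact: ler_norm.
case: (ex_minnP ex) => j hj jmin; exists j => [k kj|].
  by rewrite ltNge; apply/negP => /jmin; rewrite leqNgt kj.
apply: (@le_trans _ _ ((c `^ t)^-1 * r `^ t)); last first.
  by rewrite lerDl divr_ge0.
rewrite -powR_inv1 ?powR_ge0//.
have -> : (c `^ t) `^ (-1) = (c^-1) `^ t.
  by rewrite -powRrM mulrN1 -mulN1r powRrM powR_inv1 ?ltW.
rewrite -powRM ?invr_ge0 ?(ltW c0)//.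
apply: (@le_trans _ _ (expR (- (j%:R * L)) `^ t)); last first.
  apply: ge0_ler_powR; rewrite ?nnegrE ?expR_ge0 ?mulr_ge0 ?invr_ge0 ?(ltW c0) ?(ltW t0)//.
  by rewrite (mulrC c^-1) ler_pdivlMr// mulrC.
rewrite -expRM exprVn -[X in _ <= expR X]opprK expRN lef_pV2 ?posrE ?expR_gt0 ?exprn_gt0//.
have -> : - (- (j%:R * L) * t) = t * L * j%:R by ring.
rewrite expRM powR_mulrn ?expR_ge0// lerXn2r// nnegrE ?expR_ge0// ltW.
Qed.

(* Mass distribution along the M-adic tree, by counting instead of a measure. *)
Lemma cantor_hausdorff (A : set 'rV[R]_m) (M : nat) (pi : (nat -> 'I_M) -> 'rV[R]_m)
    (c L t : R) : 0 < c -> 0 < L -> 0 < t -> expR (t * L) <= M%:R ->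
  (forall x, A (pi x)) ->
  (forall x y j, (forall i, (i < j)%N -> x i = y i) -> x j <> y j ->
     c * expR (- (j%:R * L)) <= enorm (pi x - pi y)) ->
  hausdorff_measure t A <> 0%E.
Proof.
move=> c0 L0 t0 ML piA sep H0.
have M0 : (0 < M)%N.
  by rewrite -(ltr_nat R); apply: lt_le_trans ML; exact: expR_gt0.
have ct0 : 0 < c `^ t by rewrite powR_gt0.
(* A covering with sum below c^t / 4 yields cylinders of total mass at most 1/4 + 1/2, the 1/2 being
   the sum of the error terms; this contradicts [cylinder_cover]. *)
have : (hausdorff_content t 1 A < (c `^ t / 4)%:E)%E.
  apply: (@le_lt_trans _ _ 0%E); last by rewrite lte_fin divr_gt0.
  by rewrite -H0; apply: ereal_sup_ubound; exists 1 => /=.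
move=> /ereal_inf_lt[_ [U [AU U1] <-] Ulim].
have /choice[v vP] i : exists v : seq 'I_M,
    (forall x, U i (pi x) -> v = mkseq x (size v)) /\
    (((M%:R^-1) ^+ size v)%:E <=
      ((c `^ t)^-1)%:E * ediam (U i) `^ t + (1 / 2 / (2 ^ i.+1)%:R)%:E)%E.
  have [r r0 er] : exists2 r : R, 0 <= r & ediam (U i) = r%:E.
    have := U1 i; have := @ediam_ge0 R m (U i); case: (ediam (U i)) => [r| |]//=.
    by rewrite lee_fin => r0 _; exists r.
  have [j hj mj] := cylinder_level i c0 L0 t0 ML r0.
  have bound k : k = j -> (((M%:R^-1) ^+ k)%:E <=
      ((c `^ t)^-1)%:E * ediam (U i) `^ t + (1 / 2 / (2 ^ i.+1)%:R)%:E)%E.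
    by move=> ->; rewrite er poweR_EFin -EFinM -EFinD lee_fin.
  have [[x0 Ux0]|nx] := pselect (exists x, U i (pi x)); last first.
    exists (nseq j (Ordinal M0)); rewrite size_nseq; split; last exact: bound.
    by move=> x Ux; exfalso; apply: nx; exists x.
  exists (mkseq x0 j); rewrite size_mkseq; split; last exact: bound.
  move=> x Ux; apply: contrapT => /first_difference[k [kj xk xlt]].
  have := sep _ _ k xlt xk; rewrite leNgt => /negP; apply.
  apply: le_lt_trans (hj k kj); apply: ediam_ge Ux0 Ux.
  by rewrite er.
have : (1 <= \sum_(0 <= i <oo) ((M%:R^-1 : R) ^+ size (v i))%:E)%E.
  apply: cylinder_cover => // x; have [i _ Ui] := AU _ (piA x).
  by exists i; have [h _] := vP i; exact: h.
rewrite leNgt => /negP; apply.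
apply: (@le_lt_trans _ _ (\sum_(0 <= i <oo) (((c `^ t)^-1)%:E * ediam (U i) `^ t +
    (1 / 2 / (2 ^ i.+1)%:R)%:E))%E).
  apply: lee_nneseries => i *; last by have [] := vP i.
  by rewrite lee_fin exprn_ge0// invr_ge0.
apply: le_lt_trans (epsilon_trick _ _ _) _ => //.
  by move=> i; rewrite mule_ge0 ?poweR_ge0// lee_fin invr_ge0 ltW.
rewrite nneseriesZl; last by move=> i _; exact: poweR_ge0.
apply: (@le_lt_trans _ _ ((1 / 4)%:E + (1 / 2)%:E)%E).
  rewrite leeD2r// muleC lee_pdivrMr//; apply: ltW; apply: lt_le_trans Ulim _.
  by rewrite -EFinM lee_fin mulrC mul1r.
by rewrite -EFinD lte_fin; lra.
Qed.

End cantor_sets.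

(** * Fixed points at infinity *)

Section boundary_fixed_points.
Context {R : realType} {n : nat}.
Implicit Types (x y z : hyp R n) (f g h : hyp R n -> hyp R n).
Implicit Types (xi eta zeta : 'rV[R]_n.+1) (G : set (hyp R n -> hyp R n)).
Local Notation o0 := (@horigin R n).

(** Says that the extension of f to the sphere fixes xi, without constructing the extension. *)
Definition fixes f xi := forall d : R, 0 < d -> exists x,
  enorm (bval x - xi) < d /\ enorm (bval (f x) - xi) < d.

(* The Poisson kernel, that is the exponential of a Busemann function at xi. *)
Definition pk xi x : R := om x / enorm (bval x - xi) ^+ 2.

Lemma enorm_boundary_gt0 xi x : enorm xi = 1 -> 0 < enorm (bval x - xi).
Proof.
move=> xi1; have := enorm_dist (bval x) xi; have := bval_lt1 x; rewrite xi1.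
by rewrite ler_norml => x1 /andP[h _]; lra.
Qed.

Lemma pk_gt0 xi x : enorm xi = 1 -> 0 < pk xi x.
Proof. by move=> xi1; rewrite divr_gt0 ?om_gt0// exprn_gt0// enorm_boundary_gt0. Qed.

Lemma pk_horigin xi : enorm xi = 1 -> pk xi o0 = 1.
Proof. by move=> xi1; rewrite /pk om_horigin sub0r enormN xi1 expr1n divr1. Qed.

Lemma om_le_boundary xi x : enorm xi = 1 -> om x <= 2 * enorm (bval x - xi).
Proof.
move=> xi1; have := enorm_dist (bval x) xi; have := bval_lt1 x; rewrite xi1 omE.
have := enorm_ge0 (bval x).
by rewrite ler_norml => x0 x1 /andP[h _]; nra.
Qed.

Lemma cvg_enorm_sqr (u : nat -> 'rV[R]_n.+1) (v : nat -> 'rV[R]_n.+1) xi eta :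
  (forall k, enorm (u k - xi) < k.+1%:R^-1) ->
  (forall k, enorm (v k - eta) < k.+1%:R^-1) ->
  (enorm (u k - v k) ^+ 2 @[k --> \oo] --> enorm (xi - eta) ^+ 2).
Proof.
move=> uxi veta.
have h : enorm (u k - v k) @[k --> \oo] --> enorm (xi - eta).
  apply/cvgrPdist_lt => e e0.
  have e2 : 0 < e / 2 by rewrite divr_gt0.
  near=> k.
  have hk : k.+1%:R^-1 < e / 2 by near: k; exact: near_infty_natSinv_lt (PosNum e2).
  apply: le_lt_trans (enorm_dist _ _) _.
  have -> : xi - eta - (u k - v k) = - (u k - xi) + (v k - eta).
    by rewrite !opprB addrACA [in RHS]addrACA; congr (_ + _); rewrite addrC.
  apply: le_lt_trans (enormD _ _) _; rewrite enormN.
  by rewrite [ltRHS]splitr; apply: ltrD; apply: lt_trans hk.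
rewrite !expr2; under eq_fun do rewrite expr2.
exact: cvgM.
Unshelve. all: by end_near. Qed.

Lemma fixes_sequence f xi : fixes f xi -> exists y : nat -> hyp R n,
  (forall k, enorm (bval (y k) - xi) < k.+1%:R^-1) /\
  (forall k, enorm (bval (f (y k)) - xi) < k.+1%:R^-1).
Proof.
move=> fxi; have /choice[y yP] (k : nat) := fxi k.+1%:R^-1 ltac:(by rewrite invr_gt0).
by exists y; split=> k; have [] := yP k.
Qed.

(** Divide the distortion formulas for (x, y) and (0, y), so that om y and om (f y) cancel, and let
    y and f y tend to xi. *)
Lemma pk_cocycle f xi x : isometric f -> enorm xi = 1 -> fixes f xi ->
  pk xi (f x) = pk xi (f o0) * pk xi x.
Proof.
move=> fi xi1 /fixes_sequence[y [yxi fyxi]].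
have cst z (k : nat) : enorm (bval z - bval z) < k.+1%:R^-1.
  by rewrite subrr enorm0 invr_gt0.
pose A k := enorm (bval (f x) - bval (f (y k))) ^+ 2 *
  enorm (bval o0 - bval (y k)) ^+ 2 * (om x * om (f o0)).
pose B k := enorm (bval x - bval (y k)) ^+ 2 *
  enorm (bval (f o0) - bval (f (y k))) ^+ 2 * (om (f x) * om o0).
have AB : A = B.
  apply/funext => k; have e1 := isometric_enorm x (y k) fi.
  have e2 := isometric_enorm o0 (y k) fi.
  have h : om (y k) * om (f (y k)) != 0 by rewrite mulf_neq0 ?om_neq0.
  apply: (mulIf h); rewrite /A /B.
  transitivity ((enorm (bval (f x) - bval (f (y k))) ^+ 2 * om x * om (y k)) *
    (enorm (bval o0 - bval (y k)) ^+ 2 * om (f o0) * om (f (y k)))); first by ring.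
  by rewrite e1 -e2; ring.
have lA : A k @[k --> \oo] --> enorm (bval (f x) - xi) ^+ 2 *
    enorm (bval o0 - xi) ^+ 2 * (om x * om (f o0)).
  apply: cvgMl; apply: cvgM.
    exact: (cvg_enorm_sqr (cst (f x)) fyxi).
  exact: (cvg_enorm_sqr (cst o0) yxi).
have lB : B k @[k --> \oo] --> enorm (bval x - xi) ^+ 2 *
    enorm (bval (f o0) - xi) ^+ 2 * (om (f x) * om o0).
  apply: cvgMl; apply: cvgM.
    exact: (cvg_enorm_sqr (cst x) yxi).
  exact: (cvg_enorm_sqr (cst (f o0)) fyxi).
rewrite AB in lA; have /(_ _) := cvg_unique (@Rhausdorff R) lA lB.
rewrite /pk om_horigin horiginE sub0r enormN xi1.
have := enorm_boundary_gt0 x xi1; have := enorm_boundary_gt0 (f x) xi1.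
have := enorm_boundary_gt0 (f o0) xi1.
move: (enorm _) (enorm _) (enorm _) => a b c a0 b0 c0 e.
have {}e : b ^+ 2 * (om x * om (f o0)) = a ^+ 2 * c ^+ 2 * om (f x).
  by move: e; rewrite expr1n !mulr1.
have ha : a ^+ 2 != 0 by rewrite expf_neq0// gt_eqF.
have hb : b ^+ 2 != 0 by rewrite expf_neq0// gt_eqF.
have hc : c ^+ 2 != 0 by rewrite expf_neq0// gt_eqF.
apply: (mulIf hb); apply: (mulIf ha); apply: (mulIf hc).
transitivity (a ^+ 2 * c ^+ 2 * om (f x)); first by field; rewrite gt_eqF.
by rewrite -e; field; rewrite !gt_eqF.
Qed.

Lemma two_fixed_algebra (P Q a b c d ox oy ofx ofy cx ce : R) :
  a != 0 -> b != 0 -> c != 0 -> d != 0 -> ox != 0 -> oy != 0 ->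
  P ^+ 2 * ox * oy = Q ^+ 2 * ofx * ofy ->
  ofx / b ^+ 2 = ce * (ox / d ^+ 2) -> ofy / a ^+ 2 = cx * (oy / c ^+ 2) ->
  P ^+ 2 * d ^+ 2 * c ^+ 2 = Q ^+ 2 * b ^+ 2 * a ^+ 2 * (cx * ce).
Proof.
move=> a0 b0 c0 d0 ox0 oy0 e1 e2 e3.
have b2 : b ^+ 2 != 0 by rewrite expf_neq0.
have a2 : a ^+ 2 != 0 by rewrite expf_neq0.
have h2 : ofx = ce * (ox / d ^+ 2) * b ^+ 2 by rewrite -e2 divfK.
have h3 : ofy = cx * (oy / c ^+ 2) * a ^+ 2 by rewrite -e3 divfK.
apply: (mulIf ox0); apply: (mulIf oy0).
transitivity (P ^+ 2 * ox * oy * (d ^+ 2 * c ^+ 2)); first by ring.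
by rewrite e1 h2 h3; field; rewrite c0 d0.
Qed.

(** Apply the distortion formula to x_k -> xi and y_k -> eta, eliminating om (f x_k) by the kernel
    at eta and om (f y_k) by the kernel at xi: every remaining distance has a positive limit. *)
Lemma pk_two_fixed f xi eta : isometric f -> enorm xi = 1 -> enorm eta = 1 ->
  xi <> eta -> fixes f xi -> fixes f eta -> pk xi (f o0) * pk eta (f o0) = 1.
Proof.
move=> fi xi1 eta1 xe fxi feta.
have [x [xxi fxxi]] := fixes_sequence fxi.
have [y [yeta fyeta]] := fixes_sequence feta.
have cxi (k : nat) : enorm (xi - xi) < k.+1%:R^-1 :> R.
  by rewrite subrr enorm0 invr_gt0.
have ceta (k : nat) : enorm (eta - eta) < k.+1%:R^-1 :> R.
  by rewrite subrr enorm0 invr_gt0.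
set cx := pk xi (f o0); set ce := pk eta (f o0).
pose A k := enorm (bval (f (x k)) - bval (f (y k))) ^+ 2 *
  enorm (bval (x k) - eta) ^+ 2 * enorm (bval (y k) - xi) ^+ 2.
pose B k := enorm (bval (x k) - bval (y k)) ^+ 2 *
  enorm (bval (f (x k)) - eta) ^+ 2 * enorm (bval (f (y k)) - xi) ^+ 2 * (cx * ce).
have AB : A = B.
  apply/funext => k; have e1 := isometric_enorm (x k) (y k) fi.
  have := pk_cocycle (y k) fi xi1 fxi; have := pk_cocycle (x k) fi eta1 feta.
  rewrite -/cx -/ce /pk /A /B.
  move=> e2 e3; apply: (two_fixed_algebra _ _ _ _ _ _ e1 e2 e3);
    by rewrite gt_eqF ?om_gt0 ?enorm_boundary_gt0.
have lA : A k @[k --> \oo] --> enorm (xi - eta) ^+ 2 *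
    enorm (xi - eta) ^+ 2 * enorm (eta - xi) ^+ 2.
  apply: cvgM; [apply: cvgM|]; [exact: (cvg_enorm_sqr fxxi fyeta)| |].
    exact: (cvg_enorm_sqr xxi ceta).
  exact: (cvg_enorm_sqr yeta cxi).
have lB : B k @[k --> \oo] --> enorm (xi - eta) ^+ 2 *
    enorm (xi - eta) ^+ 2 * enorm (eta - xi) ^+ 2 * (cx * ce).
  apply: cvgMl; apply: cvgM; [apply: cvgM|]; [exact: (cvg_enorm_sqr xxi yeta)| |].
    exact: (cvg_enorm_sqr fxxi ceta).
  exact: (cvg_enorm_sqr fyeta cxi).
rewrite AB in lA; have /(_ _) := cvg_unique (@Rhausdorff R) lA lB; rewrite (enormB eta).
have h : enorm (xi - eta) != 0.
  by apply/eqP => /enorm_eq0/eqP; rewrite subr_eq0 => /eqP.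
have hh : enorm (xi - eta) ^+ 2 * enorm (xi - eta) ^+ 2 * enorm (xi - eta) ^+ 2 != 0.
  by rewrite !mulf_neq0// expf_neq0.
by rewrite -[LHS]mulr1 => /(mulfI hh).
Qed.

Lemma limit_setP G z zeta (d : R) : limit_set G z zeta -> 0 < d ->
  enorm zeta = 1 /\ exists2 g, G g & enorm (bval (g z) - zeta) < d.
Proof.
move=> [z1 zlim] d0; split=> //.
have [y [_ [_ [g Gg <-] <-] yd]] := zlim _ (near_enorm zeta d0).
by exists g.
Qed.

(** At orbit points near a third limit point, om tends to 0 while the distances to xi and eta stay
    bounded below, so both kernels tend to 0. *)
Lemma limit_set_two_points G z xi eta (c : R) : enorm xi = 1 -> enorm eta = 1 -> 0 < c ->
  (forall g, G g -> c <= pk xi (g z) * pk eta (g z)) ->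
  limit_set G z `<=` [set xi; eta].
Proof.
move=> xi1 eta1 c0 Gc zeta zlim; apply: contrapT => /not_orP[zxi zeta'].
have pos (a : 'rV[R]_n.+1) : zeta <> a -> 0 < enorm (zeta - a).
  move=> za; rewrite lt_neqAle enorm_ge0 andbT eq_sym; apply/eqP => /enorm_eq0/eqP.
  by rewrite subr_eq0 => /eqP.
pose a := Num.min (enorm (zeta - xi)) (enorm (zeta - eta)).
have a0 : 0 < a by rewrite lt_min !pos.
(* Each kernel times a^2 is at most 8 q, so c a^4 <= 64 q^2 <= 64 q, against 65 q <= c a^4. *)
pose q := Num.min (a / 2) (Num.min 1 (c * a ^+ 4 / 65)).
have ca : 0 < c * a ^+ 4 / 65 by rewrite divr_gt0// mulr_gt0// exprn_gt0.
have q0 : 0 < q by rewrite !lt_min ca ltr01 divr_gt0.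
have [z1 [g Gg gz]] := limit_setP zlim q0.
have qa : q <= a / 2 by rewrite ge_min lexx.
have q1 : q <= 1 by rewrite !ge_min lexx !orbT.
have qc : q <= c * a ^+ 4 / 65 by rewrite !ge_min lexx !orbT.
have og : om (g z) <= 2 * q.
  by apply: le_trans (om_le_boundary _ z1) _; lra.
have og0 := om_gt0 (g z).
have bound b : enorm b = 1 -> a <= enorm (zeta - b) -> pk b (g z) * a ^+ 2 <= 8 * q.
  move=> b1 ab; have h : a / 2 <= enorm (bval (g z) - b).
    have := enorm_triangle zeta (bval (g z)) b.
    by rewrite (enormB zeta (bval _)); lra.
  rewrite /pk mulrAC ler_pdivrMr ?exprn_gt0 ?enorm_boundary_gt0//.
  have : (a / 2) ^+ 2 <= enorm (bval (g z) - b) ^+ 2.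
    by rewrite lerXn2r ?nnegrE ?enorm_ge0// divr_ge0// ltW.
  nra.
have h1 := bound xi xi1 ltac:(by rewrite ge_min lexx).
have h2 := bound eta eta1 ltac:(by rewrite ge_min lexx orbT).
have p1 := pk_gt0 (g z) xi1; have p2 := pk_gt0 (g z) eta1.
have a20 : 0 < a ^+ 2 by rewrite exprn_gt0.
have := Gc g Gg; move: p1 p2 h1 h2.
move: (pk xi _) (pk eta _) => P Q P0 Q0 h1 h2 h3.
have : (P * a ^+ 2) * (Q * a ^+ 2) <= (8 * q) * (8 * q).
  by apply: ler_pM => //; rewrite mulr_ge0// ltW.
have -> : P * a ^+ 2 * (Q * a ^+ 2) = P * Q * a ^+ 4 by ring.
have : c * a ^+ 4 <= P * Q * a ^+ 4 by rewrite ler_pM2r// exprn_gt0.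
nra.
Qed.

End boundary_fixed_points.

Section compactness.
Context {R : realType} {m : nat}.

Lemma ball_cluster {T : Type} (F : set_system T) (u : T -> 'rV[R]_m) :
  ProperFilter F -> (forall t, enorm (u t) <= 1) ->
  exists eta, forall (e : R) (A : set T), 0 < e -> F A ->
    exists2 t, A t & enorm (u t - eta) < e.
Proof.
move=> FF u1; pose K := [set v : 'rV[R]_m | enorm v <= 1].
have cK : compact K.
  apply: bounded_closed_compact.
    exists 1; split=> [|M M1 x /= x1]; first exact: num_real.
    by apply: le_trans (norm_le_enorm _) _; apply: le_trans x1 (ltW M1).
  move=> x clx; rewrite /K/= leNgt; apply/negP => x1.
  have e0 : 0 < enorm x - 1 by lra.
  have [y [/= y1 yx]] := clx _ (near_enorm x e0); rewrite /K/= in y1.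
  have := enorm_dist x y; rewrite (enormB x) ler_norml => /andP[_ h]; lra.
have uK : (u @ F) K by apply: nearW => t; exact: u1.
have [eta [_ etacl]] := cK _ _ uK; exists eta => e A e0 FA.
have uA : F (u @^-1` (u @` A)) by apply: filterS FA => t At; exists t.
have [_ [[t At <-] ht]] := etacl _ _ uA (near_enorm eta e0).
by exists t.
Qed.

Lemma finite_set_repeats {T : eqType} (A : set T) (u : nat -> T) : finite_set A ->
  (forall k, A (u k)) -> exists i j, (i < j)%N /\ u i = u j.
Proof.
move=> /finite_seqP[s ->] us.
have /(uniqPn (u 0%N))[i [j [ij]]] : ~~ uniq (mkseq u (size s).+1).
  apply/negP => /uniq_leq_size h.
  have := h s; rewrite size_mkseq ltnn => /(_ _)/negP; apply=> //.
  by move=> x /mapP[k _ ->]; exact: us.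
rewrite size_mkseq => js; rewrite !nth_mkseq// => [e|]; last exact: ltn_trans js.
by exists i, j.
Qed.

End compactness.

Section global_fixed_points.
Context {R : realType} {n : nat}.
Implicit Types (x y z : hyp R n) (f g h : hyp R n -> hyp R n).
Implicit Types (xi eta zeta : 'rV[R]_n.+1) (G : set (hyp R n -> hyp R n)).
Local Notation o0 := (@horigin R n).

Lemma kleinian_iter G g k : kleinian G -> G g -> G (iter k g).
Proof.
move=> kG Gg; elim: k => [|k IH]; first by case: kG => -[].
exact: (kleinian_comp kG Gg IH).
Qed.

Lemma iter_cancel {T : Type} (f g : T -> T) k : cancel f g -> cancel (iter k f) (iter k g).
Proof. by move=> fg; elim: k => [//|k IH] x; rewrite [in iter k.+1 g _]iterSr /= fg IH. Qed.

(** The triangle inequality after inversion at xi: |x - y| / (|x - xi| |y - xi|) is the distance of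
    the inverted points. [hq] and [pk] appear because isometries fixing xi act on them by simple
    rules. *)
Lemma inv_dist_boundary xi x y : enorm xi = 1 ->
  (enorm (bval y - xi))^-1 <= (enorm (bval x - xi))^-1 +
    Num.sqrt (hq x y * (pk xi x * pk xi y)).
Proof.
move=> xi1; have a0 := enorm_boundary_gt0 x xi1; have b0 := enorm_boundary_gt0 y xi1.
have -> : hq x y * (pk xi x * pk xi y) = (enorm (bval x - bval y) *
    ((enorm (bval x - xi))^-1 * (enorm (bval y - xi))^-1)) ^+ 2.
  rewrite exprMn enorm_hq /pk; move: (hq x y) (om x) (om y) => q u v.
  by field; rewrite !gt_eqF.
rewrite sqrtr_sqr ger0_norm; last first.
  by rewrite mulr_ge0 ?enorm_ge0// mulr_ge0// invr_ge0 ltW.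
have h := enorm_triangle (bval x) (bval y) xi.
rewrite -(ler_pM2r a0) -(ler_pM2r b0).
have -> : (enorm (bval y - xi))^-1 * enorm (bval x - xi) * enorm (bval y - xi) =
  enorm (bval x - xi) by field; rewrite gt_eqF.
have -> : ((enorm (bval x - xi))^-1 + enorm (bval x - bval y) *
   ((enorm (bval x - xi))^-1 * (enorm (bval y - xi))^-1)) *
   enorm (bval x - xi) * enorm (bval y - xi) =
   enorm (bval y - xi) + enorm (bval x - bval y) by field; rewrite !gt_eqF.
lra.
Qed.

(* Points in a cone at xi are moved a bounded distance by an isometry fixing xi. *)
Lemma cone_displacement xi h (M : R) x : isometric h -> enorm xi = 1 -> fixes h xi ->
  (enorm (bval x - xi))^-1 <= M * pk xi x ->
  hq (h x) x <= 2 * M ^+ 2 * ((pk xi (h o0))^-1 + expR (hdist o0 (h o0))).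
Proof.
move=> hi xi1 hxi hM.
have a0 := enorm_boundary_gt0 x xi1; have b0 := enorm_boundary_gt0 (h x) xi1.
have p0 := pk_gt0 x xi1; have c0 := pk_gt0 (h o0) xi1.
have u0 := om_gt0 x; have v0 := om_gt0 (h x).
have uv := isometric_om x hi.
have e1 := pk_cocycle x hi xi1 hxi.
have t : enorm (bval (h x) - bval x) ^+ 2 <=
    2 * enorm (bval (h x) - xi) ^+ 2 + 2 * enorm (bval x - xi) ^+ 2.
  have := enorm_triangle (bval (h x)) xi (bval x).
  rewrite (enormB xi (bval x)); have := enorm_ge0 (bval (h x) - bval x).
  have := sqr_ge0 (enorm (bval (h x) - xi) - enorm (bval x - xi)).
  move: (enorm (bval (h x) - bval x)) (enorm (bval (h x) - xi)) b0 => c b b0.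
  by move: (enorm (bval x - xi)) a0 => a a0 *; nra.
have ea : enorm (bval x - xi) ^+ 2 = om x / pk xi x.
  by rewrite /pk; field; rewrite !gt_eqF.
have eb : enorm (bval (h x) - xi) ^+ 2 = om (h x) / (pk xi (h o0) * pk xi x).
  by rewrite -e1 /pk; field; rewrite !gt_eqF.
have hM2 : 1 <= M ^+ 2 * (pk xi x * om x).
  have M0 : 0 <= M * pk xi x by apply: le_trans hM; rewrite invr_ge0 ltW.
  have : ((enorm (bval x - xi))^-1) ^+ 2 <= (M * pk xi x) ^+ 2.
    by rewrite lerXn2r ?nnegrE ?invr_ge0 ?(ltW a0).
  rewrite exprVn ea invf_div exprMn ler_pdivrMr// => h1.
  rewrite -(ler_pM2r p0) mul1r; apply: le_trans h1 _.
  by rewrite le_eqVlt; apply/orP; left; apply/eqP; ring.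
rewrite /hq ler_pdivrMr ?mulr_gt0//; apply: le_trans t _; rewrite ea eb.
move: e1 => _; move: (expR_gt0 (hdist o0 (h o0))) uv hM2 p0 c0 u0 v0.
move: (pk xi x) (pk xi (h o0)) (om x) (om (h x)) (expR _) (M ^+ 2).
move=> p c u v E N E0 uv hN p0 c0 u0 v0.
have -> : 2 * N * (c^-1 + E) * (v * u) =
   2 * (v / (c * p)) * (N * (p * u)) + 2 * (N * (p * u)) * (E * v) / p.
  by field; rewrite !gt_eqF.
apply: lerD.
  by rewrite ler_peMr// mulr_ge0// divr_ge0 ?ltW// mulr_gt0.
rewrite mulrA ler_pM2r ?invr_gt0// -mulrA ler_pM2l//.
by apply: le_trans uv _; rewrite ler_peMl// mulr_ge0// ltW.
Qed.

Lemma bernoulli_expr (a : R) k : 1 <= a -> 1 + k%:R * (a - 1) <= a ^+ k.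
Proof.
move=> a1; elim: k => [|k IH]; first by rewrite mul0r addr0 expr0.
rewrite exprS -natr1; have : 0 <= k%:R * (a - 1) by rewrite mulr_ge0// subr_ge0.
nra.
Qed.

End global_fixed_points.

(** * Absence of a global fixed point *)

Section no_global_fixed_point.
Context {R : realType} {n : nat} (G : set (hyp R n -> hyp R n)) (xi : 'rV[R]_n.+1).
Hypotheses (kG : kleinian G) (xi1 : enorm xi = 1).
Implicit Types (x y z : hyp R n) (f g h : hyp R n -> hyp R n) (eta : 'rV[R]_n.+1).
Local Notation o0 := (@horigin R n).

(** The points X k = g^k 0 approach xi inside a cone, and Y k = g^-k 0 stay away from xi. For h in
    G, [cone_displacement] bounds how far g^-k h g^k moves 0, so by discreteness two of these
    conjugates agree and h commutes with g^-m for some m > 0. Then d(Y k, h (Y k)) is periodic in k,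
    and h fixes every cluster point of Y. *)
Lemma second_fixed_point g : G g -> 1 < pk xi (g o0) ->
  (forall h, G h -> fixes h xi) ->
  exists eta, [/\ enorm eta = 1, xi <> eta & forall h, G h -> fixes h eta].
Proof.
move=> Gg chi1 Gxi; set chi := pk xi (g o0) in chi1.
have [g' [Gg' gK g'K]] := kleinian_inv kG Gg.
have gi := kleinian_isometric kG Gg; have g'i := kleinian_isometric kG Gg'.
have chi0 : 0 < chi by lra.
have pkg x : pk xi (g x) = chi * pk xi x by apply: pk_cocycle => //; exact: Gxi.
pose X k := iter k g o0; pose Y k := iter k g' o0.
have YS k : g (Y k.+1) = Y k by rewrite /Y iterS g'K.
have pkX k : pk xi (X k) = chi ^+ k.
  by elim: k => [|k IH]; rewrite ?pk_horigin// /X iterS pkg IH exprS.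
have pkY k : pk xi (Y k) = (chi ^+ k)^-1.
  elim: k => [|k IH]; first by rewrite expr0 invr1 pk_horigin.
  apply: (mulfI (lt0r_neq0 chi0)); rewrite -pkg YS IH exprS invfM mulrA.
  by rewrite mulfV ?mul1r// gt_eqF.
pose s := Num.sqrt (hq o0 (g o0) * chi).
have s0 : 0 <= s by exact: sqrtr_ge0.
have stepE x : hq x (g x) = hq o0 (g o0) ->
    Num.sqrt (hq x (g x) * (pk xi x * pk xi (g x))) = s * pk xi x.
  move=> ->; rewrite pkg (_ : _ * _ = hq o0 (g o0) * chi * pk xi x ^+ 2); last by ring.
  have q0 : 0 <= hq o0 (g o0) * chi by rewrite mulr_ge0 ?hq_ge0// ltW.
  rewrite (sqrtrM _ q0).
  by rewrite sqrtr_sqr gtr0_norm// pk_gt0.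
have hqX k : hq (X k) (g (X k)) = hq o0 (g o0).
  elim: k => [//|k IH]; rewrite -IH; exact: (isometric_hq (X k) (g (X k)) gi).
have hqY k : hq (Y k.+1) (g (Y k.+1)) = hq o0 (g o0).
  elim: k => [|k IH].
    by rewrite YS -(isometric_hq (Y 1) (Y 0) gi) YS.
  by rewrite -IH !YS -(isometric_hq (Y k.+2) (Y k.+1) gi) !YS.
have inv0 : (enorm (bval o0 - xi))^-1 = 1 by rewrite sub0r enormN xi1 invr1.
(* After inversion at xi, the steps of both orbits have length s times the kernel, in geometric
   progression; s = B (chi - 1) makes the two inductions below close. *)
pose B := s / (chi - 1); pose M := 1 + B.
have B0 : 0 <= B by rewrite divr_ge0//; lra.
have sB : s = B * (chi - 1) by rewrite /B divfK//; apply/eqP; lra.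
have coneX k : (enorm (bval (X k) - xi))^-1 <= M * pk xi (X k).
  elim: k => [|k IH]; first by rewrite inv0 pk_horigin// /M; lra.
  have := inv_dist_boundary (X k) (g (X k)) xi1; rewrite stepE// => h.
  apply: le_trans h _; rewrite pkg sB; have := pk_gt0 (X k) xi1.
  by move: IH; rewrite /M; nra.
have farY k : (enorm (bval (Y k) - xi))^-1 + B * pk xi (Y k) <= M.
  elim: k => [|k IH]; first by rewrite inv0 pk_horigin// /M; lra.
  apply: le_trans IH; have := inv_dist_boundary (g (Y k.+1)) (Y k.+1) xi1.
  rewrite hqC (mulrC (pk xi _)) stepE// YS => h.
  have := pkg (Y k.+1); rewrite YS => ->; rewrite sB in h.
  by move: h; have := pk_gt0 (Y k.+1) xi1; lra.
have M0 : 0 < M by rewrite /M; lra.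
have distY k : M^-1 <= enorm (bval (Y k) - xi).
  rewrite -(invrK (enorm _)) lef_pV2 ?posrE ?invr_gt0 ?enorm_boundary_gt0//.
  by have := farY k; have := mulr_ge0 B0 (ltW (pk_gt0 (Y k) xi1)); lra.
have omY (e : R) : 0 < e -> exists K : nat, forall k, (K <= k)%N -> om (Y k) < e.
  move=> e0; have q0 : 0 <= 4 / e / (chi - 1) by rewrite !divr_ge0//; lra.
  exists (Num.trunc (4 / e / (chi - 1))).+1 => k kK.
  have hk : 4 / e < chi ^+ k.
    apply: lt_le_trans (bernoulli_expr k (ltW chi1)).
    have /andP[_ t] := truncn_itv q0; rewrite ltr_pdivrMr in t; last by lra.
    have : (Num.trunc (4 / e / (chi - 1))).+1%:R * (chi - 1) <= k%:R * (chi - 1).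
      by rewrite ler_wpM2r ?ler_nat//; lra.
    lra.
  have omE' : om (Y k) = (chi ^+ k)^-1 * enorm (bval (Y k) - xi) ^+ 2.
    by rewrite -pkY /pk divfK// expf_neq0// gt_eqF// enorm_boundary_gt0.
  have d2 : enorm (bval (Y k) - xi) <= 2.
    have := enormD (bval (Y k)) (- xi); rewrite enormN xi1.
    by have := bval_lt1 (Y k); lra.
  rewrite omE' mulrC ltr_pdivrMr ?exprn_gt0//.
  rewrite ltr_pdivrMr// mulrC in hk.
  by apply: le_lt_trans hk; have := enorm_ge0 (bval (Y k) - xi); nra.
have bddY h : G h -> exists D : R, forall k, hdist (Y k) (h (Y k)) <= D.
  move=> Gh; have hi := kleinian_isometric kG Gh.
  pose C := arcosh (1 + 2 * (2 * M ^+ 2 * ((pk xi (h o0))^-1 + expR (hdist o0 (h o0))))).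
  pose u k := iter k g' \o h \o iter k g.
  have uA k : [set f | G f /\ hdist o0 (f o0) <= C] (u k).
    split.
      apply: (kleinian_comp kG); last exact: kleinian_iter.
      by apply: (kleinian_comp kG) => //; exact: kleinian_iter.
    rewrite -(kleinian_isometric kG (kleinian_iter k kG Gg)) /u /=.
    rewrite (iter_cancel k g'K) hdistC; apply: hdist_le_hq.
    exact: (cone_displacement hi xi1 (Gxi h Gh) (coneX k)).
  have [i [j [ij uij]]] := finite_set_repeats (kleinian_finite C kG) uA.
  pose m := (j - i)%N.
  have m0 : (0 < m)%N by rewrite subn_gt0.
  have comm x : h (iter m g' x) = iter m g' (h x).
    pose p := iter i g' (iter m g' x).
    have jE : j = (i + m)%N by rewrite subnKC// ltnW.
    have e1 : iter i g (u i p) = h (iter m g' x).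
      by rewrite /u /p /= !(iter_cancel i g'K).
    have e2 : iter i g (u j p) = iter m g' (h x).
      rewrite jE /u /p /= (iterD i m g') (iter_cancel i g'K).
      by rewrite addnC (iterD m i g) (iter_cancel i g'K) (iter_cancel m g'K).
    by rewrite -e1 -e2 uij.
  pose w k := hdist (Y k) (h (Y k)).
  have wm k : w (k + m)%N = w k.
    rewrite /w /Y addnC iterD comm.
    exact: (kleinian_isometric kG (kleinian_iter m kG Gg')).
  exists (\big[Num.max/0]_(i < m) w i) => k; rewrite -/(w k).
  elim/ltn_ind: k => k IH; have [km|mk] := ltnP k m.
    exact: (le_bigmax _ (fun i : 'I_m => w i) (Ordinal km)).
  rewrite -(subnK mk) wm; apply: IH.
  by rewrite ltn_subLR// -{1}(add0n k) ltn_add2r.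
have [eta etacl] := @ball_cluster _ _ _ \oo (fun k => bval (Y k)) _
  (fun k => ltW (bval_lt1 (Y k))).
have near (e : R) (K : nat) : 0 < e -> exists2 k, (K <= k)%N & enorm (bval (Y k) - eta) < e.
  by move=> e0; apply: etacl => //; exact: nbhs_infty_ge.
exists eta; split.
- apply/eqP; rewrite eq_le; apply/andP; split; apply/ler_addgt0Pr => e e0.
    have [k _ h] := near e 0%N e0; have := enorm_dist eta (bval (Y k)).
    rewrite (enormB eta) ler_norml => /andP[_].
    by have := bval_lt1 (Y k); lra.
  have e2 : 0 < e / 2 by rewrite divr_gt0.
  have [K KP] := omY _ e2; have [k kK h] := near _ K e2.
  have := enorm_dist (bval (Y k)) eta; rewrite ler_norml => /andP[_].
  have := KP k kK; rewrite omE; have := bval_lt1 (Y k); have := enorm_ge0 (bval (Y k)).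
  by nra.
- move=> xe; have Mi : 0 < M^-1 by rewrite invr_gt0.
  have [k _ h] := near _ 0%N Mi; have := distY k.
  by rewrite xe leNgt h.
- move=> h Gh d d0; have [D hD] := bddY h Gh.
  have d2 : 0 < d / 2 by rewrite divr_gt0.
  have [K KP] := omY (d / 2 / expR D) ltac:(by rewrite divr_gt0// expR_gt0).
  have [k kK hk] := near _ K d2; exists (Y k); split; first by lra.
  have [h1 _] := enorm_le_hdist (hD k).
  have h2 : expR D * om (Y k) < d / 2.
    by rewrite mulrC -ltr_pdivlMr ?expR_gt0//; exact: KP.
  have := enorm_triangle (bval (h (Y k))) (bval (Y k)) eta.
  by rewrite (enormB (bval (h _)) (bval (Y k))); lra.
Qed.

Lemma no_global_fixed_point z : non_elementary G z ->
  exists2 f, G f & ~ fixes f xi.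
Proof.
move=> ne; apply: contrapT => nf.
have {nf} Gxi h : G h -> fixes h xi.
  by move=> Gh; apply: contrapT => nfix; apply: nf; exists h.
have pkE f x : G f -> pk xi (f x) = pk xi (f o0) * pk xi x.
  by move=> Gf; apply: pk_cocycle (kleinian_isometric kG Gf) xi1 (Gxi f Gf).
apply: ne.
suff [eta [c [eta1 c0 hc]]] : exists eta (c : R), [/\ enorm eta = 1, 0 < c &
    forall g, G g -> c <= pk xi (g z) * pk eta (g z)].
  apply: (@card_le_sub_image _ _ (fun i => if i == 0%N then xi else eta)).
  move=> v /(limit_set_two_points xi1 eta1 c0 hc)[->|->]; first by exists 0%N.
  by exists 1%N.
have [triv|/existsNP[g /not_implyP[Gg chig]]] :=
    pselect (forall g, G g -> pk xi (g o0) = 1).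
  (* One fixed point is enough when the kernel is constant on the orbit: eta is taken to be xi. *)
  exists xi, (pk xi z * pk xi z); split=> //; first by rewrite mulr_gt0 ?pk_gt0.
  by move=> g Gg; rewrite pkE// triv// mul1r.
have {g Gg chig} [g Gg chi1] : exists2 g, G g & 1 < pk xi (g o0).
  have [g' [Gg' gK g'K]] := kleinian_inv kG Gg.
  have e : pk xi (g' o0) * pk xi (g o0) = 1 by rewrite -pkE// gK pk_horigin.
  have p0 := pk_gt0 (g o0) xi1; have p0' := pk_gt0 (g' o0) xi1.
  have [h|h] := ltP 1 (pk xi (g o0)); first by exists g.
  exists g' => //; have : pk xi (g o0) != 1 by apply/eqP.
  by move: h; rewrite le_eqVlt => /predU1P[->|h _]; [rewrite eqxx|nra].
have [eta [eta1 xe Geta]] := second_fixed_point Gg chi1 Gxi.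
exists eta, (pk xi z * pk eta z); split=> //; first by rewrite mulr_gt0 ?pk_gt0.
move=> h Gh; have hi := kleinian_isometric kG Gh.
rewrite pkE// (pk_cocycle z hi eta1 (Geta h Gh)).
have := pk_two_fixed hi xi1 eta1 xe (Gxi h Gh) (Geta h Gh).
have -> : pk xi (h o0) * pk xi z * (pk eta (h o0) * pk eta z) =
  pk xi (h o0) * pk eta (h o0) * (pk xi z * pk eta z) by ring.
by move=> ->; rewrite mul1r.
Qed.

End no_global_fixed_point.

(** * Orbit growth *)

Section orbit_growth.
Context {R : realType} {n : nat} (G : set (hyp R n -> hyp R n)).
Hypothesis kG : kleinian G.
Implicit Types (x y z : hyp R n) (g h : hyp R n -> hyp R n) (s t r : R).
Implicit Types (T : set (hyp R n -> hyp R n)) (l : seq (hyp R n -> hyp R n)).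
Local Notation o0 := (@horigin R n).

Definition annulus (k : nat) : set (hyp R n -> hyp R n) :=
  [set g | G g /\ k%:R <= hdist o0 (g o0) < k.+1%:R].

(** Growth at most of order exp(t k), counted by duplicate-free lists. Sparse sets form an ideal
    which, for t >= 0, contains by discreteness the sets of elements of bounded displacement. *)
Definition sparse t T := exists C : R, forall (k : nat) l, uniq l ->
  (forall g, g \in l -> T g /\ annulus k g) -> (size l)%:R <= C * expR (t * k%:R).

Lemma sparseS t T T' : T `<=` T' -> sparse t T' -> sparse t T.
Proof.
move=> TT [C hC]; exists C => k l lu lT; apply: hC => // g /lT[Tg Ag].
by split=> //; exact: TT.
Qed.

Lemma sparse0 t : sparse t set0.
Proof.
exists 0 => k [|g l] _ lT; first by rewrite mul0r.
by have [] := lT g (mem_head _ _).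
Qed.

Lemma sparseU t T T' : sparse t T -> sparse t T' -> sparse t (T `|` T').
Proof.
move=> [C hC] [C' hC']; exists (C + C') => k l lu lT.
rewrite mulrDl -(count_predC [pred g | `[< T g >]] l) -!size_filter natrD lerD//.
  apply: hC => [|g]; first exact: filter_uniq.
  by rewrite mem_filter => /andP[/= /asboolP Tg gl]; have [_] := lT g gl.
apply: hC' => [|g]; first exact: filter_uniq.
by rewrite mem_filter => /andP[/= /asboolPn nTg gl]; have [[]] := lT g gl.
Qed.

Lemma sparse_bounded t T r : 0 <= t ->
  (forall g, G g -> T g -> hdist o0 (g o0) <= r) -> sparse t T.
Proof.
move=> t0 Tr; have [N hN] := kleinian_count r kG; exists N%:R => k l lu lT.
apply: (@le_trans _ _ N%:R).
  rewrite ler_nat; apply: hN => // g /lT[Tg [Gg _]].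
  by split=> //; exact: Tr.
by rewrite ler_peMr// -expR0 ler_expR mulr_ge0.
Qed.

Lemma inverse_point : exists p : (hyp R n -> hyp R n) -> hyp R n,
  forall g, G g -> g (p g) = o0.
Proof.
have /choice[p pP] g : exists x, G g -> g x = o0.
  have [Gg|nG] := pselect (G g); last by exists o0.
  by have [h [_ _ hg]] := kleinian_inv kG Gg; exists (h o0).
by exists p.
Qed.

Lemma hdist_interior x (xi : 'rV[R]_n.+1) : enorm xi < 1 ->
  enorm (bval x - xi) < (1 - enorm xi) / 2 ->
  hdist o0 x <= ln (8 / (1 - enorm xi)).
Proof.
move=> xi1 h; have := enorm_dist (bval x) xi; rewrite ler_norml => /andP[_ h1].
have ox : (1 - enorm xi) / 2 <= om x.
  by rewrite omE; have := enorm_ge0 (bval x); nra.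
have q0 : 0 < 1 - enorm xi by lra.
rewrite -[leLHS]expRK ler_ln ?posrE ?expR_gt0 ?divr_gt0// ler_pdivlMr//.
have := le_trans ox (om_le x); rewrite expRN ler_pdivlMr ?expR_gt0//; lra.
Qed.

(* The complements of sparse sets form a filter, whose image in the compact square
   of the closed ball has a cluster point. *)
Lemma heavy_pair t (p : (hyp R n -> hyp R n) -> hyp R n) : 0 <= t ->
  (forall g, G g -> g (p g) = o0) -> ~ sparse t setT ->
  exists xi eta, [/\ enorm xi = 1, enorm eta = 1 & forall r, 0 < r ->
    ~ sparse t [set g | enorm (bval (g o0) - xi) < r /\ enorm (bval (p g) - eta) < r]].
Proof.
move=> t0 pG ns.
pose F : set_system (hyp R n -> hyp R n) := [set A | sparse t (~` A)].
have FF : ProperFilter F.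
  apply: Build_ProperFilter; first by rewrite /F/= setC0.
  split.
  - by rewrite /F/= setCT; exact: sparse0.
  - by move=> A B; rewrite /F/= setCI; exact: sparseU.
  - by move=> A B AB; apply: sparseS; exact: subsetC.
have [xi xicl] := ball_cluster FF (fun g => ltW (bval_lt1 (g o0))).
(* The trace of F on the elements with g 0 near xi, proper because xi is a cluster point; eta is
   then found along these elements. *)
pose F2 : set_system (hyp R n -> hyp R n) := [set A | exists2 e : R, 0 < e &
  F (A `|` [set g | e <= enorm (bval (g o0) - xi)])].
have F2F : ProperFilter F2.
  apply: Build_ProperFilter.
    move=> [e e0]; rewrite set0U => Fe; have [g /= ge] := xicl e _ e0 Fe.
    by rewrite ltNge ge.
  split.
  - by exists 1 => //; rewrite setTU; exact: filterT.
  - move=> A B [e e0 Ae] [d d0 Bd]; exists (Num.min e d); first by rewrite lt_min e0.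
    apply: filterS (filterI Ae Bd) => g [[Ag|/= ge] [Bg|/= gd]].
    + by left.
    + by right; rewrite /= ge_min gd orbT.
    + by right; rewrite /= ge_min ge.
    + by right; rewrite /= ge_min ge.
  - move=> A B AB [e e0 Ae]; exists e => //; apply: filterS Ae => g [Ag|ge].
      by left; exact: AB.
    by right.
have [eta etacl] := ball_cluster F2F (fun g => ltW (bval_lt1 (p g))).
have heavy r : 0 < r -> ~ sparse t
    [set g | enorm (bval (g o0) - xi) < r /\ enorm (bval (p g) - eta) < r].
  move=> r0 sp.
  have Fr : F2 [set g | r <= enorm (bval (p g) - eta)].
    exists r => //; rewrite /F/=; apply: sparseS sp => g /= /not_orP[/= h1 h2].
    by rewrite !ltNge; split; apply/negP.
  have [g /= gr] := etacl _ _ r0 Fr.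
  by rewrite ltNge gr.
have wit r : 0 < r -> exists g, [/\ G g, enorm (bval (g o0) - xi) < r &
    enorm (bval (p g) - eta) < r].
  move=> r0; apply: contrapT => ng; apply: (heavy r r0).
  exists 0 => k [|g l] _ lT; first by rewrite mul0r.
  by have [[h1 h2] [Gg _]] := lT g (mem_head _ _); exfalso; apply: ng; exists g.
have le1 (v : 'rV[R]_n.+1) (q : (hyp R n -> hyp R n) -> hyp R n) :
    (forall r, 0 < r -> exists g, enorm (bval (q g) - v) < r) -> enorm v <= 1.
  move=> qv; apply/ler_addgt0Pr => e e0; have [g h] := qv e e0.
  have := enorm_dist v (bval (q g)); rewrite (enormB v) ler_norml => /andP[_].
  by have := bval_lt1 (q g); lra.
exists xi, eta; split=> //.
- apply/eqP; rewrite eq_le (le1 _ (fun g => g o0)) => [/=|r /wit[g [_ h _]]]; last first.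
    by exists g.
  rewrite leNgt; apply/negP => xi1; have r0 : 0 < (1 - enorm xi) / 2 by lra.
  apply: (heavy _ r0); apply: (sparse_bounded (r := ln (8 / (1 - enorm xi)))) => //.
  by move=> g _ [h _]; exact: hdist_interior.
- apply/eqP; rewrite eq_le (le1 _ p) => [/=|r /wit[g [_ _ h]]]; last first.
    by exists g.
  rewrite leNgt; apply/negP => eta1; have r0 : 0 < (1 - enorm eta) / 2 by lra.
  apply: (heavy _ r0); apply: (sparse_bounded (r := ln (8 / (1 - enorm eta)))) => //.
  move=> g Gg [_ h]; apply: le_trans (hdist_interior eta1 h).
  by rewrite -(kleinian_isometric kG Gg o0 (p g)) pG// hdistC.
Qed.

Lemma geometric_sum_le (q : R) K : 0 <= q -> q < 1 ->
  \sum_(k < K) q ^+ k <= (1 - q)^-1.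
Proof.
move=> q0 q1; have d0 : 0 < 1 - q by lra.
rewrite -[leRHS]mul1r ler_pdivlMr//.
have -> : (\sum_(k < K) q ^+ k) * (1 - q) = 1 - q ^+ K.
  elim: K => [|K IH]; first by rewrite big_ord0 mul0r expr0 subrr.
  by rewrite big_ord_recr/= mulrDl IH exprS; ring.
by rewrite lerBlDr lerDl exprn_ge0.
Qed.

(** Sorted by annulus, the sum is dominated by that of C exp(t k) exp(-s k). *)
Lemma sparse_sum_le t s (C : R) l : 0 <= s -> t < s ->
  (forall (k : nat) l, uniq l -> (forall g, g \in l -> annulus k g) ->
     (size l)%:R <= C * expR (t * k%:R)) ->
  uniq l -> (forall g, g \in l -> G g) -> 0 <= C ->
  \sum_(g <- l) expR (- s * hdist o0 (g o0)) <= C * (1 - expR (t - s))^-1.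
Proof.
move=> s0 ts hC lu lG C0.
pose kk g := Num.trunc (hdist o0 (g o0)).
have kkP g : (kk g)%:R <= hdist o0 (g o0) < (kk g).+1%:R.
  exact: truncn_itv (hdist_ge0 _ _).
pose K := (\max_(g <- l) kk g).+1.
have kK g : g \in l -> (kk g < K)%N.
  by move=> gl; rewrite ltnS; exact: leq_bigmax_seq.
apply: (@le_trans _ _ (\sum_(g <- l) \sum_(k < K)
    if kk g == k :> nat then expR (- s * k%:R) else 0)).
  rewrite big_seq [leRHS]big_seq; apply: ler_sum => g gl.
  rewrite (bigD1 (Ordinal (kK g gl)))//= eqxx big1 ?addr0 => [|k kne]; last first.
    by case: eqP => // e; move: kne; rewrite -val_eqE /= e eqxx.
  have /andP[h _] := kkP g.
  by rewrite ler_expR !mulNr lerN2 ler_wpM2l.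
rewrite exchange_big/=.
apply: (@le_trans _ _ (\sum_(k < K) C * expR (t - s) ^+ k)); last first.
  by rewrite -mulr_sumr ler_wpM2l// geometric_sum_le ?expR_ge0// -expR0 ltr_expR; lra.
apply: ler_sum => k _; rewrite -big_mkcond/= big_const_seq iter_addr_0.
rewrite -[leLHS]mulr_natr -size_filter.
have -> : expR (t - s) ^+ k = expR (t * k%:R) * expR (- s * k%:R).
  by rewrite -expRD -mulrDl expRM powR_mulrn ?expR_ge0.
rewrite mulrA mulrC ler_wpM2r ?expR_ge0//; apply: hC; first exact: filter_uniq.
move=> g; rewrite mem_filter => /andP[/eqP <- gl]; split; first exact: lG.
exact: kkP.
Qed.

Lemma critical_exponent_le_sparse t x y : 0 <= t -> sparse t setT ->
  (critical_exponent G x y <= t%:E)%E.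
Proof.
move=> t0 [C hC]; apply/lee_addgt0Pr => e e0; rewrite -EFinD.
pose s := t + e; apply: ereal_inf_lbound; exists s => //=.
have s0 : 0 < s by rewrite /s; lra.
split=> //.
have C0 : 0 <= C.
  by have := hC 0%N [::] isT; rewrite mulr0 expR0 mulr1; apply.
pose D := hdist o0 x + hdist y o0.
apply: (@le_lt_trans _ _ (expR (s * D) * (C * (1 - expR (t - s))^-1))%:E); last exact: ltry.
apply: ge_ereal_sup => _ [A [Afin AG] <-].
have [l lu lA] : exists2 l, uniq l & A = [set` l].
  have /finite_seqP[l ->] := Afin; exists (undup l); first exact: undup_uniq.
  by apply/seteqP; split=> g /=; rewrite mem_undup.
have lG g : g \in l -> G g by move=> gl; apply: AG; rewrite lA.
rewrite lA -fsbig_seq// sumEFin lee_fin.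
have term g : g \in l ->
    expR (- s * hdist (g x) y) <= expR (s * D) * expR (- s * hdist o0 (g o0)).
  move=> /lG Gg; rewrite -expRD ler_expR !mulNr -mulrBr -mulrN ler_wpM2l ?(ltW s0)//.
  have t1 := hdist_triangle (g o0) (g x) o0.
  have t2 := hdist_triangle (g x) y o0.
  rewrite (kleinian_isometric kG Gg) in t1.
  by rewrite /D (hdistC o0 (g o0)); lra.
have sum1 : \sum_(g <- l) expR (- s * hdist (g x) y) <=
    \sum_(g <- l) expR (s * D) * expR (- s * hdist o0 (g o0)).
  by rewrite big_seq [leRHS]big_seq; apply: ler_sum => g; exact: term.
apply: le_trans sum1 _; rewrite -mulr_sumr ler_wpM2l ?expR_ge0//.
apply: (sparse_sum_le (ltW s0)) => //.
- by rewrite /s; lra.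
- by move=> k l' lu' lA'; apply: hC => // g /lA'.
Qed.

End orbit_growth.

(** * Ping-pong *)

(** Greedy selection: keep the first element, discard the at most N later ones close to it, and
    continue; each kept element accounts for at most N + 1 elements of l. *)
Lemma sparse_subseq {T : eqType} (close : rel T) (N : nat) (l : seq T) :
  symmetric close -> uniq l ->
  (forall x l', x \in l -> uniq l' ->
     (forall y, y \in l' -> (y \in l) && close x y) -> (size l' <= N)%N) ->
  exists s, [/\ uniq s, {subset s <= l},
    (forall x y, x \in s -> y \in s -> x != y -> ~~ close x y) &
    (size l <= N.+1 * size s)%N].
Proof.
move=> symc; have [k] := ubnP (size l); elim: k l => // k IH [|x l] /=.
  by move=> _ _ _; exists [::]; split.
rewrite ltnS => lk /andP[xl lu] hN.
pose l1 := [seq y <- l | ~~ close x y].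
have l1k : (size l1 < k)%N by apply: leq_ltn_trans lk; rewrite size_filter count_size.
have l1l y : y \in l1 -> y \in l by rewrite mem_filter => /andP[].
have [|y l' yl1 l'u l'l|s [su sl1 sfar ls]] := IH l1 l1k.
- exact: filter_uniq.
- apply: (hN y) => //; first by rewrite inE l1l// orbT.
  by move=> z /l'l/andP[zl1 ->]; rewrite inE l1l// orbT.
exists (x :: s); split=> /=.
- by rewrite su andbT; apply: contra xl => /sl1/l1l.
- by move=> y; rewrite !inE => /predU1P[->|/sl1/l1l ->]; rewrite ?eqxx ?orbT.
- have xfar y : y \in s -> ~~ close x y by move=> /sl1; rewrite mem_filter => /andP[].
  move=> y z; rewrite !inE => /predU1P[->|ys] /predU1P[->|zs]; rewrite ?eqxx//.
  + by move=> _; exact: xfar.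
  + by move=> _; rewrite symc; exact: xfar.
  + exact: sfar.
have cN : (count (close x) l <= N)%N.
  rewrite -size_filter; apply: (hN x); rewrite ?mem_head ?filter_uniq//.
  by move=> y; rewrite mem_filter inE => /andP[-> ->]; rewrite orbT.
rewrite mulnS -(count_predC (close x) l) -addSn leq_add//.
by apply: leq_trans ls; rewrite /l1 size_filter.
Qed.

Section ping_pong.
Context {R : realType} {n : nat} (G : set (hyp R n -> hyp R n)).
Hypothesis kG : kleinian G.
Implicit Types (x y z : hyp R n) (f g h : hyp R n -> hyp R n) (t r d : R).
Implicit Types (xi eta : 'rV[R]_n.+1).
Local Notation o0 := (@horigin R n).

(** For xi other than eta the identity will do; otherwise an element not fixing xi throws a
    neighbourhood of xi off xi. A small r also keeps z out of the image, since f^-1 z lies inside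
    the ball, away from xi. *)
Lemma push_away z xi eta : non_elementary G z -> enorm xi = 1 -> enorm eta = 1 ->
  exists f r, [/\ G f, 0 < r, 2 * r <= enorm (bval z - eta) & forall y,
    enorm (bval y - xi) <= 2 * r -> 2 * r <= enorm (bval (f y) - eta) /\ f y <> z].
Proof.
move=> ne xi1 eta1.
have [f [d [Gf d0 fd]]] : exists f d, [/\ G f, 0 < d & forall y,
    enorm (bval y - xi) < d -> d <= enorm (bval (f y) - eta)].
  have [<-|/eqP xe] := eqVneq xi eta.
    have [f Gf nfix] := no_global_fixed_point kG xi1 ne.
    have /existsNP[d /not_implyP[d0 nd]] : ~ (forall d : R, 0 < d -> exists x,
        enorm (bval x - xi) < d /\ enorm (bval (f x) - xi) < d) by [].
    exists f, d; split=> // y yd; rewrite leNgt; apply/negP => fyd.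
    by apply: nd; exists y.
  exists id, (enorm (xi - eta) / 2); split; first by case: kG => -[].
    rewrite divr_gt0// lt_neqAle enorm_ge0 andbT eq_sym; apply/eqP => /enorm_eq0/eqP.
    by rewrite subr_eq0 => /eqP.
  move=> y yd; have := enorm_triangle xi (bval y) eta.
  by rewrite (enormB xi (bval y)); lra.
have [f' [Gf' ff' f'f]] := kleinian_inv kG Gf.
pose a := enorm (bval (f' z) - xi); pose b := enorm (bval z - eta).
have a0 : 0 < a by exact: enorm_boundary_gt0.
have b0 : 0 < b by exact: enorm_boundary_gt0.
pose r := Num.min (d / 3) (Num.min (a / 3) (b / 3)).
have r0 : 0 < r by rewrite !lt_min !divr_gt0.
have rd : r <= d / 3 by rewrite ge_min lexx.
have ra : r <= a / 3 by rewrite !ge_min lexx !orbT.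
have rb : r <= b / 3 by rewrite !ge_min lexx !orbT.
exists f, r; split=> //; first by rewrite -/b; lra.
move=> y yr; split; first by apply: le_trans (fd y _); lra.
move=> fyz; have : a <= 2 * r by rewrite /a -fyz ff'.
lra.
Qed.

(** * Words of the ping-pong *)

Section schottky.
Context {M : nat} (h : 'I_M -> hyp R n -> hyp R n) (z : hyp R n).
Context (eta : 'rV[R]_n.+1) (r c L : R).
Hypothesis Gh : forall i, G (h i).
Hypothesis hL : forall i, hdist o0 (h i o0) <= L.
Hypothesis zr : r <= enorm (bval z - eta).
Hypothesis hr : forall i x, r <= enorm (bval x - eta) ->
  r <= enorm (bval (h i x) - eta) /\ h i x <> z.
Hypothesis hc : forall i j x y, i != j -> r <= enorm (bval x - eta) ->
  r <= enorm (bval y - eta) -> c <= enorm (bval (h i x) - bval (h j y)).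

(** The first letter acts last, so that a common prefix of two words is a common outer map and can
    be stripped. *)
Fixpoint act (m : nat) (w : nat -> 'I_M) : hyp R n :=
  if m is k.+1 then h (w 0%N) (act k (w \o succn)) else z.

Lemma act_far m w : r <= enorm (bval (act m w) - eta).
Proof. by elim: m w => [//|m IH] w /=; have [] := hr (w 0%N) (IH (w \o succn)). Qed.

(** Strip the common letters until the shorter word is exhausted; z is not the image under any h i
    of a point far from eta. *)
Lemma act_neq m k w : (m < k)%N -> act m w <> act k w.
Proof.
elim: m k w => [|m IH] [|k] w //= mk.
  by have [_ hz] := hr (w 0%N) (act_far k (w \o succn)) => e; apply: hz.
have [h' [_ hK _]] := kleinian_inv kG (Gh (w 0%N)).
by move=> /(congr1 h'); rewrite !hK; exact: IH.
Qed.

Lemma act_in m w : exists2 b, G b & act m w = b z.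
Proof.
elim: m w => [|m IH] w /=; first by exists id => //; case: kG => -[].
have [b Gb ->] := IH (w \o succn).
by exists (h (w 0%N) \o b) => //; exact: (kleinian_comp kG).
Qed.

(** Each of the j common letters shrinks distances by a factor of at least exp(-L), by
    [isometric_lipschitz]; the first different letters give c. *)
Lemma act_separated j m k (w v : nat -> 'I_M) :
  (forall i, (i < j)%N -> w i = v i) -> w j <> v j -> (j < m)%N -> (j < k)%N ->
  c * expR (- (j%:R * L)) <= enorm (bval (act m w) - bval (act k v)).
Proof.
elim: j m k w v => [|j IH] [|m] [|k] w v //= wv wvj jm jk.
  rewrite mul0r oppr0 expR0 mulr1; apply: hc; rewrite ?act_far//.
  exact/eqP.
rewrite -(wv 0%N)//.
have hi := kleinian_isometric kG (Gh (w 0%N)).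
have IHj := IH m k (w \o succn) (v \o succn) (fun i ij => wv i.+1 ij) wvj jm jk.
have lip := isometric_lipschitz (act m (w \o succn)) (act k (v \o succn)) hi.
rewrite -natr1 mulrDl mul1r opprD expRD mulrA.
rewrite -(ler_pM2l (expR_gt0 L)).
have -> : expR L * (c * expR (- (j%:R * L)) * expR (- L)) = c * expR (- (j%:R * L)).
  by rewrite mulrCA -expRD subrr expR0 mulr1.
apply: le_trans IHj (le_trans lip _).
by rewrite ler_wpM2r ?enorm_ge0// ler_expR.
Qed.

(** Cluster points suffice, since the separation is uniform in the length of the words. One inside
    the ball would leave infinitely many of the distinct points [act m w] in a bounded region,
    against discreteness. *)
Lemma schottky_limit_points : exists pi : (nat -> 'I_M) -> 'rV[R]_n.+1,
  (forall w, limit_set G z (pi w)) /\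
  (forall w v j, (forall i, (i < j)%N -> w i = v i) -> w j <> v j ->
     c * expR (- (j%:R * L)) <= enorm (pi w - pi v)).
Proof.
have /choice[pi piP] w : exists v : 'rV[R]_n.+1, forall (e : R) (K : nat), 0 < e ->
    exists2 m, (K <= m)%N & enorm (bval (act m w) - v) < e.
  have [v vcl] := @ball_cluster _ _ _ \oo (fun m => bval (act m w)) _
    (fun m => ltW (bval_lt1 _)).
  by exists v => e K e0; apply: vcl => //; exact: nbhs_infty_ge.
exists pi; split=> [w|w v j wv wvj]; last first.
  apply/ler_addgt0Pr => e e0; have e2 : 0 < e / 2 by rewrite divr_gt0.
  have [m jm wm] := piP w _ j.+1 e2; have [k jk vk] := piP v _ j.+1 e2.
  apply: le_trans (act_separated wv wvj jm jk) _.
  have t1 := enorm_triangle (bval (act m w)) (pi w) (bval (act k v)).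
  have t2 := enorm_triangle (pi w) (pi v) (bval (act k v)).
  by rewrite (enormB (pi v) (bval _)) in t2; lra.
have pi1 : enorm (pi w) = 1.
  apply/eqP; rewrite eq_le; apply/andP; split.
    apply/ler_addgt0Pr => e e0; have [m _ hm] := piP w e 0%N e0.
    have := enorm_dist (pi w) (bval (act m w)); rewrite (enormB (pi w)) ler_norml.
    by move=> /andP[_]; have := bval_lt1 (act m w); lra.
  rewrite leNgt; apply/negP => lt1.
  have e0 : 0 < (1 - enorm (pi w)) / 2 by lra.
  have /choice[phi phiP] K : exists m, (K <= m)%N /\
      enorm (bval (act m w) - pi w) < (1 - enorm (pi w)) / 2.
    by have [m Km hm] := piP w _ K e0; exists m.
  pose mm := fix mm i := if i is k.+1 then phi (mm k).+1 else phi 0%N.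
  have mmS i : (mm i < mm i.+1)%N by have [] := phiP (mm i).+1.
  have mm_lt i j : (i < j)%N -> (mm i < mm j)%N by apply: (homo_ltn ltn_trans mmS).
  have mm_near i : enorm (bval (act (mm i) w) - pi w) < (1 - enorm (pi w)) / 2.
    by case: i => [|i] /=; [have [] := phiP 0%N|have [] := phiP (mm i).+1].
  pose Q := ln (8 / (1 - enorm (pi w))) + hdist z o0.
  pose A := (fun b => b z) @` [set b | G b /\ hdist o0 (b o0) <= Q].
  have finA : finite_set A by apply: finite_image; exact: kleinian_finite.
  have inA i : A (act (mm i) w).
    have [b Gb e] := act_in (mm i) w; exists b => //; split=> //.
    have h1 := hdist_interior lt1 (mm_near i).
    have t1 := hdist_triangle o0 (b z) (b o0).
    by rewrite e in h1; rewrite (kleinian_isometric kG Gb) in t1; rewrite /Q; lra.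
  have [i [j [ij eij]]] := finite_set_repeats finA inA.
  exact: (act_neq (mm_lt i j ij) eij).
split=> // U /nbhs_enormP[e e0 eU]; have [m _ hm] := piP w e 0%N e0.
exists (bval (act m w)); split; last exact: eU.
- apply/eqP => e1; have := bval_lt1 (act m w).
  by rewrite e1 pi1 ltxx.
- by exists (act m w) => //; have [b Gb ->] := act_in m w; exists b.
Qed.

End schottky.

Lemma hausdorff_limit_set_neq0 z t : non_elementary G z -> 0 < t ->
  ~ sparse G t setT -> hausdorff_measure t (limit_set G z) <> 0%E.
Proof.
move=> ne t0 ns.
have [p pG] := inverse_point kG.
have [xi [eta [xi1 eta1 heavy]]] := heavy_pair kG (ltW t0) pG ns.
have [f [rho [Gf rho0 zrho frho]]] := push_away ne xi1 eta1.
have fi := kleinian_isometric kG Gf.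
pose lf := hdist o0 (f o0); have lf0 : 0 <= lf := hdist_ge0 _ _.
(* For g, h in annulus k with g 0 and h 0 within 3 r, where r = 4 exp(-k) / rho, one has hq <= 9 r^2
   exp(2 k + 2) = K. So N bounds the number of h close to a given g, by counting the elements g^-1
   h. *)
pose K := 144 * expR 1 ^+ 2 / rho ^+ 2.
have [N hN] := kleinian_count (arcosh (1 + 2 * K)) kG.
pose k0 := (Num.trunc (4 / rho ^+ 2)).+1.
have [N0 hN0] := kleinian_count k0.+1%:R kG.
(* The first term leaves at least exp(t L) maps after a selection of one in N + 1, with L = lf + k +
   1; the second forces k >= k0, which ensures r <= rho. *)
pose C := N.+1%:R * expR (t * (1 + lf)) + N0%:R.
have [k [l [lu lT lC]]] : exists k l, [/\ uniq l, (forall g, g \in l ->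
    (enorm (bval (g o0) - xi) < rho /\ enorm (bval (p g) - eta) < rho) /\
    annulus G k g) & C * expR (t * k%:R) < (size l)%:R].
  apply: contrapT => nkl; apply: (heavy rho rho0); exists C => k l lu lT.
  by rewrite leNgt; apply/negP => h; apply: nkl; exists k, l.
have Ek : 1 <= expR (t * k%:R) by rewrite -expR0 ler_expR mulr_ge0// ltW.
have C1 : 0 < N.+1%:R * expR (t * (1 + lf)) by rewrite mulr_gt0// expR_gt0.
have kk0 : (k0 <= k)%N.
  rewrite leqNgt; apply/negP => kk0; have : (size l <= N0)%N.
    apply: hN0 => // g /lT[_ [Gg /andP[_ gk]]]; split=> //.
    by apply: le_trans (ltW gk) _; rewrite ler_nat ltnW.
  rewrite -(ler_nat R) => h; have : C <= C * expR (t * k%:R).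
    by rewrite ler_peMr// addr_ge0// ltW.
  by rewrite {1}/C; lra.
(* Points at least 2 rho away from eta are rho away from p g, and om (p g) <= 4 exp(-k), so by
   [isometric_contract] g maps them into the ball of radius r about g 0. *)
pose r := 4 * expR (- k%:R) / rho.
have r0 : 0 < r by rewrite divr_gt0// mulr_gt0// expR_gt0.
have rrho : r <= rho.
  rewrite /r ler_pdivrMr// expRN ler_pdivrMr ?expR_gt0//.
  have q0 : 0 <= 4 / rho ^+ 2 by rewrite divr_ge0// exprn_ge0// ltW.
  have /andP[_ /ltW] := truncn_itv q0; rewrite -/k0 ler_pdivrMr ?exprn_gt0// => h.
  have h1 : (k0%:R : R) <= expR k%:R.
    apply: le_trans (_ : k%:R <= _); first by rewrite ler_nat.
    by have := expR_ge1Dx (k%:R : R); lra.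
  have : k0%:R * rho ^+ 2 <= expR k%:R * rho ^+ 2 by rewrite ler_pM2r// exprn_gt0.
  by rewrite -expr2 => h2; rewrite mulrC; apply: le_trans h h2.
(* Centres 3 r apart leave a gap of r between the balls of radius r that contain the images. *)
pose close g h := `[< enorm (bval (g o0) - bval (h o0)) < 3 * r >].
have closeC : symmetric close by move=> g h; rewrite /close enormB.
have [|s [su sl sfar ls]] := sparse_subseq (N := N) closeC lu.
  move=> g l' gl l'u l'l.
  have [[_ _] [Gg /andP[gk gk1]]] := lT g gl.
  have [g' [Gg' gg' g'g]] := kleinian_inv kG Gg.
  rewrite -(size_map (fun h => g' \o h)); apply: hN.
    rewrite map_inj_uniq// => h1 h2 e; apply/funext => x.
    by have := congr1 (fun u => g (u x)) e; rewrite /= !g'g.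
  move=> _ /mapP[h /l'l/andP[hl /asboolP hclose] ->].
  have [[_ _] [Gh /andP[hk hk1]]] := lT h hl.
  split; first exact: (kleinian_comp kG).
  rewrite -(kleinian_isometric kG Gg) /= g'g; apply: hdist_le_hq.
  rewrite /hq ler_pdivrMr ?mulr_gt0 ?om_gt0//.
  have omk u : hdist o0 u < k.+1%:R -> expR (- k%:R) <= expR 1 * om u.
    move=> uk; have : expR (- k%:R) <= expR 1 * expR (- hdist o0 u).
      by rewrite -expRD ler_expR; rewrite -natr1 in uk; lra.
    by move/le_trans; apply; rewrite ler_pM2l ?expR_gt0// om_ge.
  have o1 := omk _ gk1; have o2 := omk _ hk1.
  have e1 : enorm (bval (g o0) - bval (h o0)) ^+ 2 <= (3 * r) ^+ 2.
    have r3 : 0 <= 3 * r by rewrite mulr_ge0// ltW.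
    by rewrite lerXn2r ?nnegrE ?enorm_ge0// ltW.
  apply: le_trans e1 _.
  have -> : (3 * r) ^+ 2 = 144 / rho ^+ 2 * (expR (- k%:R) * expR (- k%:R)).
    by rewrite /r; field; rewrite gt_eqF.
  have -> : K * (om (g o0) * om (h o0)) =
      144 / rho ^+ 2 * ((expR 1 * om (g o0)) * (expR 1 * om (h o0))).
    by rewrite /K; field; rewrite gt_eqF.
  rewrite ler_pM2l ?divr_gt0 ?exprn_gt0//.
  by apply: ler_pM => //; exact: expR_ge0.
pose L := lf + k.+1%:R.
have L0 : 0 < L by rewrite ltr_wpDl.
have tL : expR (t * L) <= (size s)%:R.
  have h1 : (size l)%:R <= N.+1%:R * (size s)%:R :> R by rewrite -natrM ler_nat.
  have h2 : N.+1%:R * expR (t * (1 + lf)) * expR (t * k%:R) <= C * expR (t * k%:R).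
    by rewrite ler_pM2r ?expR_gt0// lerDl.
  rewrite -(ler_pM2l (_ : 0 < N.+1%:R))//; apply: ltW.
  apply: le_lt_trans (lt_le_trans lC h1); apply: le_trans h2.
  have -> : t * L = t * (1 + lf) + t * k%:R by rewrite /L -natr1; ring.
  by rewrite expRD mulrA.
pose gg (i : 'I_(size s)) := nth id s i.
have gs i : gg i \in s by exact: mem_nth.
have gl i : gg i \in l by exact: sl.
have contract i x : 2 * rho <= enorm (bval x - eta) ->
    enorm (bval (gg i x) - bval (gg i o0)) <= r.
  move=> xr; have [[_ pr] [Gg /andP[gk _]]] := lT _ (gl i).
  have gi := kleinian_isometric kG Gg.
  have xp : rho <= enorm (bval x - bval (p (gg i))).
    by have := enorm_triangle (bval x) (bval (p (gg i))) eta; lra.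
  have op : om (p (gg i)) <= 4 * expR (- k%:R).
    apply: le_trans (om_le _) _; rewrite ler_pM2l// ler_expR lerN2.
    by rewrite -(gi o0 (p (gg i))) (pG _ Gg) hdistC.
  rewrite /r ler_pdivlMr//; apply: le_trans op.
  apply: le_trans (isometric_contract x gi (pG _ Gg)).
  by rewrite ler_wpM2l ?enorm_ge0.
pose hh i := f \o gg i.
have hG i : G (hh i).
  by apply: (kleinian_comp kG) => //; have [_ []] := lT _ (gl i).
have hL i : hdist o0 (hh i o0) <= L.
  apply: le_trans (hdist_triangle _ (f o0) _) _; rewrite /hh /= fi lerD// ltW//.
  by have [_ [_ /andP[]]] := lT _ (gl i).
have hfar i x : 2 * rho <= enorm (bval x - eta) ->
    2 * rho <= enorm (bval (hh i x) - eta) /\ hh i x <> z.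
  move=> xr; apply: frho; have [[gx _] _] := lT _ (gl i); have cx := contract i x xr.
  by have := enorm_triangle (bval (gg i x)) (bval (gg i o0)) xi; lra.
have hsep i j x y : i != j -> 2 * rho <= enorm (bval x - eta) ->
    2 * rho <= enorm (bval y - eta) ->
    expR (- lf) * r <= enorm (bval (hh i x) - bval (hh j y)).
  move=> ij xr yr; have cx := contract i x xr; have cy := contract j y yr.
  have lip := isometric_lipschitz (gg i x) (gg j y) fi.
  have gij : gg i != gg j by rewrite nth_uniq.
  have /asboolPn/negP := sfar _ _ (gs i) (gs j) gij; rewrite -leNgt => far.
  have t1 := enorm_triangle (bval (gg i o0)) (bval (gg i x)) (bval (gg j o0)).
  have t2 := enorm_triangle (bval (gg i x)) (bval (gg j y)) (bval (gg j o0)).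
  rewrite (enormB (bval (gg i o0)) (bval (gg i x))) in t1.
  rewrite expRN mulrC ler_pdivrMr ?expR_gt0// mulrC.
  by apply: le_trans lip; lra.
have c0 : 0 < expR (- lf) * r by rewrite mulr_gt0// expR_gt0.
have [pi [pilim pisep]] := schottky_limit_points hG hL zrho hfar hsep.
exact: (cantor_hausdorff c0 L0 t0 tL pilim pisep).
Qed.

End ping_pong.

Lemma critical_exponent_le_hausdorff {R : realType} {n : nat}
    (G : set (hyp R n -> hyp R n)) (o x y : hyp R n) :
  kleinian G -> non_elementary G o ->
  (critical_exponent G x y <= hausdorff_dim (limit_set G o))%E.
Proof.
move=> kG ne; apply: le_ereal_inf_tmp => _ [t [t0 Ht] <-].
apply: (critical_exponent_le_sparse kG) => //; first exact: ltW.
by apply: contrapT => ns; exact: (hausdorff_limit_set_neq0 kG ne t0 ns Ht).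
Qed.

Local Open Scope ereal_scope.

Theorem theorem3p5 (R : realType) (n : nat) (n_ge1 : (1 <= n)%N) :
  (forall (Lambda : set 'rV[R]_n.+1) (z : hyp R n) (e : R),
     closed Lambda -> Lambda `<=` unit_sphere -> (0 < e)%R ->
     hausdorff_dim Lambda <= upper_box_dim Lambda /\
     upper_box_dim Lambda = convex_core_entropy z e Lambda) /\
  (forall (G : set (hyp R n -> hyp R n)) (o x y z : hyp R n) (e : R),
     kleinian G -> non_elementary G o -> (0 < e)%R ->
     [/\ critical_exponent G x y <= hausdorff_dim (limit_set G o),
         hausdorff_dim (limit_set G o) <= upper_box_dim (limit_set G o) &
         upper_box_dim (limit_set G o) = convex_core_entropy z e (limit_set G o)]).
Proof.
have dims (L : set 'rV[R]_n.+1) (z : hyp R n) (e : R) :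
    L `<=` unit_sphere -> (0 < e)%R ->
    hausdorff_dim L <= upper_box_dim L /\ upper_box_dim L = convex_core_entropy z e L.
  move=> LS e0; split; last exact: box_dim_eq_core_entropy.
  by apply: hausdorff_le_box => x /LS ->.
split=> [L z e _ LS e0|G o x y z e kG ne e0]; first exact: dims.
have [|h1 h2] := dims (limit_set G o) z e _ e0; first by move=> v [].
by split=> //; exact: critical_exponent_le_hausdorff.
Qed.
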